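(* Let $\mathcal{M}_x,\mathcal{M}_y$ be complete Riemannian manifolds, with $\mathcal{M}_y$ a Hadamard manifold whose sectional curvature is bounded below by $\tau<0$. Let $f,g:\mathcal{M}_x\times\mathcal{M}_y\to\mathbb{R}$ and constants $\mu,l_f,L_f,L_g,\rho>0$ be such that on $\mathcal{U}=\mathcal{U}_x\times\mathcal{U}_y$: $f$ is continuously differentiable and $g$ is twice continuously differentiable; $g(x,\cdot)$ is $\mu$-geodesically strongly convex on $\mathcal{U}_y$ for every $x\in\mathcal{U}_x$; $f$ is $l_f$-Lipschitz; $\mathcal{G}_xf,\mathcal{G}_yf$ are $L_f$-Lipschitz; $\mathcal{G}_xg,\mathcal{G}_yg$ are $L_g$-Lipschitz; $\mathcal{H}_yg,\mathcal{G}^2_{xy}g,\mathcal{G}^2_{yx}g$ are $\rho$-Lipschitz. Assume that the minimum $F^*$ of $F(x)=f(x,y^*(x))$ over $\mathcal{M}_x$ is bounded below ($F^*>-\infty$), and that $\zeta(\tau,d(y_t^k,y^*(x_t)))\le\zeta$ for some constant $\zeta$ and all lower-level iterates $y_t^k$. Then the sequence $\{x_t\}_{t=0}^T$ generated by the AdaRHD algorithm (either variant) satisfies $$\frac1T\sum_{t=0}^{T-1}\|\mathcal{G}F(x_t)\|_{x_t}^2\le\frac{C}{T}=\mathcal{O}\!\left(\frac1T\right),$$ where $$C=\Big(F_0+\frac{2\bar L^2}{a_0\mu^2}\Big)\Big(C_a+2\Big(F_0+\frac{2\bar L^2}{a_0\mu^2}\Big)\Big),$$ with $L_F=\big(L_f+\frac{\rho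 l_f}{\mu}\big)\big(1+\frac{L_g}{\mu}\big)^2$, $C_a=\max\{2L_F,a_0\}$, $F_0=2(F(x_0)-F^* )+\frac{L_FC_a^2}{a_0^2}$, $L_1=L_f+\frac{l_f\rho}{\mu}+L_g\big(\frac{L_f}{\mu}+\frac{l_f\rho}{\mu^2}\big)$ and $\bar L=\max\{\sqrt2L_1,\sqrt2L_g\}$.
   Context: Notation. For a Riemannian manifold, $\langle\cdot,\cdot\rangle_z,\|\cdot\|_z$ are the metric and norm on the tangent space at $z$ (the latter also denotes operator norms), $d$ is the Riemannian distance, $\operatorname{Exp}$ the exponential map, $\operatorname{Exp}_z^{-1}$ its inverse (logarithm), $\mathcal{P}_{z}^{z'}$ parallel transport from $T_z$ to $T_{z'}$ along the minimizing geodesic. For $h(x,y)$ on $\mathcal{M}_x\times\mathcal{M}_y$: $\mathcal{G}_xh,\mathcal{G}_yh$ are the partial Riemannian gradients, $\mathcal{H}_yh(x,y):T_y\mathcal{M}_y\to T_y\mathcal{M}_y$ is the Riemannian Hessian in $y$, and $\mathcal{G}^2_{xy}h(x,y):T_y\mathcal{M}_y\to T_x\mathcal{M}_x$ (derivative of $\mathcal{G}_xh$ in $y$), $\mathcal{G}^2_{yx}h(x,y):T_x\mathcal{M}_x\to T_y\mathcal{M}_y$ are the Riemannian cross derivatives. Lipschitz conventions on $\mathcal{U}$. The gradients $\mathcal{G}_xh,\mathcal{G}_yh$ are $L$-Lipschitz if $\|\mathcal{P}_{y_1}^{y_2}\mathcal{G}_yh(x,y_1)-\mathcal{G}_yh(x,y_2)\|_{y_2}\le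 Ld(y_1,y_2)$, $\|\mathcal{G}_xh(x,y_1)-\mathcal{G}_xh(x,y_2)\|_x\le Ld(y_1,y_2)$, $\|\mathcal{P}_{x_1}^{x_2}\mathcal{G}_xh(x_1,y)-\mathcal{G}_xh(x_2,y)\|_{x_2}\le Ld(x_1,x_2)$, $\|\mathcal{G}_yh(x_1,y)-\mathcal{G}_yh(x_2,y)\|_y\le Ld(x_1,x_2)$. An operator $\mathcal{G}(x,y):T_y\mathcal{M}_y\to T_x\mathcal{M}_x$ is $\rho$-Lipschitz if $\|\mathcal{P}_{x_1}^{x_2}\mathcal{G}(x_1,y)-\mathcal{G}(x_2,y)\|_{x_2}\le\rho d(x_1,x_2)$ and $\|\mathcal{G}(x,y_1)-\mathcal{G}(x,y_2)\mathcal{P}_{y_1}^{y_2}\|_x\le\rho d(y_1,y_2)$ (similarly with the roles of $x,y$ exchanged); $\mathcal{H}(x,y):T_y\mathcal{M}_y\to T_y\mathcal{M}_y$ is $\rho$-Lipschitz if $\|\mathcal{P}_{y_1}^{y_2}\mathcal{H}(x,y_1)\mathcal{P}_{y_2}^{y_1}-\mathcal{H}(x,y_2)\|_{y_2}\le\rho d(y_1,y_2)$ and $\|\mathcal{H}(x_1,y)-\mathcal{H}(x_2,y)\|_y\le\rho d(x_1,x_2)$. Region. $\mathcal{U}_x\subseteq\mathcal{M}_x$, $\mathcal{U}_y\subseteq\mathcal{M}_y$ are geodesically convex sets (points joined by unique minimizing geodesics inside the set) in which everything takes place: $y^*(x)\in\mathcal{U}_y$ for $x\in\mathcal{U}_x$,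 and all iterates, geodesic segments joining points under consideration, and (gradient) steps from them lie in $\mathcal{U}_x$, resp. $\mathcal{U}_y$. Problem. $\min_{x\in\mathcal{M}_x}F(x):=f(x,y^*(x))$, with $y^*(x)=\arg\min_{y\in\mathcal{M}_y}g(x,y)$. The Riemannian gradient (hypergradient) of $F$ is $\mathcal{G}F(x)=\mathcal{G}_xf(x,y^*(x))-\mathcal{G}^2_{xy}g(x,y^*(x))\,\mathcal{H}_y^{-1}g(x,y^*(x))[\mathcal{G}_yf(x,y^*(x))]$. Put $R(x,y,v)=\frac12\langle v,\mathcal{H}_yg(x,y)[v]\rangle_y-\langle v,\mathcal{G}_yf(x,y)\rangle_y$ for $v\in T_y\mathcal{M}_y$, so $\nabla_vR(x,y,v)=\mathcal{H}_yg(x,y)[v]-\mathcal{G}_yf(x,y)$, and $\widehat{\mathcal{G}}F(x,y,v)=\mathcal{G}_xf(x,y)-\mathcal{G}^2_{xy}g(x,y)[v]$. Curvature constant: $\zeta(\tau,c)=\frac{\sqrt{|\tau|}c}{\tanh(\sqrt{|\tau|}c)}$ for $\tau<0$. AdaRHD algorithm. Inputs: $x_0\in\mathcal{M}_x$, $y_0\in\mathcal{M}_y$, $v_0\in T_{y_0}\mathcal{M}_y$, $a_0,b_0,c_0>0$, integer $T\ge1$; tolerances $\epsilon_y=\epsilon_v=1/T$. For $t=0,\dots,T-1$: (1) Set $y_t^0=y_{t-1}^{K_{t-1}}$ if $t>0$, $y_0^0=y_0$. Starting from $k=0$ (with $b_0$ the input value, for each $t$), while $\|\mathcal{G}_yg(x_t,y_t^k)\|_{y_t^k}^2>\epsilon_y$: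 $b_{k+1}^2=b_k^2+\|\mathcal{G}_yg(x_t,y_t^k)\|_{y_t^k}^2$, $y_t^{k+1}=\operatorname{Exp}_{y_t^k}(-\frac1{b_{k+1}}\mathcal{G}_yg(x_t,y_t^k))$, $k\leftarrow k+1$. Let $K_t$ be the final $k$. (2) Variant AdaRHD-GD: set $v_t^0=\mathcal{P}_{y_{t-1}^{K_{t-1}}}^{y_t^{K_t}}v_{t-1}^{N_{t-1}}$ if $t>0$, and $v_0^0=v_0$ (transported to $T_{y_0^{K_0}}\mathcal{M}_y$); starting from $n=0$ and the input $c_0$, while $\|\nabla_vR(x_t,y_t^{K_t},v_t^n)\|^2_{y_t^{K_t}}>\epsilon_v$: $c_{n+1}^2=c_n^2+\|\nabla_vR(x_t,y_t^{K_t},v_t^n)\|^2_{y_t^{K_t}}$, $v_t^{n+1}=v_t^n-\frac1{c_{n+1}}\nabla_vR(x_t,y_t^{K_t},v_t^n)$, $n\leftarrow n+1$. Variant AdaRHD-CG: run the standard conjugate gradient method in $T_{y_t^{K_t}}\mathcal{M}_y$ on $\mathcal{H}_yg(x_t,y_t^{K_t})[v]=\mathcal{G}_yf(x_t,y_t^{K_t})$ from $v_t^0=0$, until $\|\nabla_vR(x_t,y_t^{K_t},v_t^n)\|^2_{y_t^{K_t}}\le\epsilon_v$. Let $N_t$ be the final $n$. (3) $a_{t+1}^2=a_t^2+\|\widehat{\mathcal{G}}F(x_t,y_t^{K_t},v_t^{N_t})\|_{x_t}^2$ and $x_{t+1}=\operatorname{Exp}_{x_t}(-\frac1{a_{t+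1}}\widehat{\mathcal{G}}F(x_t,y_t^{K_t},v_t^{N_t}))$.
   Formalization: The set U_y is additionally required to lie in the closure of its interior; otherwise (e.g. U_y a single point, g = |y|^4) strong convexity on U_y does not make the Hessian of g in y invertible and the hypergradient is undefined. *)

(* Defs.v *)
From HB Require Import structures.
From mathcomp Require Import all_boot all_order all_algebra.
From mathcomp Require Import all_classical all_reals all_analysis.
Set Implicit Arguments.
Unset Strict Implicit.
Unset Printing Implicit Defensive.
Import Order.TTheory GRing.Theory Num.Theory.
Import numFieldNormedType.Exports.
Local Open Scope classical_set_scope.
Local Open Scope ring_scope.

(* C^k on A, through iterated directional derivatives. It is applied to open
   subsets of finite-dimensional spaces, where existence and continuity of all
   directional derivatives up to order k is the usual C^k. *)
Fixpoint Ck (R : realType) (V W : normedModType R) (k : nat) (h : V -> W)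
    (A : set V) : Prop :=
  (forall a, A a -> {for a, continuous h}) /\
  (if k is k'.+1 then
     forall v, (forall a, A a -> derivable h a v) /\ Ck k' ('D_v h) A
   else True).

Definition Ck_near (R : realType) (V W : normedModType R) (k : nat)
    (h : V -> W) (a : V) : Prop :=
  exists A, [/\ open A, A a & Ck k h A].

Definition smooth (R : realType) (V W : normedModType R) (h : V -> W)
    (A : set V) : Prop := forall k, Ck k h A.

Definition ebasis (R : realType) (n : nat) (i : 'I_n) : 'rV[R]_n :=
  delta_mx ord0 i.

(* A connected n-dimensional Riemannian manifold. The atlas is indexed by the
   points: [chart p] is a chart whose domain [dom p] contains p, and [ichart p]
   is its inverse. A tangent vector at p is represented by its coordinates, a
   row vector, in the chart [chart p] preferred at p; [metric p] is the Gram
   matrix of the metric at p in these coordinates. For p in [dom q], the image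
   of v in T_p M by the differential of [chart q] is
   ['D_v (chart q \o ichart p) (chart p p)], so that the Gram matrix of the
   metric in [chart q] at the parameter u has the entries given in [metricC]. *)
Record riemannianManifold (R : realType) (n : nat) := RiemannianManifold {
  carrier :> topologicalType ;
  dom : carrier -> set carrier ;
  chart : carrier -> carrier -> 'rV[R]_n ;
  ichart : carrier -> 'rV[R]_n -> carrier ;
  metric : carrier -> 'M[R]_n ;
  manifold_hausdorff : hausdorff_space carrier ;
  manifold_countable : @second_countable carrier ;
  manifold_connected : connected [set: carrier] ;
  dom_open : forall p, open (dom p) ;
  dom_refl : forall p, dom p p ;
  chart_open : forall p, open (chart p @` dom p) ;
  chartK : forall p q, dom p q -> ichart p (chart p q) = q ;
  chart_continuous : forall p q, dom p q -> {for q, continuous (chart p)} ;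
  ichart_continuous : forall p q, dom p q ->
    {for chart p q, continuous (ichart p)} ;
  transition_smooth : forall p q,
    smooth (chart q \o ichart p) (chart p @` (dom p `&` dom q)) ;
  metric_sym : forall p, (metric p)^T = metric p ;
  metric_pos : forall p (v : 'rV[R]_n), v != 0 ->
    0 < (v *m metric p *m v^T) ord0 ord0 ;
  metricC : forall q, smooth (fun u : 'rV[R]_n => \matrix_(i < n, j < n)
      ('D_(ebasis R i) (chart (ichart q u) \o ichart q) u
       *m metric (ichart q u)
       *m ('D_(ebasis R j) (chart (ichart q u) \o ichart q) u)^T) ord0 ord0)
    (chart q @` dom q)
}.

Section Riemannian.
Context (R : realType) (n : nat) (M : riemannianManifold R n).
Implicit Types (p q z : M) (u v w : 'rV[R]_n) (c : R -> M).

Definition inner z v w : R := (v *m metric z *m w^T) ord0 ord0.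

Definition tnorm z v : R := Num.sqrt (inner z v v).

(* coordinates in the chart preferred at q of v in T_p M *)
Definition tcoord q p v : 'rV[R]_n :=
  'D_v (chart q \o ichart p) (chart p p).

(* Gram matrix of the metric in the chart preferred at q, at the parameter u *)
Definition gram q u : 'M[R]_n := \matrix_(i < n, j < n)
  inner (ichart q u)
    ('D_(ebasis R i) (chart (ichart q u) \o ichart q) u)
    ('D_(ebasis R j) (chart (ichart q u) \o ichart q) u).

(* sum_ij Gamma^k_ij v_i w_j e_k for the Levi-Civita connection, with
   Gamma^k_ij = 1/2 sum_l g^kl (d_i g_jl + d_j g_il - d_l g_ij) *)
Definition christoffel q u v w : 'rV[R]_n := \row_(k < n)
  (2^-1 * \sum_(l < n) (invmx (gram q u)) k l *
    ((w *m 'D_v (gram q) u) ord0 l + (v *m 'D_w (gram q) u) ord0 l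
     - (v *m 'D_(ebasis R l) (gram q) u *m w^T) ord0 ord0)).

Definition velocity c (s : R) : 'rV[R]_n := derive1 (chart (c s) \o c) s.

Definition C1_curve c : Prop :=
  continuous c /\
  forall s : R,
    (\forall r \near s, derivable (chart (c s) \o c) r 1) /\
    {for s, continuous (fun r => derive1 (chart (c s) \o c) r)}.

Definition arclength c : R :=
  \int[lebesgue_measure]_(s in `[0, 1]%classic) (tnorm (c s) (velocity c s)).

(* Piecewise C^1 path from p to q, as a chain of C^1 arcs parametrized by
   [0, 1] *)
Fixpoint piecewise_C1 p q (cs : seq (R -> M)) : Prop :=
  if cs is c :: cs' then
    [/\ C1_curve c, c 0 = p & piecewise_C1 (c 1) q cs']
  else p = q.

Definition dist p q : R :=
  inf [set l | exists2 cs, piecewise_C1 p q cs &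
                           l = \sum_(c <- cs) arclength c].

(* D/ds X for a vector field X along c, computed at s in the chart preferred
   at c(s) *)
Definition covderiv c (X : R -> 'rV[R]_n) (s : R) : 'rV[R]_n :=
  derive1 (fun r => tcoord (c s) (c r) (X r)) s
  + christoffel (c s) (chart (c s) (c s)) (velocity c s) (X s).

Definition parallel c (X : R -> 'rV[R]_n) : Prop := forall s : R,
  derivable (fun r => tcoord (c s) (c r) (X r)) s 1 /\ covderiv c X s = 0.

Definition geodesic c : Prop := C1_curve c /\ parallel c (velocity c).

Definition geodesically_complete : Prop := forall z v,
  exists c, [/\ geodesic c, c 0 = z & velocity c 0 = v].

Definition Exp z v : M := xget z
  [set p | exists c, [/\ geodesic c, c 0 = z, velocity c 0 = v & c 1 = p]].

Definition minimizing_geodesic c p q : Prop :=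
  [/\ geodesic c, c 0 = p, c 1 = q & tnorm p (velocity c 0) = dist p q].

(* parallel transport along the minimizing geodesic; meaningful when that
   geodesic is unique *)
Definition transport p q v : 'rV[R]_n := xget 0
  [set w | exists c X,
     [/\ minimizing_geodesic c p q, parallel c X, X 0 = v & X 1 = w]].

Definition geodesically_convex (U : set M) : Prop := forall p q, U p -> U q ->
  exists c, [/\ minimizing_geodesic c p q,
    forall s, 0 <= s <= 1 -> U (c s) &
    forall c', minimizing_geodesic c' p q ->
      forall s, 0 <= s <= 1 -> c' s = c s].

(* On [0, 1] a geodesic has constant speed, hence length |c'(0)|. *)
Definition geodesically_strongly_convex (mu : R) (U : set M) (h : M -> R) :
    Prop :=
  forall c, geodesic c -> (forall s, 0 <= s <= 1 -> U (c s)) ->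
  forall s, 0 <= s <= 1 ->
    h (c s) <= (1 - s) * h (c 0) + s * h (c 1)
               - mu / 2 * s * (1 - s) * tnorm (c 0) (velocity c 0) ^+ 2.

(* the vector G of T_z M with <G, v>_z = dh(z)[v] for every v *)
Definition grad (h : M -> R) z : 'rV[R]_n :=
  (\row_(i < n) 'D_(ebasis R i) (h \o ichart z : 'rV[R]_n -> R^o) (chart z z))
  *m invmx (metric z).

(* Levi-Civita covariant derivative of the vector field X at z along v *)
Definition nabla (X : M -> 'rV[R]_n) z v : 'rV[R]_n :=
  'D_v (fun u => tcoord z (ichart z u) (X (ichart z u))) (chart z z)
  + christoffel z (chart z z) v (X z).

Definition hess (h : M -> R) z v : 'rV[R]_n := nabla (grad h) z v.

(* R(v1, v2) w, with the sign convention
   R(X, Y) Z = nabla_X nabla_Y Z - nabla_Y nabla_X Z - nabla_[X, Y] Z *)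
Definition curvature z v1 v2 w : 'rV[R]_n :=
  let G u a b := christoffel z u a b in
  let u := chart z z in
  'D_v1 (fun u' => G u' v2 w) u - 'D_v2 (fun u' => G u' v1 w) u
  + G u v1 (G u v2 w) - G u v2 (G u v1 w).

Definition plane_area z v w : R :=
  inner z v v * inner z w w - inner z v w ^+ 2.

Definition sectional z v w : R :=
  inner z (curvature z v w w) v / plane_area z v w.

Definition curvature_ge (tau : R) : Prop := forall z v w,
  plane_area z v w != 0 -> tau <= sectional z v w.

Definition simply_connected : Prop := forall c, continuous c -> c 0 = c 1 ->
  exists H : R * R -> M, [/\ continuous H,
    forall s, 0 <= s <= 1 -> H (s, 0) = c s,
    forall s, 0 <= s <= 1 -> H (s, 1) = c 0 &
    forall r, 0 <= r <= 1 -> H (0, r) = c 0 /\ H (1, r) = c 0].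

(* connectedness is part of [riemannianManifold] *)
Definition hadamard : Prop := [/\ geodesically_complete, simply_connected &
  forall z v w, plane_area z v w != 0 -> sectional z v w <= 0].

End Riemannian.

(* |A| <= k for the operator norm of A : T_p M -> T_q N *)
Definition opnorm_le (R : realType) (m n : nat) (M : riemannianManifold R m)
    (N : riemannianManifold R n) (p : M) (q : N) (A : 'rV[R]_m -> 'rV[R]_n)
    (k : R) : Prop := forall v, tnorm q (A v) <= k * tnorm p v.

Section Bilevel.
Context (R : realType) (m n : nat).
Context (Mx : riemannianManifold R m) (My : riemannianManifold R n).
Implicit Types (h f g : Mx -> My -> R) (x : Mx) (y : My).
Implicit Types (Ux : set Mx) (Uy : set My).

Definition gradx h x y : 'rV[R]_m := grad (h ^~ y) x.
Definition grady h x y : 'rV[R]_n := grad (h x) y.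
Definition hessy h x y (v : 'rV[R]_n) : 'rV[R]_n := hess (h x) y v.

(* derivative of [gradx h x] at y along v, a map from T_y My to T_x Mx *)
Definition crossxy h x y (v : 'rV[R]_n) : 'rV[R]_m :=
  'D_v (fun u => gradx h x (ichart y u)) (chart y y).

Definition crossyx h x y (w : 'rV[R]_m) : 'rV[R]_n :=
  'D_w (fun u => grady h (ichart x u) y) (chart x x).

Definition Ck_on k h Ux Uy : Prop := forall x y, Ux x -> Uy y ->
  Ck_near k (fun u : 'rV[R]_m * 'rV[R]_n =>
               h (ichart x u.1) (ichart y u.2) : R^o)
          (chart x x, chart y y).

Definition lipschitz_fun (l : R) h Ux Uy : Prop :=
  (forall x1 x2 y, Ux x1 -> Ux x2 -> Uy y ->
     `|h x1 y - h x2 y| <= l * dist x1 x2) /\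
  (forall x y1 y2, Ux x -> Uy y1 -> Uy y2 ->
     `|h x y1 - h x y2| <= l * dist y1 y2).

Definition lipschitz_gradients (L : R) h Ux Uy : Prop :=
  [/\ forall x y1 y2, Ux x -> Uy y1 -> Uy y2 ->
        tnorm y2 (transport y1 y2 (grady h x y1) - grady h x y2)
        <= L * dist y1 y2,
      forall x y1 y2, Ux x -> Uy y1 -> Uy y2 ->
        tnorm x (gradx h x y1 - gradx h x y2) <= L * dist y1 y2,
      forall x1 x2 y, Ux x1 -> Ux x2 -> Uy y ->
        tnorm x2 (transport x1 x2 (gradx h x1 y) - gradx h x2 y)
        <= L * dist x1 x2 &
      forall x1 x2 y, Ux x1 -> Ux x2 -> Uy y ->
        tnorm y (grady h x1 y - grady h x2 y) <= L * dist x1 x2].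

Definition lipschitz_hessy (rho : R) h Ux Uy : Prop :=
  (forall x y1 y2, Ux x -> Uy y1 -> Uy y2 ->
     opnorm_le y2 y2
       (fun v => transport y1 y2 (hessy h x y1 (transport y2 y1 v))
                 - hessy h x y2 v)
       (rho * dist y1 y2)) /\
  (forall x1 x2 y, Ux x1 -> Ux x2 -> Uy y ->
     opnorm_le y y (fun v => hessy h x1 y v - hessy h x2 y v)
       (rho * dist x1 x2)).

Definition lipschitz_crossxy (rho : R) h Ux Uy : Prop :=
  (forall x1 x2 y, Ux x1 -> Ux x2 -> Uy y ->
     opnorm_le y x2
       (fun v => transport x1 x2 (crossxy h x1 y v) - crossxy h x2 y v)
       (rho * dist x1 x2)) /\
  (forall x y1 y2, Ux x -> Uy y1 -> Uy y2 ->
     opnorm_le y1 x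
       (fun v => crossxy h x y1 v - crossxy h x y2 (transport y1 y2 v))
       (rho * dist y1 y2)).

Definition lipschitz_crossyx (rho : R) h Ux Uy : Prop :=
  (forall x y1 y2, Ux x -> Uy y1 -> Uy y2 ->
     opnorm_le x y2
       (fun w => transport y1 y2 (crossyx h x y1 w) - crossyx h x y2 w)
       (rho * dist y1 y2)) /\
  (forall x1 x2 y, Ux x1 -> Ux x2 -> Uy y ->
     opnorm_le x1 y
       (fun w => crossyx h x1 y w - crossyx h x2 y (transport x1 x2 w))
       (rho * dist x1 x2)).

(* the solution v of H_y g(x, y)[v] = w *)
Definition hessy_inv g x y (w : 'rV[R]_n) : 'rV[R]_n :=
  xget 0 [set v | hessy g x y v = w].

Definition upper_objective f (ystar : Mx -> My) x : R := f x (ystar x).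

Definition hypergradient f g (ystar : Mx -> My) x : 'rV[R]_m :=
  gradx f x (ystar x)
  - crossxy g x (ystar x) (hessy_inv g x (ystar x) (grady f x (ystar x))).

Definition gradR f g x y (v : 'rV[R]_n) : 'rV[R]_n :=
  hessy g x y v - grady f x y.

Definition approx_hypergradient f g x y (v : 'rV[R]_n) : 'rV[R]_m :=
  gradx f x y - crossxy g x y v.

End Bilevel.

(* continuously extended by 1 at c = 0, where c / tanh c is undefined *)
Definition zeta (R : realType) (tau c : R) : R :=
  let s := Num.sqrt `|tau| * c in
  if s == 0 then 1
  else s / ((expR s - expR (- s)) / (expR s + expR (- s))).

Section Algorithm.
Context (R : realType).

(* Conjugate gradient for A v = r in T_z M, started from v = 0; the state is
   (iterate, residual, search direction). *)
Definition cg_step n (M : riemannianManifold R n) (z : M)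
    (A : 'rV[R]_n -> 'rV[R]_n) (st : 'rV[R]_n * 'rV[R]_n * 'rV[R]_n) :
    'rV[R]_n * 'rV[R]_n * 'rV[R]_n :=
  let: (v, r, d) := st in
  let alpha := inner z r r / inner z d (A d) in
  let r' := r - alpha *: A d in
  let beta := inner z r' r' / inner z r r in
  (v + alpha *: d, r', r' + beta *: d).

Definition cg n (M : riemannianManifold R n) (z : M)
    (A : 'rV[R]_n -> 'rV[R]_n) (r : 'rV[R]_n) (k : nat) : 'rV[R]_n :=
  (iter k (cg_step z A) (0, r, r)).1.1.

(* K is the index at which a while loop with guard [eps < res k], started from
   k = 0, exits. *)
Definition exits_at (eps : R) (res : nat -> R) (K : nat) : Prop :=
  (forall k, (k < K)%N -> eps < res k) /\ res K <= eps.

Inductive variant := AdaRHD_GD | AdaRHD_CG.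

Record lower_loop n (M : riemannianManifold R n) (h : M -> R) (eps : R)
    (y0 : M) (b0 : R) (K : nat) (y : nat -> M) (b : nat -> R) : Prop :=
  LowerLoop {
  lower_y0 : y 0%N = y0 ;
  lower_b0 : b 0%N = b0 ;
  lower_b : forall k, (k < K)%N ->
    b k.+1 = Num.sqrt (b k ^+ 2 + tnorm (y k) (grad h (y k)) ^+ 2) ;
  lower_y : forall k, (k < K)%N ->
    y k.+1 = Exp (y k) (- (b k.+1)^-1 *: grad h (y k)) ;
  lower_exit :
    exits_at eps (fun k => tnorm (y k) (grad h (y k)) ^+ 2) K
}.

Record gd_loop n (M : riemannianManifold R n) (z : M)
    (G : 'rV[R]_n -> 'rV[R]_n) (eps : R) (v0 : 'rV[R]_n) (c0 : R) (N : nat)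
    (v : nat -> 'rV[R]_n) (c : nat -> R) : Prop := GdLoop {
  gd_v0 : v 0%N = v0 ;
  gd_c0 : c 0%N = c0 ;
  gd_c : forall k, (k < N)%N ->
    c k.+1 = Num.sqrt (c k ^+ 2 + tnorm z (G (v k)) ^+ 2) ;
  gd_v : forall k, (k < N)%N -> v k.+1 = v k - (c k.+1)^-1 *: G (v k) ;
  gd_exit : exits_at eps (fun k => tnorm z (G (v k)) ^+ 2) N
}.

(* Execution of T iterations. [K t] and [N t] are the final inner indices. In
   the CG variant [c] plays no role. *)
Record adarhd_run m n (Mx : riemannianManifold R m)
    (My : riemannianManifold R n) (f g : Mx -> My -> R) (var : variant)
    (x0 : Mx) (y0 : My) (v0 : 'rV[R]_n) (a0 b0 c0 : R) (T : nat)
    (x : nat -> Mx) (a : nat -> R)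
    (K : nat -> nat) (y : nat -> nat -> My) (b : nat -> nat -> R)
    (N : nat -> nat) (v : nat -> nat -> 'rV[R]_n) (c : nat -> nat -> R) :
    Prop := AdarhdRun {
  run_x0 : x 0%N = x0 ;
  run_a0 : a 0%N = a0 ;
  run_y : forall t, (t < T)%N ->
    lower_loop (g (x t)) (T%:R)^-1
      (if t is t'.+1 then y t' (K t') else y0) b0 (K t) (y t) (b t) ;
  run_v : forall t, (t < T)%N ->
    let z := y t (K t) in
    match var with
    | AdaRHD_GD =>
        gd_loop z (gradR f g (x t) z) (T%:R)^-1
          (if t is t'.+1 then transport (y t' (K t')) z (v t' (N t'))
           else transport y0 z v0)
          c0 (N t) (v t) (c t)
    | AdaRHD_CG =>
        (forall k, v t k = cg z (hessy g (x t) z) (grady f (x t) z) k) /\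
        exits_at (T%:R)^-1
          (fun k => tnorm z (gradR f g (x t) z (v t k)) ^+ 2) (N t)
    end ;
  run_a : forall t, (t < T)%N ->
    a t.+1 = Num.sqrt (a t ^+ 2
      + tnorm (x t) (approx_hypergradient f g (x t) (y t (K t)) (v t (N t)))
        ^+ 2) ;
  run_x : forall t, (t < T)%N ->
    x t.+1 = Exp (x t) (- (a t.+1)^-1 *:
      approx_hypergradient f g (x t) (y t (K t)) (v t (N t)))
}.

(* the geodesic segment from z to Exp_z v lies in U *)
Definition step_in n (M : riemannianManifold R n) (U : set M) (z : M)
    (v : 'rV[R]_n) : Prop :=
  forall c : R -> M, geodesic c -> c 0 = z -> velocity c 0 = v ->
  forall s, 0 <= s <= 1 -> U (c s).

Record run_in_region m n (Mx : riemannianManifold R m)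
    (My : riemannianManifold R n) (f g : Mx -> My -> R)
    (Ux : set Mx) (Uy : set My) (T : nat) (x : nat -> Mx) (a : nat -> R)
    (K : nat -> nat) (y : nat -> nat -> My) (b : nat -> nat -> R)
    (N : nat -> nat) (v : nat -> nat -> 'rV[R]_n) : Prop := RunInRegion {
  region_x : forall t, (t <= T)%N -> Ux (x t) ;
  region_y : forall t k, (t < T)%N -> (k <= K t)%N -> Uy (y t k) ;
  region_x_step : forall t, (t < T)%N ->
    step_in Ux (x t) (- (a t.+1)^-1 *:
      approx_hypergradient f g (x t) (y t (K t)) (v t (N t))) ;
  region_y_step : forall t k, (t < T)%N -> (k < K t)%N ->
    step_in Uy (y t k) (- (b t k.+1)^-1 *: grady g (x t) (y t k))
}.

End Algorithm.

Section Constants.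
Context (R : realType) (mu lf Lf Lg rho a0 : R).

Definition const_LF : R := (Lf + rho * lf / mu) * (1 + Lg / mu) ^+ 2.
Definition const_Ca : R := Num.max (2 * const_LF) a0.
Definition const_L1 : R :=
  Lf + lf * rho / mu + Lg * (Lf / mu + lf * rho / mu ^+ 2).
Definition const_Lbar : R :=
  Num.max (Num.sqrt 2 * const_L1) (Num.sqrt 2 * Lg).

(* [gap] stands for F(x_0) - F^* *)
Definition const_F0 (gap : R) : R :=
  2 * gap + const_LF * const_Ca ^+ 2 / a0 ^+ 2.
Definition const_C (gap : R) : R :=
  let B := const_F0 gap + 2 * const_Lbar ^+ 2 / (a0 * mu ^+ 2) in
  B * (const_Ca + 2 * B).

End Constants.

(* Main.v *)
Require Import Defs.
From HB Require Import structures.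
From mathcomp Require Import all_boot all_order all_algebra.
From mathcomp Require Import all_classical all_reals all_analysis.
From mathcomp Require Import ring lra.
Set Implicit Arguments.
Unset Strict Implicit.
Unset Printing Implicit Defensive.
Import Order.TTheory GRing.Theory Num.Theory.
Import numFieldNormedType.Exports.
Local Open Scope classical_set_scope.
Local Open Scope ring_scope.

(* Strong convexity makes [y |-> G_y g(x, y)] expand distances by at least mu,
   so that ystar is Lg/mu-Lipschitz; together with the Lipschitz bounds on the
   derivatives of f and g, the hypergradient G F is L_F-Lipschitz with respect
   to parallel transport, and the stopping criteria of the two inner loops
   bound its error at step t by a multiple of 1/T. G F is the gradient of F
   along geodesics: with v = H_y^{-1} g [G_y f], the function
   f(x, y) - d_y g(x, y)[v] has the value F(x) at y = ystar(x), where it is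
   critical in y, so the derivative of ystar, which is only Lipschitz, is never
   needed. These two facts give the descent inequality
     F(x_{t+1}) <= F(x_t) + <G F(x_t), xi_t> + L_F/2 |xi_t|^2.
   Summing it over t with xi_t = - ghat_t / a_{t+1} bounds
     sum_t |G F(x_t)|^2 / a_{t+1},
   and a_T as well, according to whether a_t has already exceeded C_a. *)

(** * Calculus in normed spaces *)

(** Two obstacles shape the proof. Parallel transport and the exponential map are defined by choice,
    so existence must come first: parallel fields along any C^1 curve come from a linear
    differential equation solved in charts, and geodesic convexity makes all minimizing geodesics
    between two points give the same transport. A geodesic step need not be minimizing, however, so
    transport between two of its points is compared with its velocity only to first order
    ([geodesic_transport]). This suffices, because the increments of F and of its derivative along
    the step are bounded locally and Cousin's lemma adds up the local bounds, without any integral.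
    Secondly, the pointwise bounds (coercivity of H_y g, |G_y f| <= l_f, |G^2_xy g| <= L_g) concern
    all tangent directions, whereas the hypotheses only speak of points of U_y. They are proved at
    interior points, where short geodesics in every direction stay in U_y, and pass to U_y, which
    lies in the closure of its interior. The constant C is a product: one factor B bounds sum_t |G
    F(x_t)|^2 / a_{t+1}, the other, C_a + 2B, bounds a_T. *)

Section Calculus.
Context (R : realType).

Lemma nbhs_epsP (V : normedModType R) (a : V) (A : set V) :
  nbhs a A <-> exists2 d : R, 0 < d & forall v, `|v - a| < d -> A v.
Proof.
split=> [/nbhs_ballP[d /= d0 dA]|[d d0 dA]].
  by exists d => // v va; apply: dA; rewrite -ball_normE /= distrC.
apply/nbhs_ballP; exists d => //= v; rewrite -ball_normE /= distrC; exact: dA.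
Qed.

Lemma continuous_epsP (V W : normedModType R) (f : V -> W) (a : V) :
  {for a, continuous f} <->
  forall e : R, 0 < e -> exists2 d : R, 0 < d &
    forall v, `|v - a| < d -> `|f v - f a| <= e.
Proof.
split=> [/cvgrPdist_le /= fa e /fa/nbhs_epsP[d d0 H]|H].
  by exists d => // v /H; rewrite distrC.
apply/cvgrPdist_le => /= e /H[d d0 {}H]; apply/nbhs_epsP.
by exists d => // v /H; rewrite distrC.
Qed.

(** Multiplied out by the increment, the definition needs no punctured neighbourhood: at [h = 0] the
    inequality reads [0 <= 0]. *)
Lemma is_derive_epsP (V W : normedModType R) (f : V -> W) (a v : V) (l : W) :
  is_derive a v f l <->
  forall e : R, 0 < e -> exists2 d : R, 0 < d &
    forall h, `|h| < d -> `|f (a + h *: v) - f a - h *: l| <= e * `|h|.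
Proof.
split=> [fl e e0|H].
  have /cvgrPdist_le/(_ _ e0) : h^-1 *: ((f \o shift a) (h *: v) - f a)
      @[h --> (0:R)^'] --> l by case: fl => cf <-; exact: cf.
  rewrite near_withinE => /nbhs_epsP[d d0 {}H]; exists d => // h hd.
  have [->|h0] := eqVneq h 0; first by rewrite !scale0r addr0 !subrr !normr0 mulr0.
  have := H h; rewrite subr0 => /(_ hd h0) /=.
  rewrite [h *: v + a]addrC; set D := f _ - _ => DH.
  have -> : D - h *: l = h *: (h^-1 *: D - l) by rewrite scalerBr scalerKV.
  by rewrite normrZ mulrC ler_pM2r ?normr_gt0// distrC.
have cv : h^-1 *: ((f \o shift a) (h *: v) - f a) @[h --> (0:R)^'] --> l.
  apply/cvgrPdist_le => e e0; rewrite near_withinE; apply/nbhs_epsP.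
  have [d d0 {}H] := H _ e0; exists d => // h; rewrite subr0 => hd h0 /=.
  have := H _ hd; rewrite [h *: v + a]addrC; set D := f _ - _.
  have -> : D - h *: l = h *: (h^-1 *: D - l) by rewrite scalerBr scalerKV.
  by rewrite normrZ mulrC ler_pM2r ?normr_gt0// distrC.
by split; [apply/cvg_ex; exists l|apply: cvg_lim].
Qed.

Lemma differentiable_eps (V W : normedModType R) (f : V -> W) (a : V)
    (D : {linear V -> W}) : continuous D ->
  (forall e : R, 0 < e -> exists2 d : R, 0 < d &
    forall k, `|k| < d -> `|f (a + k) - f a - D k| <= e * `|k|) ->
  is_diff a f D.
Proof.
move=> cD H.
have E : f \o shift a = cst (f a) + D +o_ (0 : V) id.
  apply/eqaddoP => e e0; have [d d0 {}H] := H _ e0.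
  apply/nbhs_epsP; exists d => // k; rewrite subr0 => /H.
  by rewrite /= [a + k]addrC opprD addrA.
have := @diff_unique _ _ _ f D a cD E => dD.
split; last exact: dD.
apply/diff_locallyxP; split; first by move=> x; rewrite dD; exact: cD.
move=> h; rewrite dD.
have := E; rewrite funeqE => /(_ h) /=; rewrite [h + a]addrC => ->.
by congr (_ + _).
Qed.

Lemma is_derive_continuous (W : normedModType R) (f : R -> W) (s : R) (l : W) :
  is_derive s 1 f l -> {for s, continuous f}.
Proof.
by case=> /derivable1_diffP/differentiable_continuous.
Qed.

Lemma mvt_le (f f' : R -> R) (a b K : R) : a <= b ->
  (forall s, a <= s <= b -> is_derive s 1 f (f' s)) ->
  (forall s, a <= s <= b -> `|f' s| <= K) -> `|f b - f a| <= K * (b - a).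
Proof.
move=> ab df f'K.
have dI s : s \in `]a, b[ -> is_derive s 1 f (f' s).
  by rewrite in_itv /= => /andP[sa sb]; apply: df; rewrite !ltW.
have [|c cab ->] := MVT_segment ab dI _.
  apply: derivable_within_continuous => s; rewrite in_itv /= => sab.
  by case: (df s sab).
rewrite normrM (ger0_norm (_ : 0 <= b - a)) ?subr_ge0// ler_wpM2r ?subr_ge0//.
by apply: f'K; move: cab; rewrite in_itv.
Qed.

Lemma is_derive_mx (V : normedModType R) m n (f : V -> 'M[R]_(m, n)) (a v : V) l :
  is_derive a v f l <-> forall i j, is_derive a v (fun r => f r i j) (l i j).
Proof.
split=> [[df <-] i j|H].
  split; last by rewrite derive_mx// mxE.
  by have /derivable_mxP := df; apply.
have df : derivable f a v by apply/derivable_mxP => i j; case: (H i j).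
split => //; rewrite derive_mx//; apply/matrixP => i j; rewrite mxE.
by case: (H i j).
Qed.

Lemma mx_norm_leP m n (A : 'M[R]_(m, n)) (K : R) : 0 <= K ->
  `|A| <= K <-> forall i j, `|A i j| <= K.
Proof.
move=> K0; rewrite [`|A|]/Num.Def.normr/= mx_normrE; split=> [AK i j|H].
  apply: le_trans AK.
  exact: (le_bigmax _ (fun ij => `|A ij.1 ij.2|) (i, j)).
by apply: bigmax_le => // -[i j] _ /=.
Qed.

Lemma mx_coord_le m n (A : 'M[R]_(m, n)) i j : `|A i j| <= `|A|.
Proof. exact: ((mx_norm_leP A (normr_ge0 A)).1 (lexx _)). Qed.

(** The norm of a matrix is the largest absolute value of its entries, so the scalar inequality
    holds entrywise with the same [K]. *)
Lemma mvt_mx_le m n (f f' : R -> 'M[R]_(m, n)) (a b K : R) : a <= b -> 0 <= K ->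
  (forall s, a <= s <= b -> is_derive s 1 f (f' s)) ->
  (forall s, a <= s <= b -> `|f' s| <= K) -> `|f b - f a| <= K * (b - a).
Proof.
move=> ab K0 df f'K; apply/mx_norm_leP => [|i j].
  by rewrite mulr_ge0 ?subr_ge0.
rewrite !mxE; apply: (mvt_le (f := fun s => f s i j) (f' := fun s => f' s i j)) => //.
- by move=> s /df/is_derive_mx.
- by move=> s /f'K; apply: le_trans (mx_coord_le _ _ _).
Qed.

(** The mean value inequality for [r |-> f r - r * D]. Both signs of [t] are covered, because [t]
    will be a coordinate of an increment. *)
Lemma mvt_lin_le (f f' : R -> R) (t D e : R) :
  (forall s : R, `|s| <= `|t| -> is_derive s 1 f (f' s)) ->
  (forall s : R, `|s| <= `|t| -> `|f' s - D| <= e) ->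
  `|f t - f 0 - t * D| <= e * `|t|.
Proof.
move=> df f'D.
have dg (s : R) : `|s| <= `|t| -> is_derive s 1 (fun r : R => f r - r * D : R) (f' s - D).
  move=> /df ?; apply: is_derive_eq.
  by rewrite scaler0 add0r /GRing.scale /= mulr1.
have E : f t - f 0 - t * D = (f t - t * D) - (f 0 - 0 * D) by ring.
have [t0|t0] := leP 0 t.
  rewrite E (_ : e * `|t| = e * (t - 0)); last by rewrite ger0_norm ?subr0.
  apply: (mvt_le (f := fun r : R => f r - r * D) t0) => s /andP[s0 st].
    by apply: dg; rewrite !ger0_norm.
  by apply: f'D; rewrite !ger0_norm.
rewrite E distrC (_ : e * `|t| = e * (0 - t)); last by rewrite ltr0_norm ?sub0r.
apply: (mvt_le (f := fun r : R => f r - r * D) (ltW t0)) => s /andP[s0 st].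
  by apply: dg; rewrite !ler0_norm ?lerN2// ltW.
by apply: f'D; rewrite !ler0_norm ?lerN2// ltW.
Qed.

(* finite dimension, as a basis with bounded coordinate functionals *)
Definition findim (V : normedModType R) := exists N (e : 'I_N -> V)
  (x : 'I_N -> V -> R) (C : R),
  [/\ 0 < C, forall i, scalar (x i), forall i v, `|x i v| <= C * `|v| &
      forall v, v = \sum_i x i v *: e i].

Lemma is_derive_line (V W : normedModType R) (h : V -> W) (a v : V) (s : R) :
  derivable h (a + s *: v) v ->
  is_derive s 1 (fun r => h (a + r *: v)) ('D_v h (a + s *: v)).
Proof.
move=> /derivableP /is_derive_epsP H; apply/is_derive_epsP => e /H[d d0 {}H].
exists d => // k /H; rewrite (_ : a + (s + k *: 1) *: v = a + s *: v + k *: v)//.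
by rewrite [k%:A]mulr1 scalerDl addrA.
Qed.

Lemma Ck_derivable (V W : normedModType R) k (h : V -> W) (A : set V) :
  Ck k.+1 h A -> forall a v, A a -> derivable h a v.
Proof. by move=> [_ H] a v; have [+ _] := H v; exact. Qed.

Lemma Ck_D (V W : normedModType R) k (h : V -> W) (A : set V) v :
  Ck k.+1 h A -> Ck k ('D_v h) A.
Proof. by move=> [_ /(_ v)[]]. Qed.

Lemma Ck_cont (V W : normedModType R) k (h : V -> W) (A : set V) :
  Ck k h A -> forall a, A a -> {for a, continuous h}.
Proof. by case: k => [|k] []. Qed.

(** From [a] to [a + k] one moves along one basis vector at a time; on each leg the partial
    derivative is close to its value at [a], and [mvt_lin_le] applies. *)
Lemma C1_differentiable (V : normedModType R) (h : V -> R) (A : set V) (a : V) :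
  findim V -> open A -> Ck 1 h A -> A a -> differentiable h a.
Proof.
move=> [N [e [x [C [C0 xl xC xE]]]]] oA hC Aa.
pose D k : R := \sum_i x i k * 'D_(e i) h a.
have Dlin : linear D.
  move=> c u v; rewrite /D scaler_sumr -big_split; apply: eq_bigr => i _ /=.
  by rewrite xl mulrDl -mulrA.
pose DL : {linear V -> R} := HB.pack D (GRing.isLinear.Build R V R *:%R D Dlin).
pose B := \sum_i `|'D_(e i) h a|.
have B0 : 0 <= B by rewrite /B sumr_ge0.
have cD : continuous DL.
  move=> u; apply/continuous_epsP => r r0; exists (r / (C * B + 1)).
    by rewrite divr_gt0// ltr_wpDl// mulr_ge0// ltW.
  move=> v; rewrite ltr_pdivlMr; last by rewrite ltr_wpDl// mulr_ge0// ltW.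
  move=> vu; rewrite -linearB /= /D (le_trans (ler_norm_sum _ _ _))//.
  apply: (le_trans _ (ltW vu)); rewrite mulrDr mulr1 ler_wpDr//.
  rewrite /B mulrA mulr_sumr ler_sum// => i _.
  by rewrite normrM ler_wpM2r// [_ * C]mulrC.
suff H : is_diff a h DL by case: H.
apply: differentiable_eps => // r r0.
pose E := \sum_i `|e i|.
have E0 : 0 <= E by rewrite /E sumr_ge0.
have [d1 d10 Ad] : exists2 d : R, 0 < d & forall v, `|v - a| < d -> A v.
  by apply/nbhs_epsP; exact: open_nbhs_nbhs.
have N0 : 0 < N.+1%:R :> R by [].
have r'0 : 0 < r / (C * N.+1%:R) by rewrite divr_gt0// mulr_gt0.
have [d2 d20 Dd] : exists2 d : R, 0 < d & forall i v, `|v - a| < d ->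
    `|'D_(e i) h v - 'D_(e i) h a| <= r / (C * N.+1%:R).
  have /(_ _)/cid2-/all_sig2[d d0 dP] : forall i, exists2 d : R, 0 < d &
      forall v, `|v - a| < d -> `|'D_(e i) h v - 'D_(e i) h a| <= r / (C * N.+1%:R).
    by move=> i; have /continuous_epsP := Ck_cont (Ck_D (e i) hC) Aa; apply.
  exists (\big[Num.min/1]_i d i).
    by elim/big_ind : _ => // u w u0 w0; rewrite lt_min u0.
  by move=> i v vd; apply: dP; apply: (lt_le_trans vd); exact: bigmin_le.
(* Every partial sum of the coordinate expansion of [k] has norm at most [|k| * F], so all legs stay
   in the balls of radii [d1] and [d2]. *)
pose F := C * E + 1.
have F0 : 0 < F by rewrite ltr_wpDl// mulr_ge0// ltW.
exists (Num.min d1 d2 / F) => [|k]; first by rewrite divr_gt0// lt_min d10.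
rewrite ltr_pdivlMr// lt_min => /andP[kd1 kd2].
(* Induction on the list of coordinates already switched on; the hypothesis on [l] keeps the
   intermediate points near [a]. *)
have step (l : seq 'I_N) : \sum_(i <- l) `|x i k| * `|e i| <= `|k| * F ->
   `|h (a + \sum_(i <- l) x i k *: e i) - h a - \sum_(i <- l) x i k * 'D_(e i) h a|
     <= r / (C * N.+1%:R) * \sum_(i <- l) `|x i k|.
  elim: l => [_|i l IH].
    by rewrite !big_nil addr0 mulr0 !subr0 subrr normr0.
  rewrite !big_cons => lF; set S := \sum_(j <- l) _ *: _.
  have Slt : `|S| <= \sum_(j <- l) `|x j k| * `|e j|.
    rewrite (le_trans (ler_norm_sum _ _ _))// ler_sum// => j _.
    by rewrite normrZ.
  have near s : `|s| <= `|x i k| -> `|a + S + s *: e i - a| <= `|k| * F.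
    move=> sx; rewrite -[a + S + _]addrA [a + _]addrC addrK (le_trans _ lF)//.
    rewrite (le_trans (ler_normD _ _))// addrC lerD// normrZ.
    by rewrite ler_wpM2r.
  have := @mvt_lin_le (fun s => h (a + S + s *: e i))
    (fun s => 'D_(e i) h (a + S + s *: e i)) (x i k) ('D_(e i) h a) (r / (C * N.+1%:R)).
  move=> /(_ _ _)/=; rewrite scale0r addr0 => H.
  set T := \sum_(j <- l) _ * _.
  have -> : h (a + (x i k *: e i + S)) - h a - (x i k * 'D_(e i) h a + T) =
     (h (a + S + x i k *: e i) - h (a + S) - x i k * 'D_(e i) h a) +
     (h (a + S) - h a - T).
    rewrite [_ + S]addrC addrA; ring.
  rewrite mulrDr (le_trans (ler_normD _ _))// lerD//.
    apply: H => s /near sF.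
      apply: is_derive_line; apply: (Ck_derivable hC); apply: Ad.
      exact: le_lt_trans kd1.
    apply: Dd; exact: le_lt_trans kd2.
  apply: IH; apply: le_trans lF; by rewrite lerDr mulr_ge0.
have := step (index_enum 'I_N); rewrite -xE => /(_ _)/le_trans; apply.
  rewrite /F /E mulrDr mulr1 ler_wpDr// mulrA mulr_sumr ler_sum// => i _.
  by rewrite ler_wpM2r// [_ * C]mulrC.
rewrite -ler_pdivlMl// (le_trans (ler_sum _ (fun i _ => xC i k)))//.
rewrite sumr_const card_ord.
rewrite (_ : _^-1 * _ = C * N.+1%:R * `|k|); last by field; rewrite !gt_eqF.
rewrite -[_ *+ N]mulr_natr mulrAC ler_wpM2r// ler_wpM2l ?ltW//.
by rewrite ltr_nat.
Qed.

End Calculus.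

(** * Maps of class C^k and the symmetry of second derivatives *)

Section ContinuousDerivatives.
Context (R : realType).

Lemma findim_rV n : findim 'rV[R]_n.
Proof.
exists n, (fun i => delta_mx 0 i), (fun i (v : 'rV[R]_n) => v 0 i), 1; split=> //.
- by move=> i c u v; rewrite !mxE.
- by move=> i v; rewrite mul1r mx_coord_le.
- by move=> v; rewrite -row_sum_delta.
Qed.

Lemma findim_prod (V W : normedModType R) :
  findim V -> findim W -> findim (V * W)%type.
Proof.
move=> [N [e [x [C [C0 xl xC xE]]]]] [N' [e' [x' [C' [C'0 x'l x'C x'E]]]]].
exists (N + N')%N, (fun i : 'I_(N + N') => match fintype.split i with inl j => (e j, 0)
  | inr j => (0, e' j) end), (fun (i : 'I_(N + N')) v => match fintype.split i with inl j => x j v.1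
  | inr j => x' j v.2 end), (C + C'); split.
- by rewrite addr_gt0.
- by move=> i c u v; case: fintype.split => j; rewrite /= ?xl ?x'l.
- move=> i v; have v1 : `|v.1| <= `|v| by rewrite prod_normE le_max lexx.
  have v2 : `|v.2| <= `|v| by rewrite prod_normE le_max lexx orbT.
  case: fintype.split => j; rewrite mulrDl.
    by rewrite (le_trans (xC _ _))// ler_wpDr ?mulr_ge0 ?(ltW C'0)// ler_wpM2l// ltW.
  by rewrite (le_trans (x'C _ _))// ler_wpDl ?mulr_ge0 ?(ltW C0)// ler_wpM2l// ltW.
- move=> [v w]; rewrite big_split_ord /=.
  under eq_bigr do rewrite (unsplitK (inl _)).
  under [X in _ + X]eq_bigr do rewrite (unsplitK (inr _)).
  have s1 k (F : 'I_k -> V * W) : (\sum_i F i).1 = \sum_i (F i).1.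
    by elim/big_ind2 : _ => // ? ? ? ? <- <-.
  have s2 k (F : 'I_k -> V * W) : (\sum_i F i).2 = \sum_i (F i).2.
    by elim/big_ind2 : _ => // ? ? ? ? <- <-.
  apply/pair_equal_spec; split; rewrite /= ?s1 ?s2 /=.
    by rewrite [X in _ + X]big1 ?addr0// => i _; rewrite scaler0.
  by rewrite [X in X + _]big1 ?add0r// => i _; rewrite scaler0.
Qed.

Lemma is_derive_comp (V W : normedModType R) (h : V -> W) (c : R -> V) (s : R) v :
  differentiable h (c s) -> is_derive s 1 c v ->
  is_derive s 1 (h \o c) ('D_v h (c s)).
Proof.
move=> dh [dc cv]; have /derivable1_diffP dc' := dc.
have dhc := differentiable_comp dc' dh.
split; first exact/derivable1_diffP.
by rewrite deriveE// diff_comp//= [RHS]deriveE//= -cv [in RHS]deriveE.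
Qed.

Lemma differentiable_mx (V : normedModType R) m n (h : V -> 'M[R]_(m, n)) a :
  (forall i j, differentiable (fun v => h v i j) a) -> differentiable h a.
Proof.
move=> H; have -> : h = \sum_i \sum_j (fun v => h v i j *: delta_mx i j).
  apply/funext => v; rewrite {1}(matrix_sum_delta (h v)).
  rewrite fct_sumE; apply: eq_bigr => i _; rewrite fct_sumE//.
by apply: differentiable_sum => i; apply: differentiable_sum => j;
  apply: differentiableZl.
Qed.

Lemma open_near_eq (V W : normedModType R) (f g : V -> W) (A : set V) a :
  open A -> {in A, f =1 g} -> A a -> \forall v \near a, f v = g v.
Proof.
move=> oA fg Aa; have : nbhs a A by apply: open_nbhs_nbhs.
by apply: filterS => v Av; apply: fg; rewrite inE.
Qed.

Lemma near_eq_continuous (V W : topologicalType) (f g : V -> W) (a : V) :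
  (\forall v \near a, f v = g v) -> {for a, continuous f} ->
  {for a, continuous g}.
Proof.
move=> fg fa; rewrite /prop_for /continuous_at -(nbhs_singleton fg).
by apply: cvg_trans fa; apply: near_eq_cvg.
Qed.

Lemma near_eq_D (V W : normedModType R) (f g : V -> W) (a v : V) :
  (\forall u \near a, f u = g u) -> 'D_v f a = 'D_v g a.
Proof.
move=> fg; have [->|v0] := eqVneq v 0; first by rewrite !derive0.
exact: near_eq_derive.
Qed.

Lemma near_eq_dvbl (V W : normedModType R) (f g : V -> W) (a v : V) :
  (\forall u \near a, f u = g u) -> derivable f a v -> derivable g a v.
Proof.
move=> fg; have [->|v0] := eqVneq v 0; first by move=> _; exact: derivable0.
exact: near_eq_derivable.
Qed.

Lemma Ck_eq (V W : normedModType R) k (f g : V -> W) (A : set V) :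
  open A -> {in A, f =1 g} -> Ck k f A -> Ck k g A.
Proof.
move=> oA; elim: k f g => [|k IH] f g fg [cf Df].
  split=> // a Aa; apply: near_eq_continuous (cf a Aa); exact: open_near_eq fg Aa.
split=> [a Aa|v]; first by apply: near_eq_continuous (cf a Aa); exact: open_near_eq fg Aa.
have [dv Cv] := Df v; split=> [a Aa|].
  by apply: near_eq_dvbl (dv a Aa); exact: open_near_eq fg Aa.
apply: IH Cv => a; rewrite inE => Aa.
by apply: near_eq_D; exact: open_near_eq fg Aa.
Qed.

Lemma Ck_le (V W : normedModType R) k l (f : V -> W) (A : set V) :
  (k <= l)%N -> Ck l f A -> Ck k f A.
Proof.
elim: k l f => [|k IH] [|l] f // kl [cf Df]; split=> // v.
by have [dv Cv] := Df v; split=> //; exact: IH Cv.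
Qed.

Lemma Ck_coord (V : normedModType R) k m n (f : V -> 'M[R]_(m, n)) (A : set V) i j :
  open A -> Ck k f A -> Ck k (fun v => f v i j) A.
Proof.
move=> oA.
have cc (g : V -> 'M[R]_(m, n)) a :
    {for a, continuous g} -> {for a, continuous (fun v => g v i j)}.
  move=> /continuous_epsP H; apply/continuous_epsP => e /H[d d0 {}H].
  exists d => // v /H; apply: le_trans.
  by have := mx_coord_le (g v - g a) i j; rewrite !mxE.
elim: k f => [|k IH] f [cf Df]; first by split=> // a Aa; exact/cc/cf.
split=> [a Aa|v]; first exact/cc/cf.
have [dv Cv] := Df v; split=> [a /dv/derivable_mxP//|].
apply: Ck_eq (IH _ Cv) => // a; rewrite inE => /dv da.
by rewrite derive_mx// mxE.
Qed.

Lemma C1_differentiable_mx (V : normedModType R) m n (h : V -> 'M[R]_(m, n))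
    (A : set V) (a : V) :
  findim V -> open A -> Ck 1 h A -> A a -> differentiable h a.
Proof.
move=> fV oA Ch Aa; apply: differentiable_mx => i j.
by apply: (C1_differentiable fV oA _ Aa); exact: Ck_coord.
Qed.

Lemma line_ball (V : normedModType R) (u v : V) (d : R) : 0 < d ->
  exists2 r : R, 0 < r & forall s t : R, `|s| < r -> `|t| < r ->
    `|s *: u + t *: v| < d.
Proof.
move=> d0; have P : 0 < `|u| + `|v| + 1 by rewrite ltr_wpDl// addr_ge0.
exists (d / (`|u| + `|v| + 1)) => [|s t]; first by rewrite divr_gt0.
rewrite !ltr_pdivlMr// => sd td.
have [st|ts] := leP `|s| `|t|.
  apply: le_lt_trans td; rewrite (le_trans (ler_normD _ _))// !normrZ.
  by rewrite !mulrDr mulr1 ler_wpDr// lerD// ler_wpM2r.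
apply: le_lt_trans sd; rewrite (le_trans (ler_normD _ _))// !normrZ.
by rewrite !mulrDr mulr1 ler_wpDr// lerD// ler_wpM2r// ltW.
Qed.

(** Two applications of [mvt_lin_le]: in [s] to the difference of [h] on two parallel lines, then in
    [t] to the derivative along [u] found there. *)
Lemma second_difference (V : normedModType R) (h : V -> R) (A : set V) (a u v : V) :
  open A -> Ck 2 h A -> A a -> forall e : R, 0 < e -> exists2 d : R, 0 < d &
  forall s t : R, `|s| < d -> `|t| < d ->
   `|h (a + s *: u + t *: v) - h (a + s *: u) - h (a + t *: v) + h a
     - s * (t * 'D_v ('D_u h) a)| <= e * `|t| * `|s|.
Proof.
move=> oA hC Aa e e0.
have [d1 d10 Ad] : exists2 d : R, 0 < d & forall v, `|v - a| < d -> A v.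
  by apply/nbhs_epsP; exact: open_nbhs_nbhs.
have /continuous_epsP/(_ _ e0)[d2 d20 Dd] := Ck_cont (Ck_D v (Ck_D u hC)) Aa.
have m0 : 0 < Num.min d1 d2 by rewrite lt_min d10.
have [r r0 H] := line_ball u v m0.
have {}H (s t : R) : `|s| < r -> `|t| < r -> A (a + s *: u + t *: v) /\
    `|'D_v ('D_u h) (a + s *: u + t *: v) - 'D_v ('D_u h) a| <= e.
  move=> sr tr; have := H s t sr tr; rewrite lt_min => /andP[? ?].
  by split; [apply: Ad|apply: Dd]; rewrite -[a + _ + _]addrA [a + _]addrC addrK.
exists r => // s t sr tr.
pose phi (x : R) := h (a + t *: v + x *: u) - h (a + x *: u).
have := @mvt_lin_le R phi (fun x => 'D_u h (a + t *: v + x *: u) - 'D_u h (a + x *: u))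
  s (t * 'D_v ('D_u h) a) (e * `|t|).
rewrite /phi scale0r !addr0 => M.
have -> : h (a + s *: u + t *: v) - h (a + s *: u) - h (a + t *: v) + h a
  - s * (t * 'D_v ('D_u h) a) = h (a + t *: v + s *: u) - h (a + s *: u) -
  (h (a + t *: v) - h a) - s * (t * 'D_v ('D_u h) a).
  by rewrite [a + s *: u + _]addrAC; ring.
have r00 : `|0 : R| < r by rewrite normr0.
apply: M => x xs; have xr := le_lt_trans xs sr.
  apply: is_deriveB; apply: is_derive_line; apply: (Ck_derivable hC).
    by rewrite addrAC; exact: (H x t xr tr).1.
  by have := (H x 0 xr r00).1; rewrite scale0r addr0.
have := @mvt_lin_le R (fun y => 'D_u h (a + x *: u + y *: v))
  (fun y => 'D_v ('D_u h) (a + x *: u + y *: v)) t ('D_v ('D_u h) a) e.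
rewrite scale0r addr0 [a + x *: u + _]addrAC; apply => y yt.
  apply: is_derive_line; apply: (Ck_derivable (Ck_D u hC)).
  exact: (H x y xr (le_lt_trans yt tr)).1.
exact: (H x y xr (le_lt_trans yt tr)).2.
Qed.

(** The second difference is symmetric in its two increments; at [s = t] its two expansions are
    compared and divided by [t * t]. *)
Lemma schwarz (V : normedModType R) (h : V -> R) (A : set V) (a u v : V) :
  open A -> Ck 2 h A -> A a -> 'D_v ('D_u h) a = 'D_u ('D_v h) a.
Proof.
move=> oA hC Aa; apply/eqP; rewrite -subr_eq0 -normr_le0; apply/ler_addgt0Pl => e e0.
rewrite addr0.
have e20 : 0 < e / 2 by rewrite divr_gt0.
have [d d0 H] := second_difference u v oA hC Aa e20.
have [d' d'0 H'] := second_difference v u oA hC Aa e20.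
pose t := Num.min d d' / 2.
have m0 : 0 < Num.min d d' by rewrite lt_min d0.
have t0 : 0 < t by rewrite divr_gt0.
have : `|t| < Num.min d d' by rewrite gtr0_norm// /t ltr_pdivrMr// mulr_natr mulr2n ltrDl.
rewrite lt_min => /andP[td td'].
have := lerD (H t t td td) (H' t t td' td').
rewrite -mulrDl -mulrDl -splitr [a + t *: v + _]addrAC.
set X := h (_ + _ + _); set Y := h (a + t *: u); set Z := h (a + t *: v) => B.
have : t * t * `|'D_v ('D_u h) a - 'D_u ('D_v h) a| <= t * t * e.
  rewrite (gtr0_norm t0) in B; rewrite (_ : t * t * e = e * t * t); last by ring.
  apply: le_trans B.
  rewrite -{1}(gtr0_norm (mulr_gt0 t0 t0)) -normrM.
  set P := 'D_v _ a; set Q := 'D_u _ a.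
  rewrite (_ : t * t * (P - Q) = (X - Z - Y + h a - t * (t * Q)) -
    (X - Y - Z + h a - t * (t * P))); last by ring.
  by rewrite [leRHS]addrC; exact: ler_normB.
by rewrite ler_pM2l ?mulr_gt0.
Qed.

End ContinuousDerivatives.

(** * Cousin's lemma and the calculus of matrix-valued functions *)

Section MatrixCurves.
Context (R : realType).

(* Cousin's lemma: an additive relation that holds on all small enough
   intervals around each point holds on [a, b]. *)
Lemma cousin (P : R -> R -> Prop) (a b : R) : a <= b ->
  (forall x y z, a <= x <= y -> y <= z <= b -> P x y -> P y z -> P x z) ->
  (forall s, a <= s <= b -> exists2 d : R, 0 < d &
     forall x y, a <= x <= s -> s <= y <= b -> s - d < x -> y < s + d -> P x y) ->
  P a b.
Proof.
move=> ab trans loc.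
pose S := [set t | a <= t <= b /\ P a t].
have Sa : S a.
  split; first by rewrite lexx ab.
  have [|d d0] := loc a; first by rewrite lexx ab.
  by apply; rewrite ?lexx ?ab// ?gtrBl// ltrDl.
have Sb : has_sup S.
  by split; [exists a|exists b => t [/andP[]]].
have Sub t : S t -> t <= sup S by move=> ?; exact: (ub_le_sup Sb.2).
have sb : sup S <= b by apply: ge_sup; [exists a|move=> t [/andP[]]].
have as_ := Sub _ Sa.
have [|d d0 H] := loc (sup S); first by rewrite as_ sb.
have [t [/andP[at_ tb] Pat] st] := sup_adherent d0 Sb.
have ts := Sub t (conj (introT andP (conj at_ tb)) Pat).
have Pas : P a (sup S).
  apply: (trans _ t); rewrite ?lexx ?at_ ?ts ?sb//.
  by apply: H; rewrite ?at_ ?ts ?lexx ?sb// ltrDl.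
have [<-//|sb'] := eqVneq (sup S) b.
have {sb'} sb' : sup S < b by rewrite lt_neqAle sb'.
pose y := Num.min b (sup S + d / 2).
have d2 : 0 < d / 2 by rewrite divr_gt0.
have sy : sup S < y by rewrite lt_min sb' ltrDl.
suff /Sub : S y by rewrite leNgt sy.
have yb : y <= b by rewrite ge_min lexx.
split; first by rewrite yb andbT (le_trans as_)// ltW.
apply: (trans _ (sup S)); rewrite ?lexx ?as_ ?(ltW sy) ?yb//.
apply: H; rewrite ?as_ ?lexx ?(ltW sy) ?yb// ?gtrBl//.
by rewrite gt_min ltrD2l ltr_pdivrMr// mulr_natr mulr2n ltrDr d0 orbT.
Qed.

Lemma is_derive_mulmx (V : normedModType R) m n p (A : V -> 'M[R]_(m, n))
    (B : V -> 'M[R]_(n, p)) (a v : V) A' B' :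
  is_derive a v A A' -> is_derive a v B B' ->
  is_derive a v (fun x => A x *m B x) (A' *m B a + A a *m B').
Proof.
move=> [dA <-] [dB <-].
have E i j : is_derive a v (fun x => (A x *m B x) i j)
    (('D_v A a *m B a + A a *m 'D_v B a) i j).
  have -> : (fun x => (A x *m B x) i j) = \sum_k (fun x => A x i k * B x k j).
    by apply/funext => x; rewrite mxE fct_sumE.
  apply: is_derive_eq.
    apply: is_derive_sum => k; apply: is_deriveM; apply: derivableP.
      by have /derivable_mxP := dA; apply.
    by have /derivable_mxP := dB; apply.
  rewrite !mxE -big_split; apply: eq_bigr => k _ /=.
  rewrite [in RHS]derive_mx// [in RHS]derive_mx// !mxE addrC.
  by congr (_ + _); rewrite /GRing.scale /= mulrC.
have dAB : derivable (fun x => A x *m B x) a v.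
  by apply/derivable_mxP => i j; case: (E i j).
by split=> //; rewrite derive_mx//; apply/matrixP => i j; rewrite mxE; case: (E i j).
Qed.

Lemma is_derive_trmx (V : normedModType R) m n (f : V -> 'M[R]_(m, n)) (a v : V) l :
  is_derive a v f l -> is_derive a v (fun x => (f x)^T) l^T.
Proof.
move=> /is_derive_mx H; apply/is_derive_mx => i j; rewrite mxE.
by under eq_fun do rewrite mxE; exact: H.
Qed.

Lemma cvg_mxP (T : Type) (F : set_system T) (FF : Filter F) m n
    (f : T -> 'M[R]_(m, n)) (l : 'M[R]_(m, n)) :
  f @ F --> l <-> forall i j, (fun x => f x i j) @ F --> l i j.
Proof.
split=> [/cvgrPdist_le H i j|H]; apply/cvgrPdist_le => e e0.
  apply: (@filterS _ F FF) (H e e0) => x; apply: le_trans.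
  by have := mx_coord_le (l - f x) i j; rewrite !mxE.
have : \forall x \near F, forall ij : 'I_m * 'I_n, `|l ij.1 ij.2 - f x ij.1 ij.2| <= e.
  by apply: filter_forall => -[i j] /=; have /cvgrPdist_le := H i j; apply.
apply: (@filterS _ F FF) => x Hx; apply/mx_norm_leP => [|i j]; first exact: ltW.
by rewrite !mxE; exact: (Hx (i, j)).
Qed.

Lemma cvg_mulmx (T : Type) (F : set_system T) (FF : Filter F) m n p
    (f : T -> 'M[R]_(m, n)) (g : T -> 'M[R]_(n, p)) (a : 'M[R]_(m, n)) (b : 'M[R]_(n, p)) :
  f @ F --> a -> g @ F --> b -> (fun x => f x *m g x) @ F --> a *m b.
Proof.
move=> /cvg_mxP fa /cvg_mxP gb; apply/cvg_mxP => i j; rewrite mxE.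
under eq_cvg do rewrite mxE.
apply: cvg_big => [|k _]; first exact: add_continuous.
by apply: cvgM.
Qed.

Lemma cvg_trmx (T : Type) (F : set_system T) (FF : Filter F) m n
    (f : T -> 'M[R]_(m, n)) (a : 'M[R]_(m, n)) :
  f @ F --> a -> (fun x => (f x)^T) @ F --> a^T.
Proof.
move=> /cvg_mxP fa; apply/cvg_mxP => i j; rewrite mxE.
by under eq_cvg do rewrite mxE; exact: fa.
Qed.

Lemma cvg_det (T : Type) (F : set_system T) (FF : Filter F) n
    (f : T -> 'M[R]_n) (a : 'M[R]_n) :
  f @ F --> a -> (fun x => \det (f x)) @ F --> \det a.
Proof.
move=> /cvg_mxP fa; rewrite /determinant.
apply: cvg_big => [|s _]; first exact: add_continuous.
apply: cvgM; first exact: cvg_cst.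
apply: cvg_big => [|i _]; [exact: mul_continuous|exact: fa].
Qed.

(** Convergence of the determinant makes [f] eventually invertible, and there the cofactor formula
    expresses the inverse by determinants. *)
Lemma cvg_invmx (T : Type) (F : set_system T) (FF : Filter F) n
    (f : T -> 'M[R]_n) (a : 'M[R]_n) :
  a \in unitmx -> f @ F --> a -> (fun x => invmx (f x)) @ F --> invmx a.
Proof.
move=> ua fa; have cd := cvg_det FF fa.
have da : \det a != 0 by move: ua; rewrite unitmxE unitfE.
have nz : \forall x \near F, f x \in unitmx.
  have : \forall x \near F, \det (f x) != 0 by apply: cvgr_neq0 cd da.
  apply: (@filterS _ F FF) => x.
  by rewrite unitmxE unitfE.
have -> : invmx a = (\det a)^-1 *: \adj a by rewrite /invmx ua.
apply: (@cvg_trans _ ((fun x => (\det (f x))^-1 *: \adj (f x)) @ F)).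
  apply: near_eq_cvg; apply: (@filterS _ F FF) nz => x ux; by rewrite /invmx ux.
apply: cvgZ; first exact: cvgV.
apply/cvg_mxP => i j; rewrite mxE.
under eq_cvg do rewrite mxE.
apply: cvgM; first exact: cvg_cst.
apply: cvg_det; move/cvg_mxP: fa => fa; apply/cvg_mxP => k l; rewrite !mxE.
by under eq_cvg do rewrite !mxE; exact: fa.
Qed.

(** Follows from [A(h)^-1 - A^-1 = - A(h)^-1 (A(h) - A) A^-1] and from the continuity of [A] along
    the line in direction [v]. *)
Lemma is_derive_invmx (V : normedModType R) n (A : V -> 'M[R]_n) (a v : V) A' :
  A a \in unitmx -> is_derive a v A A' ->
  is_derive a v (fun x => invmx (A x)) (- (invmx (A a) *m A' *m invmx (A a))).
Proof.
move=> uA dA.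
have cA : (fun h : R => A (h *: v + a)) @ 0^' --> A a.
  have /derivable1P/derivable1_diffP/differentiable_continuous := @ex_derive _ _ _ _ _ _ _ dA.
  rewrite /prop_for /continuous_at /= scale0r add0r => H.
  exact: cvg_trans (cvg_app _ (@nbhs_dnbhs _ _)) H.
have cI := cvg_invmx _ uA cA.
have nz : \forall h \near (0 : R)^', A (h *: v + a) \in unitmx.
  have da : \det (A a) != 0 by move: uA; rewrite unitmxE unitfE.
  have : \forall h \near (0 : R)^', \det (A (h *: v + a)) != 0.
    by apply: cvgr_neq0 (cvg_det _ cA) da.
  by apply: filterS => x; rewrite unitmxE unitfE.
have cv : (fun h => h^-1 *: (invmx (A (h *: v + a)) - invmx (A a))) @ (0 : R)^' -->
    - (invmx (A a) *m A' *m invmx (A a)).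
  apply: (@cvg_trans _ ((fun h => - (invmx (A (h *: v + a)) *m
      (h^-1 *: (A (h *: v + a) - A a)) *m invmx (A a))) @ (0 : R)^')).
    apply: near_eq_cvg; apply: filterS nz => h uh.
    rewrite -scalemxAr -scalemxAl -scalerN; congr (_ *: _).
    rewrite mulmxBr mulmxBl mulVmx// mul1mx opprB.
    by rewrite -mulmxA mulmxV// mulmx1.
  apply: cvgN; apply: cvg_mulmx; last exact: cvg_cst.
  apply: cvg_mulmx; first exact: cI.
  by case: dA => dA E; rewrite -[X in _ --> X]E; exact: dA.
by split; [apply/cvg_ex; eexists; exact: cv|apply: cvg_lim].
Qed.

Lemma mulmx_norm_le m n p (A : 'M[R]_(m, n)) (B : 'M[R]_(n, p)) :
  `|A *m B| <= n%:R * `|A| * `|B|.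
Proof.
apply/mx_norm_leP => [|i j]; first by rewrite !mulr_ge0.
rewrite mxE (le_trans (ler_norm_sum _ _ _))//.
apply: (@le_trans _ _ (\sum_(k < n) `|A| * `|B|)).
  by apply: ler_sum => k _; rewrite normrM ler_pM// mx_coord_le.
by rewrite sumr_const card_ord -mulrA mulr_natl.
Qed.

End MatrixCurves.

(** * Linear differential equations *)

Section LinearODE.
Context (R : realType).

Lemma primitive_exists (f : R -> R) (a : R) : continuous f ->
  exists F : R -> R, forall x, a < x -> is_derive x 1 F (f x).
Proof.
move=> cf; exists (fun x => \int[lebesgue_measure]_(t in `[a, x]%classic) f t) => x ax.
have xu : x < x + 1 by rewrite ltrDl.
have [] := @continuous_FTC1_closed R f a x (x + 1) xu _ ax (cf x).
  apply: continuous_compact_integrable; first exact: segment_compact.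
  exact: continuous_subspaceT.
by move=> dF <-; rewrite derive1E; exact: derivableP.
Qed.

Lemma primitive_mx_exists m n (f : R -> 'M[R]_(m, n)) (a : R) : continuous f ->
  exists F : R -> 'M[R]_(m, n), forall x, a < x -> is_derive x 1 F (f x).
Proof.
move=> cf.
have /(_ _)/cid-/all_sig[F FP] : forall ij : 'I_m * 'I_n, exists F : R -> R,
    forall x, a < x -> is_derive x 1 F (f x ij.1 ij.2).
  move=> [i j]; apply: primitive_exists => x.
  by have /cvg_mxP := cf x; apply.
exists (fun x => \matrix_(i, j) F (i, j) x) => x ax; apply/is_derive_mx => i j.
by under eq_fun do rewrite mxE; exact: (FP (i, j) x ax).
Qed.

(** The intervals of radius [2 * C / 2 ^+ k] around [x k] are nested, and the supremum of their left
    ends lies in all of them. *)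
Lemma geometric_limit (x : nat -> R) (C : R) : 0 <= C ->
  (forall k, `|x k.+1 - x k| <= C / 2 ^+ k) ->
  exists l, forall k, `|x k - l| <= 2 * C / 2 ^+ k.
Proof.
move=> C0 xC.
have p k : 0 < (2 : R) ^+ k by rewrite exprn_gt0.
pose y k := x k + 2 * C / 2 ^+ k; pose z k := x k - 2 * C / 2 ^+ k.
have E k : 2 * C / 2 ^+ k.+1 = C / 2 ^+ k.
  by rewrite exprS; field; rewrite gt_eqF.
have E2 k : 2 * C / 2 ^+ k = C / 2 ^+ k + C / 2 ^+ k by field; rewrite gt_eqF.
have zS k : z k <= z k.+1.
  rewrite /z E E2; have := xC k; rewrite ler_norml => /andP[]; lra.
have yS k : y k.+1 <= y k.
  rewrite /y E E2; have := xC k; rewrite ler_norml => /andP[]; lra.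
have zm j k : (j <= k)%N -> z j <= z k.
  by move=> jk; apply: (@homo_leq _ z (fun a b => a <= b)) => // a b c; exact: le_trans.
have ym j k : (j <= k)%N -> y k <= y j.
  by move=> jk; apply: (@homo_leq _ y (fun a b => b <= a)) => // a b c ba cb; exact: le_trans ba.
have zy j k : z j <= y k.
  have zyk i : z i <= y i.
    by rewrite /z /y lerD2l ge0_cp// divr_ge0 ?mulr_ge0// ltW.
  have [jk|kj] := leqP j k.
    exact: le_trans (zm _ _ jk) (zyk k).
  exact: le_trans (zyk j) (ym _ _ (ltnW kj)).
exists (sup (range z)) => k; rewrite distrC ler_distl; apply/andP; split.
  apply: (@ub_le_sup _ (range z)); last by exists k.
  by exists (y 0) => _ [j _ <-].
by apply: ge_sup; [exists (z 0), 0%N|move=> _ [j _ <-]; exact: zy].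
Qed.

(** Clamping time to the interval around [a] extends a function continuous there to one continuous
    on all of R, as [primitive_mx_exists] asks. *)
Definition clip (a d s : R) : R := Num.max (a - d) (Num.min (a + d) s).

Lemma clip_in a d s : 0 <= d -> `|clip a d s - a| <= d.
Proof.
move=> d0; rewrite /clip ler_distl le_max lexx /= ge_max.
by rewrite ge_min lexx lerD2l ge0_cp.
Qed.

Lemma clip_id a d s : `|s - a| <= d -> clip a d s = s.
Proof.
by rewrite ler_distl => /andP[ads sad]; rewrite /clip (min_idPr sad) (max_idPr ads).
Qed.

Lemma clip_continuous a d : continuous (clip a d).
Proof.
move=> s; apply: (@continuous_max _ _ (fun=> a - d) (fun s => Num.min (a + d) s)).
  exact: cst_continuous.
by apply: (@continuous_min _ _ (fun=> a + d) id); [exact: cst_continuous|].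
Qed.

Lemma mvt_ball m n (f f' : R -> 'M[R]_(m, n)) (a d K : R) : 0 <= K ->
  (forall s, `|s - a| <= d -> is_derive s 1 f (f' s)) ->
  (forall s, `|s - a| <= d -> `|f' s| <= K) ->
  forall s t, `|s - a| <= d -> `|t - a| <= d -> `|f t - f s| <= K * `|t - s|.
Proof.
move=> K0 df f'K s t; rewrite !ler_distl => /andP[s1 s2] /andP[t1 t2].
have B r : Num.min s t <= r -> r <= Num.max s t -> `|r - a| <= d.
  by rewrite ge_min le_max ler_distl; lra.
have [st|ts] := leP s t.
  rewrite (ger0_norm (_ : 0 <= t - s)) ?subr_ge0//.
  apply: (mvt_mx_le st K0 (f' := f')) => r /andP[sr rt]; [apply: df|apply: f'K];
  by apply: B; rewrite ?ge_min ?le_max ?sr ?rt ?orbT.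
rewrite distrC (ltr0_norm (_ : t - s < 0)) ?subr_lt0// opprB.
apply: (mvt_mx_le (ltW ts) K0 (f' := f')) => r /andP[sr rt]; [apply: df|apply: f'K];
by apply: B; rewrite ?ge_min ?le_max ?sr ?rt ?orbT.
Qed.

(** Picard iteration. The radius [d] depends neither on the initial time nor on the initial value,
    which is what lets Cousin's lemma join local solutions in [par_segment]. *)
Lemma linear_ode_local n (A : R -> 'M[R]_n) (s0 d0 : R) : 0 < d0 ->
  (forall s, `|s - s0| < d0 -> {for s, continuous A}) ->
  exists2 d : R, 0 < d & forall s1, `|s1 - s0| <= d -> forall x1 : 'rV[R]_n,
    exists2 x : R -> 'rV[R]_n, x s1 = x1 &
      forall s, `|s - s0| <= d -> is_derive s 1 x (x s *m A s).
Proof.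
move=> d00 cA.
have [d1 d10 Ad1] : exists2 d : R, 0 < d &
    forall s, `|s - s0| < d -> `|A s| <= `|A s0| + 1.
  have /continuous_epsP/(_ _ ltr01)[d d1 H] : {for s0, continuous A}.
    by apply: cA; rewrite subrr normr0.
  exists d => // s /H As; rewrite -lerBlDl; apply: le_trans As.
  by rewrite (le_trans _ (lerB_dist _ _)).
pose K : R := n.+1%:R * (`|A s0| + 1).
have K0 : 0 < K by rewrite mulr_gt0// ltr_wpDl.
(* On an interval of length [d + d] with [K * (d + d) <= 1/2], the integral operator halves
   distances. *)
pose d := Num.min (Num.min d0 d1) (K^-1 / 2) / 2.
have m0 : 0 < Num.min (Num.min d0 d1) (K^-1 / 2).
  by rewrite !lt_min d00 d10 divr_gt0// invr_gt0.
have dd : 0 < d by rewrite divr_gt0.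
have : d < Num.min (Num.min d0 d1) (K^-1 / 2).
  by rewrite /d ltr_pdivrMr// mulr_natr mulr2n ltrDl.
rewrite !lt_min -andbA => /and3P[dd0 dd1 _].
have Kd : K * (d + d) <= 2^-1.
  have : d + d <= K^-1 / 2.
    by rewrite -mulr2n -[d *+ 2]mulr_natr /d divfK// ge_min lexx orbT.
  by rewrite -(ler_pM2l K0) => /le_trans; apply; rewrite mulrA mulfV ?mul1r// gt_eqF.
exists d => // s1 s1d x1.
pose cl := clip s0 d.
have clin s : `|cl s - s0| <= d by apply: clip_in; exact: ltW.
have clid s : `|s - s0| <= d -> cl s = s by exact: clip_id.
have clc : continuous cl by exact: clip_continuous.
pose Ac s := A (cl s).
have cAc : continuous Ac.
  move=> s; apply: (@continuous_comp _ _ _ cl A); first exact: clc.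
  by apply: cA; exact: le_lt_trans dd0.
have AcK s : n%:R * `|Ac s| <= K.
  rewrite ler_pM// ?ler_nat//; apply: Ad1; exact: le_lt_trans dd1.
pose prim (f : R -> 'rV[R]_n) := fun F : R -> 'rV[R]_n =>
  F s1 = x1 /\ forall x, `|x - s0| <= d -> is_derive x 1 F (f x).
have primP f : continuous f -> exists F, prim f F.
  move=> /(primitive_mx_exists (s0 - (d + 1)))[F FP].
  exists (fun x => F x + (x1 - F s1)); split; first by rewrite addrC subrK.
  move=> x xd; rewrite -[f x]addr0; apply: is_deriveD; apply: FP.
  by move: xd; rewrite ler_distl; lra.
(* The Picard operator: a primitive with value [x1] at [s1]. It is picked by [xget] because its
   existence is known only when [v \o cl] is continuous. *)
pose I (v : R -> 'rV[R]_n) := xget (fun=> x1) (prim (fun s => v (cl s) *m Ac s)).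
pose good (v : R -> 'rV[R]_n) := continuous (v \o cl).
have goodI v : good v -> prim (fun s => v (cl s) *m Ac s) (I v).
  move=> gv; apply: (@xgetPex _ (fun=> x1) (prim (fun s => v (cl s) *m Ac s))).
  by apply: primP => s; apply: cvg_mulmx; [exact: gv|exact: cAc].
have Igood v : good v -> good (I v).
  move=> /goodI[_ H] s; apply: (@continuous_comp _ _ _ cl (I v)); first exact: clc.
  by apply: is_derive_continuous; exact: H.
have contr v w B : good v -> good w -> 0 <= B ->
    (forall s, `|s - s0| <= d -> `|v s - w s| <= B) ->
    forall s, `|s - s0| <= d -> `|I v s - I w s| <= B / 2.
  move=> gv gw B0 vw s sd; have [v1 dv] := goodI _ gv; have [w1 dw] := goodI _ gw.
  have := @mvt_ball _ _ (fun s => I v s - I w s)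
    (fun s => (v (cl s) - w (cl s)) *m Ac s) s0 d (K * B) _ _ _ s1 s s1d sd.
  rewrite /= v1 w1 subrr subr0 => H; apply: (le_trans (H _ _ _)).
  - by rewrite mulr_ge0// ltW.
  - by move=> r rd; rewrite mulmxBl; apply: is_deriveB; [exact: dv|exact: dw].
  - move=> r rd; rewrite (le_trans (mulmx_norm_le _ _))// mulrAC.
    by rewrite ler_pM// ?mulr_ge0//; apply: vw.
  rewrite mulrC mulrA [_ / 2]mulrC ler_wpM2r//; apply: le_trans Kd.
  rewrite mulrC ler_pM2l//; move: sd s1d; rewrite !ler_distl; lra.
pose u k := iter k I (fun=> x1).
have ug k : good (u k).
  elim: k => [|k /Igood//]; exact: cst_continuous.
pose B := K * `|x1| * (d + d).
have B0 : 0 <= B by rewrite /B !mulr_ge0// ?addr_ge0// ltW.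
have u01 s : `|s - s0| <= d -> `|u 1%N s - u 0%N s| <= B.
  move=> sd; have [v1 dv] := goodI _ (ug 0%N).
  have := @mvt_ball _ _ (u 1%N) (fun s => x1 *m Ac s) s0 d (K * `|x1|) _ _ _ s1 s s1d sd.
  rewrite [u 1%N s1]v1 => H; apply: (le_trans (H _ dv _)).
  - by rewrite mulr_ge0// ltW.
  - by move=> r _; rewrite (le_trans (mulmx_norm_le _ _))// mulrAC ler_wpM2r.
  rewrite /B ler_wpM2l ?mulr_ge0 ?(ltW K0)//.
  by move: sd s1d; rewrite !ler_distl; lra.
have uS k s : `|s - s0| <= d -> `|u k.+1 s - u k s| <= B / 2 ^+ k.
  elim: k s => [|k IH] s sd; first by rewrite expr0 divr1; exact: u01.
  have := contr _ _ _ (ug k.+1) (ug k) _ IH s sd.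
  rewrite exprSr invfM mulrA; apply.
  by rewrite divr_ge0 ?exprn_ge0.
have /(_ _)/cid-/all_sig[l lP] : forall sj : R * 'I_n, exists l, forall k,
    `|u k (cl sj.1) 0 sj.2 - l| <= 2 * B / 2 ^+ k.
  move=> [s j] /=; apply: geometric_limit => // k.
  apply: le_trans (uS k (cl s) (clin s)).
  by have := mx_coord_le (u k.+1 (cl s) - u k (cl s)) 0 j; rewrite !mxE.
have clcl s : cl (cl s) = cl s by apply: clid.
pose v s := \row_j l (cl s, j).
have p k : 0 <= 2 * B / 2 ^+ k by apply: divr_ge0; [exact: mulr_ge0|exact: exprn_ge0].
have uv k s : `|u k (cl s) - v s| <= 2 * B / 2 ^+ k.
  by apply/mx_norm_leP => // i j; rewrite !mxE ord1; by have := lP (cl s, j) k; rewrite /= clcl.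
have small e : 0 < e -> exists k, 2 * B / 2 ^+ k <= e.
  move=> e0; pose k := Num.bound (2 * B / e); exists k.
  have kB : 2 * B / e < k%:R by apply: archi_boundP; apply: divr_ge0; [exact: mulr_ge0|exact: ltW].
  rewrite ler_pdivrMr ?exprn_gt0// -ler_pdivrMl// [leLHS]mulrC.
  by rewrite (le_trans (ltW kB))// -natrX ler_nat ltnW// ltn_expl.
have vcl s : v (cl s) = v s by rewrite /v clcl.
have gv : good v.
  move=> s; apply/continuous_epsP => e e0.
  have [k ke] := small (e / 3) (divr_gt0 e0 (ltr0n _ 3)).
  have /continuous_epsP/(_ (e / 3))[|r r0 H] := ug k s; first by rewrite divr_gt0.
  exists r => // t /H /=; rewrite !vcl => ut.
  rewrite (_ : v t - v s = (u k (cl t) - u k (cl s)) - (u k (cl t) - v t) +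
    (u k (cl s) - v s)); last by rewrite opprB [_ - _ + (_ - _)]addrC !subrKA.
  rewrite (le_trans (ler_normD _ _))// (_ : e = e / 3 + e / 3 + e / 3); last by field.
  rewrite lerD ?(le_trans (uv _ _))// (le_trans (ler_normB _ _))//.
  by rewrite lerD ?(le_trans (uv _ _)).
(* [I v] and [v] are both within a multiple of [2 ^- k] of the iterate [u k.+1], so [v] is a fixed
   point of [I] on the ball. *)
have Iv s : `|s - s0| <= d -> I v s = v s.
  move=> sd; apply/eqP; rewrite -subr_eq0 -normr_le0; apply/ler_addgt0Pl => e e0.
  have [k ke] := small _ e0; rewrite addr0; apply: le_trans ke.
  have := contr v (u k) _ gv (ug k) (p k) _ s sd.
  move=> /(_ _)/le_trans-H; rewrite -(subrKA (u k.+1 s)) (le_trans (ler_normD _ _))//.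
  rewrite [leRHS](_ : _ = 2 * B / 2 ^+ k / 2 + 2 * B / 2 ^+ k.+1); last first.
    by rewrite exprS; field; rewrite gt_eqF// exprn_gt0.
  rewrite lerD//; last by rewrite -{1}(clid s sd).
  by apply: H => // r rd; rewrite distrC -{1}(clid r rd).
have [I1 dI] := goodI _ gv.
exists (I v) => // s sd; rewrite Iv//.
by have := dI s sd; rewrite /Ac clid.
Qed.

End LinearODE.

(** * Charts, metric and Christoffel symbols *)

(* The notions of [Riemannian] that are defined by derivatives are locked:
   unfolded, they would be compared by conversion on every rewriting. *)
HB.lock Definition bform (R : realType) (n : nat) (a : 'rV[R]_n) (A : 'M[R]_n)
  (b : 'rV[R]_n) : R := (a *m A *m b^T) 0 0.

HB.lock Definition tc (R : realType) (n : nat) (M : riemannianManifold R n)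
  (q p : M) (v : 'rV[R]_n) : 'rV[R]_n := tcoord q p v.

HB.lock Definition gr (R : realType) (n : nat) (M : riemannianManifold R n)
  (q : M) (u : 'rV[R]_n) : 'M[R]_n := gram q u.

HB.lock Definition chr (R : realType) (n : nat) (M : riemannianManifold R n)
  (q : M) (u v w : 'rV[R]_n) : 'rV[R]_n := christoffel q u v w.

Definition transition (R : realType) (n : nat) (M : riemannianManifold R n)
  (p q : M) : 'rV[R]_n -> 'rV[R]_n := chart q \o ichart p.

HB.lock Definition jac (R : realType) (n : nat) (M : riemannianManifold R n)
  (p q : M) (u : 'rV[R]_n) : 'M[R]_n :=
  \matrix_(i, j) ('D_(delta_mx 0 i) (transition p q) u) 0 j.

HB.lock Definition dgr (R : realType) (n : nat) (M : riemannianManifold R n)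
  (q : M) (u v : 'rV[R]_n) : 'M[R]_n := 'D_v (gr q) u.

HB.lock Definition djac (R : realType) (n : nat) (M : riemannianManifold R n)
  (p q : M) (u v : 'rV[R]_n) : 'M[R]_n := 'D_v (jac p q) u.

Section Form.
Context (R : realType) (n : nat).
Implicit Types (a b c : 'rV[R]_n) (A B : 'M[R]_n).

Lemma bformDl a a' A b : bform (a + a') A b = bform a A b + bform a' A b.
Proof. by rewrite unlock !mulmxDl mxE. Qed.

Lemma bformDr a A b b' : bform a A (b + b') = bform a A b + bform a A b'.
Proof. by rewrite unlock [(b + b')^T]linearD mulmxDr mxE. Qed.

Lemma bformDm a A B b : bform a (A + B) b = bform a A b + bform a B b.
Proof. by rewrite unlock mulmxDr mulmxDl mxE. Qed.

Lemma bformZl k a A b : bform (k *: a) A b = k * bform a A b.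
Proof. by rewrite unlock -!scalemxAl mxE. Qed.

Lemma bformZr k a A b : bform a A (k *: b) = k * bform a A b.
Proof. by rewrite unlock [(k *: b)^T]linearZ -scalemxAr mxE. Qed.

Lemma bformZm k a A b : bform a (k *: A) b = k * bform a A b.
Proof. by rewrite unlock -scalemxAr -scalemxAl mxE. Qed.

Lemma bformNl a A b : bform (- a) A b = - bform a A b.
Proof. by rewrite -scaleN1r bformZl mulN1r. Qed.

Lemma bformNr a A b : bform a A (- b) = - bform a A b.
Proof. by rewrite -scaleN1r bformZr mulN1r. Qed.

Lemma bformBl a a' A b : bform (a - a') A b = bform a A b - bform a' A b.
Proof. by rewrite bformDl bformNl. Qed.

Lemma bformBr a A b b' : bform a A (b - b') = bform a A b - bform a A b'.
Proof. by rewrite bformDr bformNr. Qed.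

Lemma bform0l A b : bform 0 A b = 0.
Proof. by rewrite -(scale0r (0 : 'rV[R]_n)) bformZl mul0r. Qed.

Lemma bform0r A b : bform b A 0 = 0.
Proof. by rewrite -(scale0r (0 : 'rV[R]_n)) bformZr mul0r. Qed.

Lemma bform_mul a A B b : bform (a *m A) B b = bform a (A *m B) b.
Proof. by rewrite unlock mulmxA. Qed.

Lemma bform_mul_tr a A B b : bform a A (b *m B) = bform a (A *m B^T) b.
Proof. by rewrite unlock trmx_mul !mulmxA. Qed.

Lemma bform_delta A i j : bform (delta_mx 0 i) A (delta_mx 0 j) = A i j.
Proof. by rewrite unlock -rowE trmx_delta -colE !mxE. Qed.

Lemma bform_sym A a b : A^T = A -> bform a A b = bform b A a.
Proof.
rewrite unlock => As; rewrite -[in LHS](trmxK (a *m A *m b^T)) mxE.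
by rewrite !trmx_mul trmxK As mulmxA.
Qed.

Lemma bform_summ (I : finType) (F : I -> 'M[R]_n) a b :
  bform a (\sum_i F i) b = \sum_i bform a (F i) b.
Proof.
rewrite unlock mulmx_sumr mulmx_suml summxE; apply: eq_bigr => i _.
by [].
Qed.

Lemma bform1 a b : bform a 1%:M b = (a *m b^T) 0 0.
Proof. by rewrite unlock mulmx1. Qed.

Lemma bform_inj A a b : A \in unitmx -> (forall x, bform a A x = bform b A x) -> a = b.
Proof.
move=> uA H; apply: (can_inj (mulmxK uA)); apply/rowP => j.
have := H (delta_mx 0 j); rewrite unlock trmx_delta -!colE !mxE.
exact.
Qed.

End Form.

Section Charts.
Context (R : realType) (n : nat) (M : riemannianManifold R n).
Implicit Types (p q z : M) (u v w : 'rV[R]_n).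

Definition overlap p q : set 'rV[R]_n := chart p @` (dom p `&` dom q).

Lemma jac_entry p q u i j :
  jac p q u i j = ('D_(delta_mx 0 i) (transition p q) u) 0 j.
Proof. by rewrite unlock mxE. Qed.

Lemma near_dom p q z : dom p z -> dom q z ->
  \forall u \near chart p z, overlap p q u /\ dom q (ichart p u).
Proof.
move=> pz qz.
have Hp : \forall u \near chart p z, (chart p @` dom p) u.
  by apply: open_nbhs_nbhs; split; [exact: chart_open|exists z].
have Hq : \forall u \near chart p z, dom q (ichart p u).
  have := ichart_continuous pz; rewrite /prop_for /continuous_at chartK//; apply.
  by apply: open_nbhs_nbhs; split; [exact: dom_open|].
near=> u.
have [z' pz' E] : (chart p @` dom p) u by near: u.
have qu : dom q (ichart p u) by near: u.
split=> //; exists z' => //; split=> //.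
by move: qu; rewrite -E chartK.
Unshelve. all: by end_near. Qed.

Lemma overlap_open p q : open (overlap p q).
Proof.
rewrite openE => _ [z [pz qz] <-]; apply: filterS (near_dom pz qz) => u [].
exact.
Qed.

Lemma overlap_chart p q z : dom p z -> dom q z -> overlap p q (chart p z).
Proof. by move=> pz qz; exists z. Qed.

Lemma transitionE p q z : dom p z -> transition p q (chart p z) = chart q z.
Proof. by move=> pz; rewrite /transition /= chartK. Qed.

Lemma transition_Ck k p q : Ck k (transition p q) (overlap p q).
Proof. exact: transition_smooth. Qed.

Lemma transition_differentiable p q u : overlap p q u ->
  differentiable (transition p q) u.
Proof.
move=> uo; apply: C1_differentiable_mx uo; first exact: findim_rV.
  exact: overlap_open.
exact: transition_Ck.
Qed.

Lemma D_transition p q u v : overlap p q u ->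
  'D_v (transition p q) u = v *m jac p q u.
Proof.
move=> uo; have dt := transition_differentiable uo.
rewrite deriveE// {1}(row_sum_delta v) linear_sum; apply/rowP => j.
rewrite summxE mxE; apply: eq_bigr => i _.
by rewrite linearZ mxE -deriveE// jac_entry.
Qed.

Lemma diff_chain (U V W : normedModType R) (f : U -> V) (g : V -> W) (a v : U) :
  differentiable f a -> differentiable g (f a) ->
  'D_v (g \o f) a = 'D_('D_v f a) g (f a).
Proof.
move=> df dg; have dgf := differentiable_comp df dg.
by rewrite deriveE// diff_comp//= [RHS]deriveE//= [in RHS]deriveE.
Qed.

Lemma jac_eq p q u (A : 'M[R]_n) :
  (forall v, 'D_v (transition p q) u = v *m A) -> jac p q u = A.
Proof.
move=> H; by apply/matrixP => i j; rewrite jac_entry H -rowE mxE.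
Qed.

Lemma jac_chain p q r z : dom p z -> dom q z -> dom r z ->
  jac p q (chart p z) *m jac q r (chart q z) = jac p r (chart p z).
Proof.
move=> pz qz rz; apply/esym; apply: jac_eq => v.
have E : \forall u \near chart p z, (transition q r \o transition p q) u = transition p r u.
  apply: filterS (near_dom pz qz) => u [_ qu].
  by rewrite /transition /= chartK.
rewrite -(near_eq_D _ E) diff_chain.
- rewrite !D_transition ?mulmxA ?transitionE//; exact: overlap_chart.
- by apply: transition_differentiable; exact: overlap_chart.
- by rewrite transitionE//; apply: transition_differentiable; exact: overlap_chart.
Qed.

Lemma jac_id p z : dom p z -> jac p p (chart p z) = 1%:M.
Proof.
move=> pz; apply: jac_eq => v; rewrite mulmx1.
have E : \forall u \near chart p z, id u = transition p p u.
  by apply: filterS (near_dom pz pz) => _ [[z' [pz' _] <-] _]; rewrite /transition /= chartK.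
by rewrite -(near_eq_D _ E) derive_id.
Qed.

Lemma jacK p q z : dom p z -> dom q z ->
  jac p q (chart p z) *m jac q p (chart q z) = 1%:M.
Proof. by move=> pz qz; rewrite jac_chain// jac_id. Qed.

Lemma tcoordE q z v : tcoord q z v = tc q z v. Proof. by rewrite unlock. Qed.

Lemma gramE q u : gram q u = gr q u. Proof. by rewrite unlock. Qed.

Lemma christoffelE q u v w : christoffel q u v w = chr q u v w.
Proof. by rewrite unlock. Qed.

Lemma innerE z v w : inner z v w = bform v (metric z) w.
Proof. by rewrite unlock. Qed.

Lemma tcE q z v : dom q z -> tc q z v = v *m jac z q (chart z z).
Proof.
move=> qz; rewrite unlock /tcoord -[_ \o _]/(transition z q) D_transition//.
by apply: overlap_chart; first exact: dom_refl.
Qed.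

Lemma tc_id z v : tc z z v = v.
Proof. by rewrite tcE ?jac_id ?mulmx1//; exact: dom_refl. Qed.

Lemma tc_change p q z v : dom p z -> dom q z ->
  tc q z v = tc p z v *m jac p q (chart p z).
Proof.
move=> pz qz; rewrite (tcE _ pz) (tcE _ qz) -mulmxA (jac_chain (dom_refl z))//.
Qed.

Lemma tcK q z v : dom q z -> tc q z v *m jac q z (chart q z) = v.
Proof.
by move=> qz; rewrite tcE// -mulmxA jacK ?mulmx1//; exact: dom_refl.
Qed.

Lemma tcKV q z v : dom q z -> tc q z (v *m jac q z (chart q z)) = v.
Proof.
by move=> qz; rewrite tcE// -mulmxA jacK ?mulmx1//; exact: dom_refl.
Qed.

Lemma tc_linear q z : dom q z -> linear (tc q z).
Proof. by move=> qz a v w; rewrite !(tcE _ qz) mulmxDl scalemxAl. Qed.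

Lemma grE q z : dom q z -> gr q (chart q z) =
  jac q z (chart q z) *m metric z *m (jac q z (chart q z))^T.
Proof.
move=> qz; have zz := dom_refl z.
have E v : 'D_v (chart z \o ichart q) (chart q z) = v *m jac q z (chart q z).
  by rewrite -[_ \o _]/(transition q z) D_transition//; exact: overlap_chart.
apply/matrixP => i j; rewrite -gramE mxE chartK// innerE !E.
by rewrite bform_mul_tr bform_mul bform_delta mulmxA.
Qed.

Lemma inner_gr q z v w : dom q z ->
  inner z v w = bform (tc q z v) (gr q (chart q z)) (tc q z w).
Proof.
move=> qz; rewrite innerE (grE qz) -[_ *m (jac _ _ _)^T]mulmxA.
by rewrite -bform_mul -bform_mul_tr !tcK.
Qed.

Lemma gr_change p q z : dom p z -> dom q z -> gr p (chart p z) =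
  jac p q (chart p z) *m gr q (chart q z) *m (jac p q (chart p z))^T.
Proof.
move=> pz qz; have zz := dom_refl z.
rewrite (grE pz) (grE qz) -(jac_chain pz qz zz) trmx_mul.
by rewrite !mulmxA.
Qed.

Lemma gr_self z : gr z (chart z z) = metric z.
Proof.
have zz := dom_refl z.
by rewrite grE// jac_id// mul1mx trmx1 mulmx1.
Qed.

Lemma jac_unit p q z : dom p z -> dom q z -> jac p q (chart p z) \in unitmx.
Proof. by move=> pz qz; have [H _] := mulmx1_unit (jacK pz qz); exact: H. Qed.

Lemma metric_unit z : metric z \in unitmx.
Proof.
rewrite -row_free_unit -kermx_eq0; apply/rowV0P => v /sub_kermxP vm.
apply/eqP; apply: contraT => /(@metric_pos _ _ M z); by rewrite vm mul0mx mxE ltxx.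
Qed.

Lemma gr_unit q z : dom q z -> gr q (chart q z) \in unitmx.
Proof.
move=> qz; rewrite (grE qz) !unitmx_mul unitmx_tr metric_unit.
by rewrite jac_unit//; exact: dom_refl.
Qed.

Lemma gr_sym q z : dom q z -> (gr q (chart q z))^T = gr q (chart q z).
Proof. by move=> qz; rewrite (grE qz) !trmx_mul trmxK Defs.metric_sym mulmxA. Qed.

Definition chart_dom q : set 'rV[R]_n := chart q @` dom q.

Lemma chart_dom_open q : open (chart_dom q). Proof. exact: chart_open. Qed.

Lemma chart_dom_in q z : dom q z -> chart_dom q (chart q z).
Proof. by exists z. Qed.

Lemma near_chart_dom q z : dom q z -> \forall u \near chart q z, chart_dom q u.
Proof.
by move=> qz; apply: open_nbhs_nbhs; split; [exact: chart_dom_open|exists z].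
Qed.

Lemma gr_Ck k q : Ck k (gr q) (chart_dom q).
Proof.
rewrite (_ : gr q = gram q); last by apply/funext => u; rewrite gramE.
exact: metricC.
Qed.

Lemma gr_differentiable q u : chart_dom q u -> differentiable (gr q) u.
Proof.
move=> qu; apply: C1_differentiable_mx qu; first exact: findim_rV.
  exact: chart_dom_open.
exact: gr_Ck.
Qed.

Lemma gr_continuous q u : chart_dom q u -> {for u, continuous (gr q)}.
Proof. by move=> /gr_differentiable/differentiable_continuous. Qed.

Lemma is_derive_gr q u v : chart_dom q u -> is_derive u v (gr q) (dgr q u v).
Proof.
by move=> /gr_differentiable/diff_derivable qu; rewrite dgr.unlock; exact: derivableP.
Qed.

Lemma dgr_sym q z v : dom q z -> (dgr q (chart q z) v)^T = dgr q (chart q z) v.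
Proof.
move=> qz; have [_ <-] := is_derive_trmx (is_derive_gr v (chart_dom_in qz)).
rewrite dgr.unlock; apply: near_eq_D; apply: filterS (near_chart_dom qz) => _ [z' qz' <-].
exact: gr_sym.
Qed.

Lemma dgr_linear q u : chart_dom q u -> linear (dgr q u).
Proof.
move=> /gr_differentiable dg a v w.
by rewrite dgr.unlock (deriveE _ dg) linearP -!deriveE.
Qed.

Lemma dgr_sum q u (x : 'rV[R]_n) : chart_dom q u ->
  dgr q u x = \sum_l x 0 l *: dgr q u (ebasis R l).
Proof.
move=> /gr_differentiable dg; rewrite dgr.unlock.
rewrite deriveE// {1}(row_sum_delta x) linear_sum; apply: eq_bigr => i _.
by rewrite linearZ [in RHS]deriveE.
Qed.

Lemma chrE q u v w : chr q u v w =
  2^-1 *: ((\row_l ((w *m dgr q u v) ord0 l + (v *m dgr q u w) ord0 l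
    - bform v (dgr q u (ebasis R l)) w)) *m (invmx (gr q u))^T).
Proof.
have gE : gram q = gr q by apply/funext => u'; rewrite gramE.
rewrite dgr.unlock -christoffelE; apply/rowP => k; rewrite mxE [RHS]mxE.
congr (_ * _); rewrite [RHS]mxE; apply: eq_bigr => l _.
by rewrite [X in _ = X * _]mxE [X in _ = _ * X]mxE mulrC bform.unlock gE.
Qed.

Lemma bform_row_sum (A B : 'M[R]_n) (C : 'I_n -> 'M[R]_n) v w x :
  bform (\row_l ((w *m A) ord0 l + (v *m B) ord0 l - bform v (C l) w)) 1%:M x =
  bform w A x + bform v B x - bform v (\sum_l x 0 l *: C l) w.
Proof.
have F (a : 'rV[R]_n) : bform a 1%:M x = \sum_l a ord0 l * x 0 l.
  by rewrite bform1 mxE; apply: eq_bigr => l _; congr (_ * _); rewrite mxE.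
rewrite -[A]mulmx1 -[B]mulmx1 -!bform_mul bform_summ !F !mulmx1 -big_split -sumrB.
apply: eq_bigr => l _ /=; rewrite [X in X * _]mxE bformZm.
move: ((w *m A) 0 l) ((v *m B) 0 l) (bform _ _ _) (x 0 l) => a b c d; ring.
Qed.

(** Pairing with the metric removes its inverse from the definition of the Christoffel symbols.
    Symmetry, linearity, metric compatibility and the change of chart are read off this formula
    instead of index sums. *)
Lemma koszul q z v w x : dom q z -> let u := chart q z in
  bform (chr q u v w) (gr q u) x =
  2^-1 * (bform w (dgr q u v) x + bform v (dgr q u w) x - bform v (dgr q u x) w).
Proof.
move=> qz u; rewrite (dgr_sum x (chart_dom_in qz)) -bform_row_sum chrE bformZl bform_mul.
by rewrite trmx_inv (gr_sym qz) (mulVmx (gr_unit qz)).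
Qed.

Lemma chrC q z v w : dom q z ->
  chr q (chart q z) v w = chr q (chart q z) w v.
Proof.
move=> qz; apply: (bform_inj (gr_unit qz)) => x.
rewrite (koszul v w x qz) (koszul w v x qz).
by rewrite (bform_sym v w (dgr_sym x qz)); ring.
Qed.

Lemma metric_compat q z v w x : dom q z -> let u := chart q z in
  bform v (dgr q u x) w =
  bform (chr q u x v) (gr q u) w + bform v (gr q u) (chr q u x w).
Proof.
move=> qz u; rewrite (bform_sym v (chr q u x w) (gr_sym qz)).
rewrite (koszul x v w qz) (koszul x w v qz).
by rewrite (bform_sym w v (dgr_sym x qz)); field.
Qed.

Lemma chr_linear q z v : dom q z -> linear (chr q (chart q z) v).
Proof.
move=> qz a w w'; apply: (bform_inj (gr_unit qz)) => x.
rewrite bformDl bformZl (koszul v _ x qz) (koszul v w x qz) (koszul v w' x qz).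
rewrite (dgr_linear (chart_dom_in qz)).
rewrite bformDl bformDm bformDr bformZl bformZm bformZr; ring.
Qed.

Lemma jac_derivable p q u v : overlap p q u -> derivable (jac p q) u v.
Proof.
move=> uo; apply/derivable_mxP => i j.
have /derivable_mxP/(_ 0 j) := @Ck_derivable _ _ _ 0 _ _
  (Ck_D (delta_mx 0 i) (transition_Ck 2 p q)) u v uo.
by rewrite (_ : (fun u => jac p q u i j) =
  (fun u => ('D_(delta_mx 0 i) (transition p q) u) 0 j))//;
  apply/funext => u'; rewrite jac_entry.
Qed.

Lemma jac_differentiable p q u : overlap p q u -> differentiable (jac p q) u.
Proof.
move=> uo; apply: differentiable_mx => i j.
rewrite (_ : (fun u => jac p q u i j) =
  (fun u => ('D_(delta_mx 0 i) (transition p q) u) 0 j)).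
  apply: C1_differentiable uo; first exact: findim_rV.
    exact: overlap_open.
  apply: Ck_coord; first exact: overlap_open.
  exact: (Ck_D _ (transition_Ck 2 p q)).
by apply/funext => u'; rewrite jac_entry.
Qed.

Lemma is_derive_jac p q u v : overlap p q u ->
  is_derive u v (jac p q) (djac p q u v).
Proof.
by move=> /(@jac_derivable p q u v) uo; rewrite djac.unlock; exact: derivableP.
Qed.

Lemma D_jac p q u v w : overlap p q u ->
  w *m djac p q u v = 'D_v ('D_w (transition p q)) u.
Proof.
move=> uo.
have dj := is_derive_jac v uo.
have H := is_derive_mulmx (is_derive_cst w u v) dj.
have E : 'D_v (fun u => w *m jac p q u) u = w *m djac p q u v.
  case: H => _.
  rewrite mul0mx add0r.
  exact.
rewrite -E.
apply: near_eq_D; have : \forall u \near u, overlap p q u.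
  by apply: open_nbhs_nbhs; split=> //; exact: overlap_open.
by apply: filterS => u' /D_transition ->.
Qed.

(** [w *m djac p q u v] is the second derivative of the transition map along [w] and [v], so this is
    Schwarz's theorem coordinate by coordinate. *)
Lemma D_jac_sym p q u v w : overlap p q u ->
  w *m djac p q u v = v *m djac p q u w.
Proof.
move=> uo; rewrite (D_jac v w uo) (D_jac w v uo); apply/rowP => j.
have C2 := transition_Ck 2 p q; have oo : open (overlap p q) by exact: overlap_open.
have E a b : ('D_a ('D_b (transition p q)) u) 0 j =
    'D_a ('D_b (fun u => transition p q u 0 j)) u.
  rewrite derive_mx ?mxE; last exact: (Ck_derivable (Ck_D b C2)).
  apply: near_eq_D; have : \forall u \near u, overlap p q u.
    by apply: open_nbhs_nbhs; split.
  apply: filterS => u' uo'; rewrite derive_mx ?mxE//.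
  exact: (Ck_derivable C2).
apply: (eq_trans (E v w)); apply: (eq_trans _ (esym (E w v))).
exact: (@schwarz _ _ (fun u => transition p q u 0 j) _ u w v oo (Ck_coord 0 j oo C2) uo).
Qed.

(* The second derivative of a change of chart is what prevents the Christoffel
   symbols from being a tensor. *)
Lemma chr_change p q z v w : dom p z -> dom q z ->
  let J := jac p q (chart p z) in
  chr p (chart p z) v w *m J =
  w *m djac p q (chart p z) v + chr q (chart q z) (v *m J) (w *m J).
Proof.
move=> pz qz J; set u := chart p z; have uo : overlap p q u by exact: overlap_chart.
have uJ : J \in unitmx by exact: jac_unit.
apply: (bform_inj (gr_unit qz)) => y.
pose x := y *m invmx J; have -> : y = x *m J by rewrite mulmxKV.
set G := gr q (chart q z).
(* Product rule for [J *m gr q *m J^T], the expression of [gr p] through the other chart. *)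
have DG a : dgr p u a = djac p q u a *m G *m J^T +
    J *m dgr q (chart q z) (a *m J) *m J^T + J *m G *m (djac p q u a)^T.
  have Ej := is_derive_jac a uo.
  have dG := gr_differentiable (chart_dom_in qz).
  have Eg : is_derive u a (gr q \o transition p q) (dgr q (chart q z) (a *m J)).
    have dt := transition_differentiable uo.
    have dgt : differentiable (gr q) (transition p q u) by rewrite transitionE.
    split; first by apply: diff_derivable; exact: differentiable_comp.
    by rewrite diff_chain// D_transition// transitionE// dgr.unlock.
  have [_ /esym] := is_derive_mulmx (is_derive_mulmx Ej Eg) (is_derive_trmx Ej).
  rewrite /= (transitionE q pz) mulmxDl => ->; rewrite dgr.unlock; apply: near_eq_D.
  apply: filterS (near_dom pz qz) => _ [[z' [pz' qz'] <-] _] /=.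
  by rewrite (transitionE q pz') (gr_change pz' qz').
have F a b X Y : bform a (X *m Y *m J^T) b = bform (a *m X) Y (b *m J).
  by rewrite bform_mul_tr bform_mul mulmxA.
have F' a b X : bform a (J *m G *m X^T) b = bform (b *m X) G (a *m J).
  by rewrite (bform_sym _ _ (gr_sym qz)) bform_mul_tr bform_mul mulmxA.
rewrite bform_mul bform_mul_tr -(mulmxA _ G) mulmxA -mulmxA.
have -> : J *m (G *m J^T) = gr p u by rewrite (gr_change pz qz) mulmxA.
rewrite (koszul v w x pz) -/u bformDl (koszul (v *m J) (w *m J) (x *m J) qz) -/G.
rewrite !DG !bformDm !F !F'.
(* With the second derivatives of the transition map symmetrized, they cancel in the Koszul sum
   except for two equal terms, which make up the one with [w *m djac p q u v]. *)
rewrite (D_jac_sym w v uo) (D_jac_sym x v uo) (D_jac_sym x w uo).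
by field.
Qed.

End Charts.

(** * Parallel fields and geodesics *)

Section Curves.
Context (R : realType) (n : nat) (M : riemannianManifold R n).
Implicit Types (p q z : M) (c : R -> M) (X Y : R -> 'rV[R]_n).

(** Parallelism at a single time, read in the chart of an arbitrary point [p]. In [parallel] the
    chart changes with the time, whereas a differential equation has to be solved in a fixed one. *)
Definition par_at p c X (s : R) : Prop :=
  is_derive s 1 (fun r => tc p (c r) (X r))
    (- chr p (chart p (c s)) (tc p (c s) (velocity c s)) (tc p (c s) (X s))).

Lemma near_curve c p s : continuous c -> dom p (c s) ->
  \forall r \near s, dom p (c r).
Proof.
by move=> cc pc; apply: cc; apply: open_nbhs_nbhs; split; [exact: dom_open|].
Qed.

Lemma is_derive_near (V W : normedModType R) (f g : V -> W) (a v : V) l :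
  (\forall u \near a, f u = g u) -> is_derive a v f l -> is_derive a v g l.
Proof.
move=> fg [df <-]; split; first exact: near_eq_dvbl df.
by apply/esym; exact: near_eq_D.
Qed.

Lemma curve_derive c p s : C1_curve c -> dom p (c s) ->
  is_derive s 1 (chart p \o c) (tc p (c s) (velocity c s)).
Proof.
move=> [cc C1] pc; have [/nbhs_singleton dc _] := C1 s.
have zz := dom_refl (c s).
have H : is_derive s 1 (chart (c s) \o c) (velocity c s).
  by rewrite /velocity derive1E; exact: derivableP.
have o := overlap_chart zz pc.
have := is_derive_comp (h := transition (c s) p) (transition_differentiable o) H.
rewrite (D_transition _ o) -(tcE _ pc); apply: is_derive_near.
by apply: filterS (near_curve cc zz) => r rc; rewrite /= transitionE.
Qed.

Lemma chart_curve_continuous c p s : C1_curve c -> dom p (c s) ->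
  {for s, continuous (chart p \o c)}.
Proof. by move=> C1 pc; exact: is_derive_continuous (curve_derive C1 pc). Qed.

Lemma velocity_continuous c p s : C1_curve c -> dom p (c s) ->
  {for s, continuous (fun r => tc p (c r) (velocity c r))}.
Proof.
move=> C1c pc; have [cc C1] := C1c; have [dc vc] := C1 s.
have zz := dom_refl (c s); have o := overlap_chart zz pc.
set w := fun r => derive1 _ r in vc.
have jc : {for s, continuous (fun r => jac (c s) p (chart (c s) (c r)))}.
  apply: (@continuous_comp _ _ _ (chart (c s) \o c) (jac (c s) p)).
    exact: chart_curve_continuous.
  exact: (differentiable_continuous (jac_differentiable o)).
have : {for s, continuous (fun r => w r *m jac (c s) p (chart (c s) (c r)))}.
  exact: (cvg_mulmx _ vc jc).
apply: near_eq_continuous; near=> r.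
have rz : dom (c s) (c r) by near: r; exact: near_curve.
have rp : dom p (c r) by near: r; exact: near_curve.
have dr : derivable (chart (c s) \o c) r 1 by near: r.
rewrite (tc_change _ rz rp); congr (_ *m _).
by have [_ <-] := curve_derive C1c rz; rewrite /w derive1E.
Unshelve. all: by end_near. Qed.

(** Differentiating the Jacobian along the curve produces a second derivative of the transition map,
    exactly the extra term of [chr_change]. *)
Lemma par_change c X p q s : C1_curve c -> dom p (c s) -> dom q (c s) ->
  par_at p c X s -> par_at q c X s.
Proof.
move=> C1c pc qc; have cc := C1c.1; have o := overlap_chart pc qc.
rewrite /par_at (tc_change _ pc qc) (tc_change (X s) pc qc) => H.
have dj := is_derive_comp (h := jac p q) (jac_differentiable o) (curve_derive C1c pc).
have := is_derive_mulmx H dj.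
rewrite (_ : _ + _ = - chr q (chart q (c s))
  (tc p (c s) (velocity c s) *m jac p q (chart p (c s)))
  (tc p (c s) (X s) *m jac p q (chart p (c s)))).
  apply: is_derive_near; near=> r.
  have rp : dom p (c r) by near: r; exact: near_curve.
  have rq : dom q (c r) by near: r; exact: near_curve.
  by rewrite (tc_change _ rp rq).
have := chr_change (tc p (c s) (velocity c s)) (tc p (c s) (X s)) pc qc.
rewrite /= mulNmx => ->; rewrite djac.unlock opprD addrAC addNr add0r.
by [].
Unshelve. all: by end_near. Qed.

Lemma par_atP c X : C1_curve c ->
  parallel c X <-> forall s, par_at (c s) c X s.
Proof.
move=> C1c.
have E s : (fun r => tcoord (c s) (c r) (X r)) = (fun r => tc (c s) (c r) (X r)).
  by apply/funext => r; rewrite tcoordE.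
split=> H s; last first.
  have Hs := H s; rewrite /covderiv E; split; first by case: Hs.
  rewrite derive1E christoffelE; case: Hs => _ ->.
  by rewrite !tc_id addNr.
have [ds cs] := H s; rewrite E in ds; rewrite /covderiv E christoffelE in cs.
split=> //; rewrite !tc_id; apply/eqP; rewrite -addr_eq0 -derive1E.
exact/eqP.
Qed.

Lemma is_derive_form (V : normedModType R) (a b : V -> 'rV[R]_n)
    (A : V -> 'M[R]_n) (x v : V) a' b' A' :
  is_derive x v a a' -> is_derive x v A A' -> is_derive x v b b' ->
  is_derive x v (fun y => bform (a y) (A y) (b y))
    (bform a' (A x) (b x) + bform (a x) A' (b x) + bform (a x) (A x) b').
Proof.
move=> da dA db.
have /is_derive_mx/(_ 0 0) := is_derive_mulmx (is_derive_mulmx da dA) (is_derive_trmx db).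
rewrite bform.unlock mulmxDl !mxE => H; apply: is_derive_eq H _.
by [].
Qed.

(** By [metric_compat] the derivative of the Gram matrix cancels the two Christoffel terms. *)
Lemma par_inner c X Y s : C1_curve c ->
  par_at (c s) c X s -> par_at (c s) c Y s ->
  is_derive s 1 (fun r => inner (c r) (X r) (Y r)) 0.
Proof.
move=> C1c HX HY; have zz := dom_refl (c s).
have dG := is_derive_comp (h := gr (c s))
  (gr_differentiable (chart_dom_in zz)) (curve_derive C1c zz).
have := is_derive_form HX dG HY; rewrite /=.
set u := chart _ _; set v := tc _ _ (velocity _ _).
rewrite (_ : 'D_v (gr (c s)) u = dgr (c s) u v); last by rewrite dgr.unlock.
rewrite (metric_compat _ _ v zz) -/u bformNl bformNr.
rewrite (_ : _ + _ = 0); last by ring.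
apply: is_derive_near; apply: filterS (near_curve C1c.1 zz) => r rz.
by rewrite (inner_gr _ _ rz).
Qed.

Lemma inner_pos z v : v != 0 -> 0 < inner z v v.
Proof. exact: metric_pos. Qed.

Lemma inner_eq0 z v : inner z v v = 0 -> v = 0.
Proof.
move=> v0; apply/eqP; apply: contraT => /(inner_pos z); by rewrite v0 ltxx.
Qed.

Lemma par_linear c X Y p s k : dom p (c s) -> continuous c ->
  par_at p c X s -> par_at p c Y s -> par_at p c (fun r => k *: X r + Y r) s.
Proof.
move=> pc cc HX HY; rewrite /par_at.
have := is_deriveD (is_deriveZ k HX) HY.
rewrite (_ : _ + _ = - chr p (chart p (c s)) (tc p (c s) (velocity c s))
    (tc p (c s) (k *: X s + Y s))); last first.
  by rewrite (tc_linear pc) (chr_linear _ pc) opprD scalerN.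
apply: is_derive_near; apply: filterS (near_curve cc pc) => r rp.
by rewrite (tc_linear rp).
Qed.

Lemma par_eq c c' X Y p s : (\forall r \near s, c r = c' r) ->
  (\forall r \near s, X r = Y r) -> par_at p c X s -> par_at p c' Y s.
Proof.
move=> cc' XY; rewrite /par_at.
have cs := nbhs_singleton cc'.
have -> : velocity c s = velocity c' s.
  rewrite /velocity cs !derive1E; apply: near_eq_D.
  by apply: filterS cc' => r /= ->.
rewrite (nbhs_singleton XY) cs; apply: is_derive_near.
by near=> r; congr (tc _ _ _); near: r.
Unshelve. all: by end_near. Qed.

Lemma derive0_const (f : R -> R) (a b : R) : a <= b ->
  (forall s, a <= s <= b -> is_derive s 1 f 0) ->
  forall s t, a <= s <= b -> a <= t <= b -> f s = f t.
Proof.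
move=> ab df; suff H s t : a <= s -> s <= t -> t <= b -> f t = f s.
  move=> s t /andP[as_ sb] /andP[at_ tb]; have [st|ts] := leP s t.
    by rewrite (H s t).
  by rewrite (H t s)// ltW.
move=> as_ st tb; apply/eqP; rewrite -subr_eq0 -normr_le0 -(mul0r (t - s)).
apply: (mvt_le (f' := fun=> 0)) => // r; last by rewrite normr0.
by move=> /andP[sr rt]; apply: df; rewrite (le_trans as_ sr) (le_trans rt).
Qed.

(** The difference of the two fields is parallel, so its norm is constant, and it vanishes at
    [s1]. *)
Lemma par_unique c X Y (a b s1 : R) : C1_curve c -> a <= s1 <= b ->
  (forall s, a <= s <= b -> par_at (c s) c X s) ->
  (forall s, a <= s <= b -> par_at (c s) c Y s) -> X s1 = Y s1 ->
  forall s, a <= s <= b -> X s = Y s.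
Proof.
move=> C1c s1ab HX HY E s sab; have /andP[as1 s1b] := s1ab.
pose Z r := -1 *: Y r + X r.
have HZ r : a <= r <= b -> par_at (c r) c Z r.
  by move=> rab; apply: par_linear;
    [exact: dom_refl|exact: C1c.1|exact: HY|exact: HX].
have : inner (c s) (Z s) (Z s) = inner (c s1) (Z s1) (Z s1).
  apply: (derive0_const (f := fun r => inner (c r) (Z r) (Z r)) (le_trans as1 s1b)) => //.
  by move=> r rab; apply: par_inner => //; exact: HZ.
have -> : Z s1 = 0 by rewrite /Z E scaleN1r addNr.
rewrite [RHS]innerE bform0l => /inner_eq0/eqP.
by rewrite /Z scaleN1r addrC subr_eq0 => /eqP.
Qed.

Lemma cvg_dgr (T : Type) (F : set_system T) (FF : Filter F) p z
    (u v : T -> 'rV[R]_n) v0 : dom p z ->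
  u @ F --> chart p z -> v @ F --> v0 ->
  (fun t => dgr p (u t) (v t)) @ F --> dgr p (chart p z) v0.
Proof.
move=> pz uz vv; rewrite (dgr_sum _ (chart_dom_in pz)).
have nd : \forall t \near F, chart_dom p (u t) by apply: uz; exact: near_chart_dom.
apply: (@cvg_trans _ ((fun t => \sum_l v t 0 l *: dgr p (u t) (ebasis R l)) @ F)).
  apply: near_eq_cvg; apply: (@filterS _ F FF) nd => t ut.
  by rewrite (dgr_sum _ ut).
apply: cvg_big => [|l _]; first exact: add_continuous.
apply: cvgZ; first by have /cvg_mxP := vv; apply.
have C1 := Ck_D (ebasis R l) (gr_Ck (M := M) 1 p).
rewrite dgr.unlock.
exact: (@continuous_cvg _ _ _ F FF u ('D_(ebasis R l) (gr p)) _
  (Ck_cont C1 (chart_dom_in pz)) uz).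
Qed.

Lemma cvg_form (T : Type) (F : set_system T) (FF : Filter F)
    (a b : T -> 'rV[R]_n) (A : T -> 'M[R]_n) a0 b0 A0 :
  a @ F --> a0 -> A @ F --> A0 -> b @ F --> b0 ->
  (fun t => bform (a t) (A t) (b t)) @ F --> bform a0 A0 b0.
Proof.
move=> aa AA bb; rewrite bform.unlock.
have /cvg_mxP := cvg_mulmx FF (cvg_mulmx FF aa AA) (cvg_trmx FF bb).
exact.
Qed.

Lemma cvg_chr (T : Type) (F : set_system T) (FF : Filter F) p z
    (u v w : T -> 'rV[R]_n) v0 w0 : dom p z ->
  u @ F --> chart p z -> v @ F --> v0 -> w @ F --> w0 ->
  (fun t => chr p (u t) (v t) (w t)) @ F --> chr p (chart p z) v0 w0.
Proof.
move=> pz uz vv ww; under eq_cvg do rewrite chrE.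
rewrite chrE; apply: cvgZ; first exact: cvg_cst.
have gc : (fun t => gr p (u t)) @ F --> gr p (chart p z).
  exact: (@continuous_cvg _ _ _ F FF u (gr p) _ (gr_continuous (chart_dom_in pz)) uz).
have dv := cvg_dgr FF pz uz vv; have dw := cvg_dgr FF pz uz ww.
apply: cvg_mulmx; last by apply: cvg_trmx; apply: cvg_invmx gc; exact: gr_unit.
apply/cvg_mxP => i j; under eq_cvg do rewrite mxE; rewrite mxE.
have /cvg_mxP/(_ 0 j) A1 := cvg_mulmx FF ww dv.
have /cvg_mxP/(_ 0 j) A2 := cvg_mulmx FF vv dw.
apply: cvgB; first exact: cvgD A1 A2.
by apply: cvg_form => //; apply: cvg_dgr => //; exact: cvg_cst.
Qed.

(** In the fixed chart of [c s0] a parallel field solves a linear equation with matrix [A], whose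
    rows are the Christoffel terms of the basis vectors; the solution is then read back in the
    tangent spaces along the curve. *)
Lemma par_local c (s0 : R) : C1_curve c ->
  exists2 d : R, 0 < d & forall s1, `|s1 - s0| <= d -> forall v,
    exists2 X, X s1 = v &
      forall s, `|s - s0| <= d -> par_at (c s) c X s.
Proof.
move=> C1c; have cc := C1c.1; set p := c s0.
have [d0 d00 Hd0] : exists2 d : R, 0 < d & forall s, `|s - s0| < d -> dom p (c s).
  by apply/nbhs_epsP; apply: near_curve => //; exact: dom_refl.
pose A r : 'M[R]_n := \matrix_(i, j)
  (- chr p (chart p (c r)) (tc p (c r) (velocity c r)) (delta_mx 0 i)) 0 j.
have AE r (x : 'rV[R]_n) : dom p (c r) ->
    x *m A r = - chr p (chart p (c r)) (tc p (c r) (velocity c r)) x.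
  move=> pc; set L := chr p _ _.
  have Ll : linear L by exact: chr_linear.
  pose LL : {linear 'rV[R]_n -> 'rV[R]_n} := HB.pack L (GRing.isLinear.Build R _ _ _ L Ll).
  rewrite -[L x]/(LL x) {2}(row_sum_delta x) linear_sum; apply/rowP => j.
  rewrite mxE -sumrN summxE; apply: eq_bigr => i _.
  by rewrite linearZ !mxE mulrN.
have Ac s : `|s - s0| < d0 -> {for s, continuous A}.
  move=> /Hd0 sp; apply/cvg_mxP => i j.
  have uc := chart_curve_continuous C1c sp.
  have vc := velocity_continuous C1c sp.
  have ec : (fun _ : R => delta_mx 0 i : 'rV[R]_n) @ s --> (delta_mx 0 i : 'rV[R]_n).
    exact: cvg_cst.
  have /cvg_mxP/(_ 0 j) H := cvg_chr (nbhs_filter s) sp uc vc ec.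
  have E r : A r i j = - chr p (chart p (c r)) (tc p (c r) (velocity c r))
    (delta_mx 0 i) 0 j by rewrite !mxE.
  by rewrite (eq_cvg _ _ E) E; exact: cvgN H.
have [d1 d10 Hd1] := linear_ode_local d00 Ac.
exists (Num.min d1 (d0 / 2)) => [|s1].
  by rewrite lt_min d10 divr_gt0.
have sub s : `|s - s0| <= Num.min d1 (d0 / 2) -> `|s - s0| <= d1 /\ dom p (c s).
  rewrite le_min => /andP[-> sd]; split=> //; apply: Hd0.
  by rewrite (le_lt_trans sd)// ltr_pdivrMr// mulr_natr mulr2n ltrDl.
move=> /sub[s1d ps1] v.
have [x x1 dx] := Hd1 s1 s1d (tc p (c s1) v).
exists (fun r => x r *m jac p (c r) (chart p (c r))); first by rewrite x1 tcK.
move=> s /sub[sd ps]; apply: (par_change C1c ps (dom_refl (c s))).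
rewrite /par_at tcKV//; have := dx s sd; rewrite AE//.
apply: is_derive_near; apply: filterS (near_curve cc ps) => r pr.
by rewrite tcKV.
Qed.

Lemma is_derive_glue (W : normedModType R) (f g : R -> W) (b : R) l :
  f b = g b -> is_derive b 1 f l -> is_derive b 1 g l ->
  is_derive b 1 (fun r => if r <= b then f r else g r) l.
Proof.
move=> fg /is_derive_epsP Hf /is_derive_epsP Hg; apply/is_derive_epsP => e e0.
have [d1 d10 {}Hf] := Hf _ e0; have [d2 d20 {}Hg] := Hg _ e0.
exists (Num.min d1 d2) => [|h]; first by rewrite lt_min d10.
rewrite lt_min lexx => /andP[h1 h2]; case: ifP => _; first exact: Hf.
by rewrite fg; exact: Hg.
Qed.

(** At the junction the two pieces share their value, and the equation then forces their derivatives
    to agree. *)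
Lemma par_glue c X Y (a b d : R) : C1_curve c -> a <= b -> b <= d -> X b = Y b ->
  (forall s, a <= s <= b -> par_at (c s) c X s) ->
  (forall s, b <= s <= d -> par_at (c s) c Y s) ->
  forall s, a <= s <= d ->
    par_at (c s) c (fun r => if r <= b then X r else Y r) s.
Proof.
move=> C1c ab bd XY HX HY s /andP[as_ sd].
have near_c : \forall r \near s, c r = c r by apply: filterE.
have [sb|bs|sb] := ltgtP s b.
- apply: (par_eq near_c) (HX s _); last by rewrite as_ (ltW sb).
  by apply: filterS (lt_nbhsl sb) => r rb; rewrite (ltW rb).
- apply: (par_eq near_c) (HY s _); last by rewrite sd (ltW bs).
  by apply: filterS (lt_nbhsr bs) => r rb; rewrite leNgt rb.
- have := HX s; have := HY s; rewrite as_ sd sb lexx => /(_ isT) Y' /(_ isT) X'.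
  rewrite /par_at lexx.
  have := is_derive_glue (f := fun r => tc (c b) (c r) (X r))
    (g := fun r => tc (c b) (c r) (Y r)) _ X' _.
  rewrite XY => /(_ erefl Y'); apply: is_derive_near.
  by apply: filterE => r; case: ifP.
Qed.

(** Cousin's lemma is applied to a statement that quantifies over the starting time and value, so
    that adjacent pieces can be joined from either side of their common end. *)
Lemma par_segment c (a b : R) : C1_curve c -> a <= b ->
  forall s1, a <= s1 <= b -> forall v, exists2 X, X s1 = v &
    forall s, a <= s <= b -> par_at (c s) c X s.
Proof.
move=> C1c ab.
pose P (x y : R) := forall s1, x <= s1 <= y -> forall v, exists2 X, X s1 = v &
    forall s, x <= s <= y -> par_at (c s) c X s.
apply: (@cousin R P a b ab).
  move=> x y z /andP[ax xy] /andP[yz zb] Pxy Pyz s1 /andP[xs1 s1z] v.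
  have [s1y|ys1] := leP s1 y.
    have [|X X1 HX] := Pxy s1 _ v; first by rewrite xs1.
    have [|Y Y1 HY] := Pyz y _ (X y); first by rewrite lexx.
    exists (fun r => if r <= y then X r else Y r); first by rewrite s1y.
    exact: par_glue.
  have [|Y Y1 HY] := Pyz s1 _ v; first by rewrite s1z ltW.
  have [|X X1 HX] := Pxy y _ (Y y); first by rewrite lexx xy.
  exists (fun r => if r <= y then X r else Y r); first by rewrite leNgt ys1.
  exact: par_glue.
move=> s _; have [d d0 Hd] := par_local s C1c; exists d => // x y.
move=> /andP[_ xs] /andP[sy _] dx yd s1 /andP[xs1 s1y] v.
have inb r : x <= r <= y -> `|r - s| <= d.
  by move=> /andP[xr ry]; rewrite ler_distl; apply/andP; split; lra.
have [|X X1 HX] := Hd s1 _ v; first by apply: inb; rewrite xs1.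
by exists X => // r /inb/HX.
Qed.

Lemma parallel_exists c v : C1_curve c -> exists2 X, parallel c X & X 0 = v.
Proof.
move=> C1c.
have /(_ _)/cid2-/all_sig2[X X0 XP] : forall b : R, exists2 X, X 0 = v &
    forall s, - `|b| <= s <= `|b| -> par_at (c s) c X s.
  by move=> b; apply: par_segment => //; rewrite ?oppr_le0 ?normr_ge0// ge0_cp.
have agree (b b' r : R) : `|r| <= `|b| -> `|r| <= `|b'| -> X b r = X b' r.
  move=> rb rb'.
  apply: (@par_unique c _ _ (- `|r|) `|r| 0) => //.
  - by rewrite oppr_le0 normr_ge0.
  - by move=> s; rewrite -ler_norml => sr; apply: XP; rewrite -ler_norml (le_trans sr).
  - by move=> s; rewrite -ler_norml => sr; apply: XP; rewrite -ler_norml (le_trans sr).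
  - by rewrite !X0.
  - by rewrite -ler_norml.
(* At time [r] the solution on the larger interval of radius [|r| + 1] is taken, so that near any
   [s] the field coincides with one single solution. *)
exists (fun r => X (`|r| + 1) r); last by rewrite X0.
have n1 (r : R) : `|(`|r| + 1)| = `|r| + 1 by rewrite ger0_norm// addr_ge0.
apply/par_atP => // s; have near_c : \forall r \near s, c r = c r by apply: filterE.
apply: (par_eq near_c) (XP (`|s| + 1) s _); last first.
  by rewrite -ler_norml n1 lerDl.
apply/nbhs_epsP; exists 1 => // r rs; apply: agree; rewrite n1 ?lerDl//.
rewrite -(subrK s r) addrC (le_trans (ler_normD _ _))// lerD2l.
by rewrite ltW.
Qed.

End Curves.

(** * Inner product and norm on tangent spaces *)

Section Norm.
Context (R : realType) (n : nat) (M : riemannianManifold R n).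
Implicit Types (p q z : M) (u v w : 'rV[R]_n) (c : R -> M).

Lemma innerC z v w : inner z v w = inner z w v.
Proof. by rewrite !innerE bform_sym// Defs.metric_sym. Qed.

Lemma innerDl z v v' w : inner z (v + v') w = inner z v w + inner z v' w.
Proof. by rewrite !innerE bformDl. Qed.

Lemma innerDr z v w w' : inner z v (w + w') = inner z v w + inner z v w'.
Proof. by rewrite !innerE bformDr. Qed.

Lemma innerBl z v v' w : inner z (v - v') w = inner z v w - inner z v' w.
Proof. by rewrite !innerE bformBl. Qed.

Lemma innerBr z v w w' : inner z v (w - w') = inner z v w - inner z v w'.
Proof. by rewrite !innerE bformBr. Qed.

Lemma innerZl z k v w : inner z (k *: v) w = k * inner z v w.
Proof. by rewrite !innerE bformZl. Qed.

Lemma innerZr z k v w : inner z v (k *: w) = k * inner z v w.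
Proof. by rewrite !innerE bformZr. Qed.

Lemma innerNl z v w : inner z (- v) w = - inner z v w.
Proof. by rewrite !innerE bformNl. Qed.

Lemma inner0l z w : inner z 0 w = 0.
Proof. by rewrite innerE bform0l. Qed.

Lemma inner_ge0 z v : 0 <= inner z v v.
Proof.
have [->|/(inner_pos z)/ltW//] := eqVneq v 0; by rewrite inner0l.
Qed.

Lemma tnorm_ge0 z v : 0 <= tnorm z v. Proof. exact: sqrtr_ge0. Qed.

Lemma tnorm_sqr z v : tnorm z v ^+ 2 = inner z v v.
Proof. by rewrite sqr_sqrtr// inner_ge0. Qed.

Lemma tnorm0 z : tnorm z 0 = 0.
Proof. by rewrite /tnorm inner0l sqrtr0. Qed.

Lemma tnormZ z k v : tnorm z (k *: v) = `|k| * tnorm z v.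
Proof.
by rewrite /tnorm innerZl innerZr mulrA -expr2 sqrtrM ?sqr_ge0// sqrtr_sqr.
Qed.

Lemma tnormN z v : tnorm z (- v) = tnorm z v.
Proof. by rewrite -scaleN1r tnormZ normrN1 mul1r. Qed.

Lemma tnormBC z v w : tnorm z (v - w) = tnorm z (w - v).
Proof. by rewrite -tnormN opprB. Qed.

Lemma cauchy_schwarz z v w : `|inner z v w| <= tnorm z v * tnorm z w.
Proof.
rewrite -(ler_pXn2r (ltn0Sn 1)) ?nnegrE ?mulr_ge0 ?tnorm_ge0//.
rewrite exprMn !tnorm_sqr real_normK ?num_real//.
have [->|w0] := eqVneq w 0; first by rewrite innerC !inner0l expr0n mulr0.
have W := inner_pos z w0.
have := inner_ge0 z (inner z w w *: v - inner z v w *: w).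
rewrite innerBl !innerBr !innerZl !innerZr (innerC z w v) => H.
rewrite -(ler_pM2l W) -subr_ge0; move: H.
set a := inner z v v; set b := inner z v w; set d := inner z w w.
by rewrite (_ : d * (d * a) - d * (b * b) - (b * (d * b) - b * (b * d))
  = d * (a * d) - d * b ^+ 2); last by ring.
Qed.

Lemma inner_le z v w : inner z v w <= tnorm z v * tnorm z w.
Proof. exact: le_trans (ler_norm _) (cauchy_schwarz z v w). Qed.

Lemma tnormD z v w : tnorm z (v + w) <= tnorm z v + tnorm z w.
Proof.
rewrite -(ler_pXn2r (ltn0Sn 1)) ?nnegrE ?addr_ge0 ?tnorm_ge0//.
rewrite sqrrD !tnorm_sqr innerDl !innerDr (innerC z w v).
have := inner_le z v w; rewrite mulr2n; lra.
Qed.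

Lemma tnormB z v w : tnorm z (v - w) <= tnorm z v + tnorm z w.
Proof. by rewrite -(tnormN z w); exact: tnormD. Qed.

Lemma tnorm_triangle z u v w :
  tnorm z (v - w) <= tnorm z (v - u) + tnorm z (u - w).
Proof. by rewrite -(subrKA u v (- w)); exact: tnormD. Qed.

(** Serves to bound a gradient or the value of an operator by testing it against itself. *)
Lemma tnorm_le_sqr z v (k : R) : 0 <= k -> inner z v v <= k * tnorm z v ->
  tnorm z v <= k.
Proof.
move=> k0; rewrite -tnorm_sqr expr2 => H.
have [->//|v0] := eqVneq (tnorm z v) 0.
have vp : 0 < tnorm z v by rewrite lt0r v0 tnorm_ge0.
by rewrite -(ler_pM2r vp).
Qed.

End Norm.

(** * Reparametrized geodesics and the distance *)

Section Geodesics.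
Context (R : realType) (n : nat) (M : riemannianManifold R n).
Implicit Types (p q z : M) (u v w : 'rV[R]_n) (c : R -> M).

(** Affine change of time: [aff (-1) 1] reverses [[0, 1]], [aff s 0] shrinks a geodesic, and
    [aff (t - s) s] cuts out the piece between [s] and [t]. *)
Definition aff (a b s : R) : R := a * s + b.

Lemma is_derive_aff (a b s : R) : is_derive s 1 (aff a b) a.
Proof.
apply/is_derive_epsP => e e0; exists 1 => // h _.
have -> : aff a b (s + h *: 1) - aff a b s - h *: a = 0.
  by rewrite /aff /GRing.scale /=; ring.
by rewrite normr0 mulr_ge0// ltW.
Qed.

Lemma is_derive_comp_aff (W : normedModType R) (f : R -> W) (a b s : R) l :
  is_derive (aff a b s) 1 f l -> is_derive s 1 (f \o aff a b) (a *: l).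
Proof.
move=> [df <-]; have /derivable1_diffP dff := df.
have := is_derive_comp dff (is_derive_aff a b s).
by rewrite (deriveE a dff) (@deriveE _ _ _ _ _ (1 : R) dff) -linearZ [a *: 1]mulr1.
Qed.

Lemma aff_continuous (a b : R) : continuous (aff a b).
Proof. by move=> s; exact: is_derive_continuous (is_derive_aff a b s). Qed.

Lemma near_aff (a b s : R) (P : R -> Prop) :
  (\forall r \near aff a b s, P r) -> \forall r \near s, P (aff a b r).
Proof. exact: aff_continuous. Qed.

Lemma velocity_aff c a b s : C1_curve c ->
  velocity (c \o aff a b) s = a *: velocity c (aff a b s).
Proof.
move=> C1c; have zz := dom_refl (c (aff a b s)).
have H := curve_derive C1c zz; rewrite tc_id in H.
by rewrite /velocity derive1E; have [_ <-] := is_derive_comp_aff H.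
Qed.

Lemma C1_aff c a b : C1_curve c -> C1_curve (c \o aff a b).
Proof.
move=> C1c; have [cc C1] := C1c; split=> [s|s].
  by apply: continuous_comp; [exact: aff_continuous|exact: cc].
have [ds vs] := C1 (aff a b s); have ac := @aff_continuous a b s.
have near_d := near_aff ds.
have E : \forall r \near s, derive1 (chart (c (aff a b s)) \o (c \o aff a b)) r =
    a *: derive1 (chart (c (aff a b s)) \o c) (aff a b r).
  apply: filterS near_d => r /= dr; rewrite !derive1E.
  by have [_ <-] := is_derive_comp_aff (derivableP dr).
split.
  by apply: filterS near_d => r dr; have [] := is_derive_comp_aff (derivableP dr).
have H : {for s, continuous (fun r => a *: derive1 (chart (c (aff a b s)) \o c) (aff a b r))}.
  apply: cvgZl_tmp.
  exact: (@continuous_comp _ _ _ (aff a b) (derive1 (chart (c (aff a b s)) \o c)) s ac vs).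
apply: (near_eq_continuous _ H).
by apply: filterS E => r Er; exact: esym Er.
Qed.

Lemma par_aff c X p a b s : C1_curve c -> dom p (c (aff a b s)) ->
  par_at p c X (aff a b s) -> par_at p (c \o aff a b) (X \o aff a b) s.
Proof.
move=> C1c pc H; rewrite /par_at (velocity_aff _ _ _ C1c).
have := is_derive_comp_aff H; congr is_derive; rewrite /= scalerN; congr (- _).
have t0 : tc p (c (aff a b s)) 0 = 0 by rewrite tcE// mul0mx.
rewrite -(addr0 (a *: velocity _ _)) (tc_linear pc) t0 addr0.
rewrite !(chrC _ (tc _ _ (X _)) pc) -(addr0 (a *: tc _ _ _)) (chr_linear _ pc).
have -> : chr p (chart p (c (aff a b s))) (tc p (c (aff a b s)) (X (aff a b s))) 0 = 0.
  have L := chr_linear (tc p (c (aff a b s)) (X (aff a b s))) pc.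
  by have := L (-1) 0 0; rewrite !scaler0 addr0 scaleN1r addNr.
by rewrite addr0.
Qed.

Lemma par_scale c X p s k : dom p (c s) -> continuous c ->
  par_at p c X s -> par_at p c (fun r => k *: X r) s.
Proof.
move=> pc cc H; have := par_linear (k - 1) pc cc H H.
by apply: par_eq; apply: filterE => r //; rewrite scalerBl scale1r subrK.
Qed.

Lemma parallel_aff c X a b : C1_curve c -> parallel c X ->
  parallel (c \o aff a b) (X \o aff a b).
Proof.
move=> C1c /(par_atP X C1c) H; apply/par_atP => [|s]; first exact: C1_aff.
exact: (par_aff C1c (dom_refl (c (aff a b s))) (H (aff a b s))).
Qed.

Lemma geodesic_aff c a b : geodesic c -> geodesic (c \o aff a b).
Proof.
move=> [C1c pc]; have C1a := C1_aff a b C1c; split; first exact: C1a.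
have H := (par_atP _ C1a).1 (parallel_aff a b C1c pc).
apply/(par_atP _ C1a) => s; have zz := dom_refl ((c \o aff a b) s).
apply: (par_eq _ _ (par_scale a zz C1a.1 (H s))); first exact: filterE.
by apply: filterE => r; rewrite velocity_aff.
Qed.

Lemma par_inner_const c X Y : C1_curve c -> parallel c X -> parallel c Y ->
  forall s t, inner (c s) (X s) (Y s) = inner (c t) (X t) (Y t).
Proof.
move=> C1c /(par_atP _ C1c) HX /(par_atP _ C1c) HY s t.
have d0 (r : R) : is_derive r 1 (fun r => inner (c r) (X r) (Y r)) 0 by exact: par_inner.
have [st|ts] := leP s t.
  apply: (derive0_const (f := fun r => inner (c r) (X r) (Y r)) st) => //;
  by rewrite ?lexx ?st.
apply: (derive0_const (f := fun r => inner (c r) (X r) (Y r)) (ltW ts)) => //;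
by rewrite ?lexx ?(ltW ts).
Qed.

Lemma geodesic_speed c s t : geodesic c ->
  tnorm (c s) (velocity c s) = tnorm (c t) (velocity c t).
Proof. by move=> [C1c pc]; rewrite /tnorm (par_inner_const C1c pc pc s t). Qed.

Lemma arclength_ge0 c : 0 <= arclength c.
Proof. by apply: Rintegral_ge0 => s _; exact: tnorm_ge0. Qed.

(** The piece between [s] and [t], rescaled to [[0, 1]], competes in the infimum and has constant
    speed. *)
Lemma dist_le_geodesic c s t : geodesic c ->
  dist (c s) (c t) <= `|t - s| * tnorm (c s) (velocity c s).
Proof.
move=> gc; have g' := geodesic_aff (t - s) s gc; set c' := c \o aff (t - s) s in g'.
have E0 : c' 0 = c s by rewrite /c' /= /aff mulr0 add0r.
have E1 : c' 1 = c t by rewrite /c' /= /aff mulr1 subrK.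
have sp r : tnorm (c' r) (velocity c' r) = `|t - s| * tnorm (c s) (velocity c s).
  rewrite (geodesic_speed r 0 g') E0 /c' velocity_aff; last exact: gc.1.
  by rewrite /aff mulr0 add0r tnormZ.
rewrite /dist; apply: ge_inf.
  exists 0 => _ [cs _ ->]; apply: sumr_ge0 => r _; exact: arclength_ge0.
exists [:: c']; first by split=> //; exact: g'.1.
rewrite big_seq1 /arclength.
rewrite (_ : (fun r => _) = cst (`|t - s| * tnorm (c s) (velocity c s))); last first.
  by apply/funext => r; exact: sp.
rewrite Rintegral_cst//= lebesgue_measure_itv /= lte_fin ltr01.
by rewrite /= ?sube0 ?oppr0 ?addr0 mulr1.
Qed.

(** The curves agree on [[0, 1]] only, so at 0 and 1 the difference of the fields cannot be
    differentiated from both sides. Its norm is constant because its derivative vanishes inside and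
    it is continuous up to the ends. *)
Lemma par_unique01 c c' X X' : C1_curve c -> C1_curve c' ->
  (forall s, 0 <= s <= 1 -> c' s = c s) ->
  parallel c X -> parallel c' X' -> X 0 = X' 0 -> X 1 = X' 1.
Proof.
move=> C1c C1c' cc' /(par_atP _ C1c) HX /(par_atP _ C1c') HX' X0.
pose Z r := -1 *: X' r + X r.
pose D r := inner (c r) (Z r) (Z r).
have D0 (r : R) : 0 < r < 1 -> is_derive r 1 D 0.
  move=> /andP[r0 r1].
  have near_c : \forall s \near r, c' s = c s.
    near=> s; apply: cc'; apply/andP; split; apply: ltW; near: s.
      exact: lt_nbhsr.
    exact: lt_nbhsl.
  have HY : par_at (c r) c X' r.
    rewrite -(nbhs_singleton near_c).
    by apply: par_eq (HX' r) => //; exact: filterE.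
  by apply: par_inner => //; apply: par_linear => //;
    [exact: dom_refl|exact: C1c.1|exact: dom_refl|exact: C1c.1].
(* Near an end point, reading each field along its own curve gives a function that is continuous
   from both sides and equals [D] within [[0, 1]]. *)
have Dend (e : R) : 0 <= e <= 1 -> exists2 g : R -> R, {for e, continuous g} &
    \forall r \near e, 0 <= r <= 1 -> D r = g r.
  move=> e01; have zz := dom_refl (c e); have zz' : dom (c e) (c' e) by rewrite cc'.
  have HX'e := par_change C1c' (dom_refl (c' e)) zz' (HX' e).
  pose y r := -1 *: tc (c e) (c' r) (X' r) + tc (c e) (c r) (X r).
  have yc : {for e, continuous y}.
    exact: is_derive_continuous (is_deriveD (is_deriveZ (-1) HX'e) (HX e)).
  have gc : {for e, continuous (fun r => gr (c e) (chart (c e) (c r)))}.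
    apply: (@continuous_comp _ _ _ (chart (c e) \o c) (gr (c e))).
      exact: chart_curve_continuous.
    exact: gr_continuous (chart_dom_in zz).
  exists (fun r => bform (y r) (gr (c e) (chart (c e) (c r))) (y r)).
    exact: (cvg_form _ yc gc yc).
  apply: filterS (near_curve C1c.1 zz) => r rz r01.
  by rewrite /D (inner_gr _ _ rz) /Z (tc_linear rz) /y cc'.
have Dc : {within `[0, 1], continuous D}.
  apply/continuous_within_itvP => //; split.
  - move=> r; rewrite in_itv /= => /D0; exact: is_derive_continuous.
  - have [|g gc Dg] := Dend 0; first by rewrite lexx ler01.
    have g0 : D 0 = g 0 by apply: (nbhs_singleton Dg); rewrite lexx ler01.
    rewrite g0; apply: (@cvg_trans _ (g @ (0 : R)^'+)); last first.
      exact: cvg_at_right_filter.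
    apply: near_eq_cvg; near=> r; apply/esym.
    have H : 0 <= r <= 1 -> D r = g r by near: r; apply: cvg_within; exact: Dg.
    by apply: H; apply/andP; split; [near: r; exact: nbhs_right_ge|
      near: r; exact: nbhs_right_le].
  - have [|g gc Dg] := Dend 1; first by rewrite lexx ler01.
    have g0 : D 1 = g 1 by apply: (nbhs_singleton Dg); rewrite lexx ler01.
    rewrite g0; apply: (@cvg_trans _ (g @ (1 : R)^'-)); last first.
      exact: cvg_at_left_filter.
    apply: near_eq_cvg; near=> r; apply/esym.
    have H : 0 <= r <= 1 -> D r = g r by near: r; apply: cvg_within; exact: Dg.
    by apply: H; apply/andP; split; [near: r; exact: nbhs_left_ge|
      near: r; exact: nbhs_left_le].
have D0' (r : R) : r \in `]0, 1[ -> is_derive r 1 D 0 by rewrite in_itv; exact: D0.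
have [r _] := @MVT R D (fun=> 0) 0 1 ltr01 D0' Dc.
rewrite mul0r => /eqP; rewrite subr_eq0 => /eqP.
rewrite {2}/D /Z X0 scaleN1r addNr inner0l => /inner_eq0/eqP.
by rewrite /Z scaleN1r addrC subr_eq0 => /eqP.
Unshelve. all: by end_near. Qed.

End Geodesics.

(** * Parallel transport *)

Section Transport.
Context (R : realType) (n : nat) (M : riemannianManifold R n) (U : set M).
Hypothesis hU : geodesically_convex U.
Implicit Types (p q z : M) (u v w : 'rV[R]_n) (c : R -> M).

(** [transport] chooses some minimizing geodesic and some parallel field; by convexity all
    minimizing geodesics coincide on [[0, 1]], so every choice gives the same vector. *)
Lemma transportE p q c X : U p -> U q -> minimizing_geodesic c p q ->
  parallel c X -> transport p q (X 0) = X 1.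
Proof.
move=> Up Uq mc pX; have [c0 [mc0 c0U c0u]] := hU Up Uq.
have : [set w | exists c Y, [/\ minimizing_geodesic c p q, parallel c Y,
    Y 0 = X 0 & Y 1 = w]] (transport p q (X 0)).
  by apply: (@xgetPex _ 0); exists (X 1), c, X.
move=> [c' [Y [mc' pY Y0 <-]]]; apply: (@par_unique01 _ _ _ c' c) => //.
- by case: mc' => -[].
- by case: mc => -[].
- by move=> s s01; rewrite (c0u c)// (c0u c').
Qed.

Lemma minimizing_exists p q : U p -> U q -> exists2 c, minimizing_geodesic c p q &
  forall s, 0 <= s <= 1 -> U (c s).
Proof. by move=> Up Uq; have [c [mc cU _]] := hU Up Uq; exists c. Qed.

Lemma transport_parallel p q v : U p -> U q -> exists c X,
  [/\ minimizing_geodesic c p q, parallel c X, X 0 = v & X 1 = transport p q v].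
Proof.
move=> Up Uq; have [c mc _] := minimizing_exists Up Uq.
have [[C1c _] _ _ _] := mc.
have [X pX X0] := parallel_exists v C1c.
by exists c, X; split=> //; rewrite -X0 (transportE Up Uq mc pX).
Qed.

Lemma transport_linear p q : U p -> U q -> linear (transport p q).
Proof.
move=> Up Uq a v w; have [c mc _] := minimizing_exists Up Uq.
have [[C1c _] _ _ _] := mc.
have [X pX X0] := parallel_exists v C1c; have [Y pY Y0] := parallel_exists w C1c.
have pZ : parallel c (fun r => a *: X r + Y r).
  apply/par_atP => // s; apply: par_linear; [exact: dom_refl|exact: C1c.1| |].
    by have /(par_atP _ C1c) := pX; apply.
  by have /(par_atP _ C1c) := pY; apply.
have := transportE Up Uq mc pZ; rewrite X0 Y0 => ->.
by rewrite -(transportE Up Uq mc pX) -(transportE Up Uq mc pY) X0 Y0.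
Qed.

Lemma transportB p q v w : U p -> U q ->
  transport p q (v - w) = transport p q v - transport p q w.
Proof.
move=> Up Uq; have L := transport_linear Up Uq.
by rewrite -[- w]scaleN1r (addrC v) L scaleN1r addrC.
Qed.

Lemma transport_inner p q v w : U p -> U q ->
  inner q (transport p q v) (transport p q w) = inner p v w.
Proof.
move=> Up Uq; have [c mc _] := minimizing_exists Up Uq.
have [[C1c _] c0 c1 _] := mc.
have [X pX X0] := parallel_exists v C1c; have [Y pY Y0] := parallel_exists w C1c.
rewrite -{1}X0 -{1}Y0 (transportE Up Uq mc pX) (transportE Up Uq mc pY).
by rewrite -{1}c1 (par_inner_const C1c pX pY 1 0) c0 X0 Y0.
Qed.

Lemma transport_tnorm p q v : U p -> U q ->
  tnorm q (transport p q v) = tnorm p v.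
Proof. by move=> Up Uq; rewrite /tnorm transport_inner. Qed.

Lemma aff_rev0 c : (c \o aff (-1) 1) 0 = c 1.
Proof. by rewrite /= /aff mulr0 add0r. Qed.

Lemma aff_rev1 c : (c \o aff (-1) 1) 1 = c 0.
Proof. by rewrite /= /aff mulr1 addNr. Qed.

Lemma dist_le_minimizing c p q : minimizing_geodesic c p q -> dist q p <= dist p q.
Proof.
move=> [gc <- <- <-]; have := dist_le_geodesic 1 0 gc.
by rewrite sub0r normrN1 mul1r (geodesic_speed 1 0 gc).
Qed.

(** Each of the two distances is realized by a geodesic, whose reversal bounds the other one. *)
Lemma dist_sym p q : U p -> U q -> dist p q = dist q p.
Proof.
move=> Up Uq; apply/eqP; rewrite eq_le.
have [c mc _] := minimizing_exists Up Uq.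
have [c' mc' _] := minimizing_exists Uq Up.
by rewrite (dist_le_minimizing mc) (dist_le_minimizing mc').
Qed.

Lemma minimizing_rev c p q : U p -> U q -> minimizing_geodesic c p q ->
  minimizing_geodesic (c \o aff (-1) 1) q p.
Proof.
move=> Up Uq [gc c0 c1 cd]; split; [exact: geodesic_aff|by rewrite aff_rev0|by rewrite aff_rev1|].
rewrite velocity_aff; last exact: gc.1.
rewrite /aff mulr0 add0r tnormZ normrN1 mul1r (dist_sym Uq Up) -cd.
by rewrite -[in LHS]c1 -[in RHS]c0; exact: geodesic_speed.
Qed.

Lemma transportK p q v : U p -> U q -> transport q p (transport p q v) = v.
Proof.
move=> Up Uq; have [c [X [mc pX X0 X1]]] := transport_parallel v Up Uq.
have [[C1c _] _ _ _] := mc.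
have := transportE Uq Up (minimizing_rev Up Uq mc) (parallel_aff (-1) 1 C1c pX).
by rewrite /= /aff mulr0 add0r mulr1 addNr X0 X1.
Qed.

Lemma dist_ge0 p q : U p -> U q -> 0 <= dist p q.
Proof.
by move=> Up Uq; have [c [_ _ _ <-] _] := minimizing_exists Up Uq; exact: tnorm_ge0.
Qed.

End Transport.

(** * Estimates in the chart around a point *)

Section Local.
Context (R : realType) (n : nat) (M : riemannianManifold R n).
Implicit Types (p q z : M) (u v w : 'rV[R]_n) (c : R -> M).

(* In the ball of radius r around p, the chart of p distorts norms by a factor
   at most C. *)
Definition chart_scale p (r C : R) : Prop :=
  [/\ 0 < r, 0 < C, forall u, `|u - chart p p| <= r -> chart_dom p u &
    forall z, dom p z -> `|chart p z - chart p p| <= r -> forall v,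
      `|tc p z v| <= C * tnorm z v /\ tnorm z v <= C * `|tc p z v|].

Lemma bform_norm_le (a b : 'rV[R]_n) (A : 'M[R]_n) :
  `|bform a A b| <= n%:R ^+ 2 * `|A| * (`|a| * `|b|).
Proof.
rewrite bform.unlock (le_trans (mx_coord_le _ _ _))// (le_trans (mulmx_norm_le _ _))//.
have bT : `|b^T| <= `|b| by apply/mx_norm_leP => // i j; rewrite mxE mx_coord_le.
rewrite (_ : _ * (_ * _) = n%:R * (n%:R * `|a| * `|A|) * `|b|); last by ring.
by apply: ler_pM; rewrite ?mulr_ge0// ler_wpM2l// mulmx_norm_le.
Qed.

(** One inequality is governed by the Gram matrix and the other by its inverse; both matrices are
    continuous, hence bounded near [p]. *)
Lemma chart_scale_exists p : exists r C, chart_scale p r C.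
Proof.
have pp := dom_refl p; have cd := chart_dom_in pp.
have gc := gr_continuous cd.
have [r1 r10 H1] : exists2 d : R, 0 < d & forall u, `|u - chart p p| < d -> chart_dom p u.
  by apply/nbhs_epsP; exact: near_chart_dom.
have /continuous_epsP/(_ _ ltr01)[r2 r20 H2] := gc.
have ic : {for chart p p, continuous (fun u => invmx (gr p u))}.
  exact: (cvg_invmx _ (gr_unit pp) gc).
have /continuous_epsP/(_ _ ltr01)[r3 r30 H3] := ic.
set G0 := gr p (chart p p) in H2 H3.
pose B1 := n%:R ^+ 2 * (`|G0| + 1); pose B2 := `|invmx G0| + 1.
have B10 : 0 <= B1 by rewrite mulr_ge0 ?addr_ge0// exprn_ge0.
have B20 : 0 <= B2 by rewrite addr_ge0.
pose C := Num.sqrt B1 + Num.sqrt B2 + 1.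
have s1 := sqrtr_ge0 B1; have s2 := sqrtr_ge0 B2.
pose r := Num.min r1 (Num.min r2 r3) / 2.
have m0 : 0 < Num.min r1 (Num.min r2 r3) by rewrite !lt_min r10 r20.
have rr u : `|u - chart p p| <= r ->
    [/\ `|u - chart p p| < r1, `|u - chart p p| < r2 & `|u - chart p p| < r3].
  move=> ur; have : `|u - chart p p| < Num.min r1 (Num.min r2 r3).
    by rewrite (le_lt_trans ur)// /r ltr_pdivrMr// mulr_natr mulr2n ltrDl.
  by rewrite !lt_min => /and3P.
exists r, C; split.
- by rewrite divr_gt0.
- by rewrite ltr_wpDl// addr_ge0.
- by move=> u /rr[/H1].
move=> z pz /rr[_ /H2 Gz /H3 Iz] v; set u := chart p z in Gz Iz.
have GB : `|gr p u| <= `|G0| + 1.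
  by rewrite -lerBlDl; apply: le_trans Gz; rewrite (le_trans _ (lerB_dist _ _)).
have IB : `|invmx (gr p u)| <= B2.
  by rewrite -lerBlDl; apply: le_trans Iz; rewrite (le_trans _ (lerB_dist _ _)).
have up := gr_unit pz; split.
  apply/mx_norm_leP => [|i j]; first by rewrite mulr_ge0 ?tnorm_ge0// ltW// ltr_wpDl// addr_ge0.
  (* [w] is dual to the j-th coordinate: pairing with it gives that coordinate, and its norm is
     controlled by the inverse Gram matrix. *)
  rewrite ord1; pose x : 'rV[R]_n := delta_mx 0 j *m invmx (gr p u).
  pose w := x *m jac p z (chart p z).
  have tw : tc p z w = x by rewrite /w tcKV.
  have E1 : inner z v w = (tc p z v) 0 j.
    rewrite (inner_gr _ _ pz) tw bform_mul_tr trmx_inv (gr_sym pz) mulmxV//.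
    by rewrite bform1 trmx_delta -colE mxE.
  have E2 : inner z w w <= B2.
    rewrite (inner_gr _ _ pz) tw {1}/x bform_mul mulVmx// /x bform_mul_tr mul1mx.
    rewrite bform_delta mxE (le_trans (ler_norm _))// (le_trans _ IB)//.
    exact: mx_coord_le.
  rewrite -E1 (le_trans (cauchy_schwarz _ _ _))// mulrC ler_wpM2r ?tnorm_ge0//.
  have : tnorm z w <= Num.sqrt B2 by rewrite /tnorm ler_wsqrtr.
  rewrite /C; lra.
rewrite -(ler_pXn2r (ltn0Sn 1)) ?nnegrE ?tnorm_ge0 ?mulr_ge0//; last first.
  by rewrite ltW// ltr_wpDl// addr_ge0.
rewrite tnorm_sqr (inner_gr _ _ pz) (le_trans (ler_norm _))//.
rewrite (le_trans (bform_norm_le _ _ _))// exprMn -expr2 ler_wpM2r ?exprn_ge0//.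
apply: (@le_trans _ _ B1); first by rewrite /B1 ler_wpM2l ?exprn_ge0.
rewrite -{1}(sqr_sqrtr B10) ler_pXn2r ?nnegrE ?sqrtr_ge0 ?addr_ge0//.
rewrite /C; lra.
Qed.

(** A continuation argument. The geodesic is still in the chart ball [K] at the supremum [sg] of the
    times up to which it stays there, as [K] is compact in a Hausdorff space. The speed bound puts
    it strictly inside, so [sg < 1] is impossible. *)
Lemma short_geodesic p (r C : R) c : chart_scale p r C -> geodesic c -> c 0 = p ->
  C * tnorm p (velocity c 0) < r -> forall s, 0 <= s <= 1 ->
  dom p (c s) /\ `|chart p (c s) - chart p p| <= C * tnorm p (velocity c 0) * s.
Proof.
move=> [r0 C0 rdom nrm] gc c0 lr; set l := tnorm p _ in lr *.
have C1c := gc.1; have cc := C1c.1.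
have l0 : 0 <= C * l by rewrite mulr_ge0 ?tnorm_ge0// ltW.
pose B := [set u | `|u - chart p p| <= r].
pose K := ichart p @` B.
have KP z : K z -> dom p z /\ `|chart p z - chart p p| <= r.
  move=> [u Bu <-]; have [z' pz' E] := rdom _ Bu.
  by move: Bu; rewrite /B /= -E chartK.
have PK z : dom p z -> `|chart p z - chart p p| <= r -> K z.
  by move=> pz zr; exists (chart p z) => //; rewrite chartK.
have clK : closed K.
  apply: compact_closed; first exact: manifold_hausdorff.
  apply: continuous_compact.
    apply: continuous_in_subspaceT => u; rewrite inE => /rdom[z pz <-].
    exact: ichart_continuous.
  apply: bounded_closed_compact.
    exists (r + `|chart p p|); split; first exact: num_real.
    move=> x rx u /= ur; apply: ltW; apply: le_lt_trans rx.
    by rewrite -[u](subrK (chart p p)) (le_trans (ler_normD _ _))// lerD2r.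
  rewrite (_ : B = (fun u => `|u - chart p p|) @^-1` [set x | x <= r])//.
  apply: closed_comp; last exact: closed_le.
  move=> u _; apply/continuous_epsP => e e0; exists e => // v vu.
  rewrite (le_trans (ler_dist_dist _ _))// opprB addrA subrK.
  exact: ltW.
have sp s : tnorm (c s) (velocity c s) = l by rewrite (geodesic_speed s 0 gc) c0.
have est t : 0 <= t -> (forall s, 0 <= s <= t -> K (c s)) ->
    forall s, 0 <= s <= t -> `|chart p (c s) - chart p p| <= C * l * s.
  move=> t0 H s /andP[s0 st]; rewrite -[s in _ * s]subr0 -[X in _ - chart p X]c0.
  apply: (mvt_mx_le (f := chart p \o c) (f' := fun s => tc p (c s) (velocity c s)) s0 l0).
    move=> x /andP[x0 xs]; apply: curve_derive => //.
    by apply: (KP _ _).1; apply: H; rewrite x0 (le_trans xs).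
  move=> x /andP[x0 xs]; have [|px xr] := KP (c x).
    by apply: H; rewrite x0 (le_trans xs).
  by have [+ _] := nrm _ px xr (velocity c x); rewrite sp.
pose S := [set t | 0 <= t <= 1 /\ forall s, 0 <= s <= t -> K (c s)].
have K0 : K (c 0) by apply: PK; rewrite c0 ?subrr ?normr0 ?(ltW r0)//; exact: dom_refl.
have S0 : S 0.
  split; first by rewrite lexx ler01.
  by move=> s; rewrite -eq_le => /eqP <-.
have Sb : has_sup S by split; [exists 0|exists 1 => t [/andP[]]].
have Sub t : S t -> t <= sup S by move=> ?; exact: (ub_le_sup Sb.2).
set sg := sup S in Sub.
have sg1 : sg <= 1 by apply: ge_sup; [exists 0|move=> t [/andP[]]].
have sg0 : 0 <= sg := Sub _ S0.
have Slt s : 0 <= s < sg -> K (c s).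
  move=> /andP[s0 ssg]; have d0 : 0 < sg - s by rewrite subr_gt0.
  have [t [_ Ht]] := sup_adherent d0 Sb; rewrite -/sg subKr => st.
  by apply: Ht; rewrite s0 ltW.
have Ksg : K (c sg).
  apply: contrapT => nK.
  have : nbhs (c sg) (~` K) by apply: open_nbhs_nbhs; split=> //; exact: closed_openC.
  move=> /(cc sg)/nbhs_epsP[d d0 Hd].
  have [t St] := sup_adherent d0 Sb; rewrite -/sg => tsg.
  apply: (Hd t); last by apply: (St.2); rewrite lexx andbT; case/andP: St.1.
  by rewrite distrC ger0_norm ?subr_ge0; [lra|exact: Sub].
have Ssg : S sg.
  split=> [|s /andP[s0]]; first by rewrite sg0.
  rewrite le_eqVlt => /orP[/eqP->//|ssg]; apply: Slt; by rewrite s0.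
suff sg1' : sg = 1.
  move=> s s01; have Ks : forall x, 0 <= x <= 1 -> K (c x) by rewrite -sg1'; exact: Ssg.2.
  by split; [exact: (KP _ (Ks _ s01)).1|exact: est Ks _ s01].
apply/eqP; rewrite eq_le sg1 leNgt; apply/negP => sgl1.
have [psg _] := KP _ Ksg.
have usg : `|chart p (c sg) - chart p p| < r.
  apply: le_lt_trans lr.
  apply: (le_trans (est _ sg0 Ssg.2 sg _)); first by rewrite sg0 lexx.
  by rewrite ler_piMr.
have [d d0 Hd] : exists2 d : R, 0 < d & forall s, `|s - sg| < d -> K (c s).
  apply/nbhs_epsP; have n1 := near_curve cc psg.
  have uc := chart_curve_continuous C1c psg.
  have n2 : \forall s \near sg, `|chart p (c s) - chart p p| < r.
    have e0 : 0 < (r - `|chart p (c sg) - chart p p|) / 2 by rewrite divr_gt0// subr_gt0.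
    have /continuous_epsP/(_ _ e0)[d d0 H] := uc.
    apply/nbhs_epsP; exists d => // s /H /= us.
    rewrite -(subrKA (chart p (c sg))) (le_lt_trans (ler_normD _ _))//.
    by move: us; lra.
  near=> s; apply: PK; first by near: s.
  by apply: ltW; near: s.
pose y := Num.min 1 (sg + d / 2).
have d20 : 0 < d / 2 by rewrite divr_gt0.
have sy : sg < y by rewrite lt_min sgl1 ltrDl.
suff /Sub : S y by rewrite leNgt sy.
split; first by rewrite ge_min lexx (le_trans sg0)// ltW.
move=> s /andP[s0]; rewrite le_min => /andP[s1 sd].
have [ssg|ssg] := leP s sg; first by apply: Ssg.2; rewrite s0.
by apply: Hd; rewrite ger0_norm ?subr_ge0 ?(ltW ssg)//; lra.
Unshelve. all: by end_near. Qed.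

Lemma chr_sum p z v w : dom p z -> chr p (chart p z) v w =
  \sum_i \sum_j (v 0 i * w 0 j) *: chr p (chart p z) (delta_mx 0 i) (delta_mx 0 j).
Proof.
move=> pz.
have lin x y : chr p (chart p z) x y = \sum_j y 0 j *: chr p (chart p z) x (delta_mx 0 j).
  have L : linear (chr p (chart p z) x) by exact: chr_linear.
  pose LL : {linear 'rV[R]_n -> 'rV[R]_n} :=
    HB.pack (chr p (chart p z) x) (GRing.isLinear.Build R _ _ _ _ L).
  rewrite -[LHS]/(LL y) {1}(row_sum_delta y) linear_sum; apply: eq_bigr => j _.
  by rewrite linearZ.
rewrite (chrC _ _ pz) lin; apply: eq_bigr => i _.
rewrite (chrC _ _ pz) lin scaler_sumr; apply: eq_bigr => j _.
by rewrite scalerA.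
Qed.

(** By bilinearity only the finitely many pairs of basis vectors have to be controlled, which makes
    the estimate uniform in [v] and [w]. *)
Lemma chr_near p (e : R) : 0 < e -> exists2 d : R, 0 < d &
  forall z, dom p z -> `|chart p z - chart p p| < d -> forall v w,
    `|chr p (chart p z) v w - chr p (chart p p) v w| <= e * (`|v| * `|w|).
Proof.
move=> e0; have pp := dom_refl p.
pose e' := e / n.+1%:R ^+ 2.
have e'0 : 0 < e' by rewrite divr_gt0// exprn_gt0.
pose P (ij : 'I_n * 'I_n) (u : 'rV[R]_n) :=
  `|chr p u (delta_mx 0 ij.1) (delta_mx 0 ij.2) -
    chr p (chart p p) (delta_mx 0 ij.1) (delta_mx 0 ij.2)| <= e'.
have : \forall u \near chart p p, forall ij, P ij u.
  apply: (@filter_forall _ _ P (nbhs (chart p p)) (nbhs_filter _)) => -[i j].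
  have uc : (fun u : 'rV[R]_n => u) @ chart p p --> chart p p by exact: cvg_id.
  have ec k : (fun _ : 'rV[R]_n => delta_mx 0 k : 'rV[R]_n) @ chart p p -->
    (delta_mx 0 k : 'rV[R]_n).
    exact: (@cst_continuous _ _ (delta_mx 0 k : 'rV[R]_n) (chart p p)).
  have /cvgrPdist_le/(_ _ e'0) := cvg_chr (nbhs_filter (chart p p)) pp uc (ec i) (ec j).
  by apply: filterS => u; rewrite /P distrC.
move=> /nbhs_epsP[d d0 H]; exists d => // z pz /H {}H v w.
rewrite (chr_sum _ _ pz) (chr_sum _ _ pp) -sumrB.
apply: (@le_trans _ _ (\sum_(i < n) \sum_(j < n) e' * (`|v| * `|w|))).
  rewrite (le_trans (ler_norm_sum _ _ _))// ler_sum// => i _.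
  rewrite -sumrB (le_trans (ler_norm_sum _ _ _))// ler_sum// => j _.
  rewrite -scalerBr normrZ mulrC normrM.
  apply: ler_pM => //; first exact: (H (i, j)).
  by apply: ler_pM => //; exact: mx_coord_le.
rewrite !sumr_const !card_ord -mulrnA -mulr_natl mulrA ler_wpM2r ?mulr_ge0//.
rewrite /e' mulrCA ger_pMr// ler_pdivrMr ?exprn_gt0// mul1r -natrX ler_nat.
by rewrite -mulnn leq_mul.
Qed.

Lemma chr_bounded p : exists2 K : R, 0 < K &
  forall v w, `|chr p (chart p p) v w| <= K * (`|v| * `|w|).
Proof.
have pp := dom_refl p.
pose K := \sum_(i < n) \sum_(j < n)
  `|chr p (chart p p) (delta_mx 0 i) (delta_mx 0 j)|.
exists (K + 1) => [|v w]; first by rewrite ltr_wpDl// !sumr_ge0// => i _; rewrite sumr_ge0.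
rewrite (chr_sum _ _ pp) mulrDl ler_wpDr ?mulr_ge0// /K mulr_suml.
rewrite (le_trans (ler_norm_sum _ _ _))// ler_sum// => i _; rewrite mulr_suml.
rewrite (le_trans (ler_norm_sum _ _ _))// ler_sum// => j _.
by rewrite normrZ mulrC ler_wpM2l// normrM ler_pM// mx_coord_le.
Qed.

End Local.

(** * First-order expansion of parallel transport *)

Section ShortTransport.
Context (R : realType) (n : nat) (M : riemannianManifold R n) (U : set M).
Hypothesis hU : geodesically_convex U.
Implicit Types (p q z : M) (u v w : 'rV[R]_n) (c : R -> M).

Lemma tcB q z v w : dom q z -> tc q z (v - w) = tc q z v - tc q z w.
Proof. by move=> qz; rewrite !(tcE _ qz) mulmxBl. Qed.

Lemma chr_matrix p (a : 'rV[R]_n) : exists G : 'M[R]_n,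
  forall v, v *m G = chr p (chart p p) v a.
Proof.
have pp := dom_refl p.
have L : linear (chr p (chart p p) a) by exact: chr_linear.
pose LL : {linear 'rV[R]_n -> 'rV[R]_n} :=
    HB.pack (chr p (chart p p) a) (GRing.isLinear.Build R _ _ _ _ L).
exists (lin1_mx LL) => v; rewrite mul_rV_lin1 /=; exact: chrC.
Qed.

(* To first order, parallel transport along a short geodesic only depends on
   its end points, whichever geodesic it is. *)
Lemma transport_expansion p (a : 'rV[R]_n) (G : 'M[R]_n) (e : R) : U p ->
  (forall v, v *m G = chr p (chart p p) v a) -> 0 < e ->
  exists2 d : R, 0 < d & forall q, U q -> dist p q < d ->
    dom p q /\ `|tc p q (transport p q a) - a + (chart p q - chart p p) *m G|
      <= e * dist p q.
Proof.
move=> Up HG e0; have pp := dom_refl p.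
have [r [C [r0 C0 rdom nrm]]] := chart_scale_exists p.
have [K K0 HK] := chr_bounded p.
set A := tnorm p a; have A0 : 0 <= A := tnorm_ge0 p a.
(* Half of [e] pays for the variation of the Christoffel symbols with the base point, the other half
   for the drift of the field away from [a], whose contribution is quadratic in the length. *)
pose e1 := e / 2 / (C * (C * A) + 1).
have CA : 0 <= C * (C * A) by rewrite !mulr_ge0// ltW.
have e10 : 0 < e1 by rewrite !divr_gt0// ltr_wpDl.
have [d1 d10 H1] := chr_near p e10.
have [d2 d20 H2] := chr_near p ltr01.
pose K2 := C * K * ((K + 1) * (C * (C * A))).
have K20 : 0 <= K2 by rewrite /K2; do !apply: mulr_ge0 => //; rewrite ?addr_ge0// ltW.
pose m := Num.min r (Num.min d1 d2).
have m0 : 0 < m by rewrite !lt_min r0 d10.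
pose d := Num.min (m / C) (e / 2 / (K2 + 1)).
exists d => [|q Uq]; first by rewrite lt_min !divr_gt0// ltr_wpDl.
rewrite lt_min ltr_pdivlMr// [_ * C]mulrC => /andP[lm ld].
have [c [X [mc pX X0 X1]]] := transport_parallel hU a Up Uq.
have [gc c0 c1 cd] := mc; have C1c := gc.1.
set l := dist p q in lm ld cd *; have l0 : 0 <= l by rewrite -cd tnorm_ge0.
have lmr : C * tnorm p (velocity c 0) < r.
  by rewrite cd (lt_le_trans lm)// ge_min lexx.
have S (s : R) : 0 <= s <= 1 -> dom p (c s) /\ `|chart p (c s) - chart p p| <= C * l.
  move=> s01; have [ps H] := short_geodesic (And4 r0 C0 rdom nrm) gc c0 lmr s01.
  split=> //; apply: (le_trans H); rewrite cd ler_piMr ?mulr_ge0 ?(ltW C0)//.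
  by case/andP: s01.
have Sm (s : R) : 0 <= s <= 1 -> [/\ dom p (c s), `|chart p (c s) - chart p p| <= r,
    `|chart p (c s) - chart p p| < d1 & `|chart p (c s) - chart p p| < d2].
  move=> /S[ps H]; have := le_lt_trans H lm.
  by rewrite !lt_min => /and3P[/ltW].
pose w s := tc p (c s) (velocity c s); pose x s := tc p (c s) (X s).
have wb (s : R) : 0 <= s <= 1 -> `|w s| <= C * l.
  move=> /Sm[ps sr _ _]; have [H _] := nrm _ ps sr (velocity c s).
  by rewrite (geodesic_speed s 0 gc) c0 cd in H.
have xb (s : R) : 0 <= s <= 1 -> `|x s| <= C * A.
  move=> /Sm[ps sr _ _]; have [H _] := nrm _ ps sr (X s).
  by rewrite /tnorm (par_inner_const C1c pX pX s 0) c0 X0 in H.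
have dx (s : R) : 0 <= s <= 1 -> is_derive s 1 x (- chr p (chart p (c s)) (w s) (x s)).
  move=> /Sm[ps _ _ _]; apply: (par_change C1c (dom_refl (c s)) ps).
  exact: ((par_atP X C1c).1 pX s).
have x0 : x 0 = a by rewrite /x c0 tc_id X0.
have cb (s : R) : 0 <= s <= 1 -> `|chr p (chart p (c s)) (w s) (x s)| <=
    (K + 1) * (C * (C * A)) * l.
  move=> s01; have [ps _ _ sd2] := Sm _ s01; have := H2 _ ps sd2 (w s) (x s).
  rewrite mul1r => H; rewrite -[chr _ _ _ _](subrK (chr p (chart p p) (w s) (x s))).
  rewrite (le_trans (ler_normD _ _))//.
  apply: (@le_trans _ _ ((K + 1) * (`|w s| * `|x s|))).
    by rewrite mulrDl mul1r addrC lerD.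
  rewrite [leRHS](_ : _ = (K + 1) * ((C * l) * (C * A))); last by ring.
  by rewrite ler_pM2l ?ltr_wpDl ?(ltW K0)// ler_pM ?wb ?xb.
have xa (s : R) : 0 <= s <= 1 -> `|x s - a| <= (K + 1) * (C * (C * A)) * l.
  move=> /andP[s0 s1]; rewrite -x0.
  apply: (@le_trans _ _ ((K + 1) * (C * (C * A)) * l * (s - 0))).
    apply: (mvt_mx_le (f' := fun s => - chr p (chart p (c s)) (w s) (x s)) s0).
    - by rewrite !mulr_ge0// ?addr_ge0// ltW.
    - by move=> t /andP[t0 ts]; apply: dx; rewrite t0 (le_trans ts).
    - by move=> t /andP[t0 ts]; rewrite normrN; apply: cb; rewrite t0 (le_trans ts).
  by rewrite subr0 ler_piMr// !mulr_ge0// ?addr_ge0// ltW.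
(* The expansion is the increment of [h] over [[0, 1]]. Its derivative compares the Christoffel term
   along the curve with the one frozen at [p] and [a]. *)
pose h s := x s + (chart p (c s)) *m G.
have dh (s : R) : 0 <= s <= 1 ->
    is_derive s 1 h (- chr p (chart p (c s)) (w s) (x s) + w s *m G).
  move=> s01; have [ps _ _ _] := Sm _ s01.
  apply: is_deriveD; first exact: dx.
  apply: is_derive_eq (is_derive_mulmx (curve_derive C1c ps) (is_derive_cst G s 1)) _.
  by rewrite mulmx0 addr0.
have hb (s : R) : 0 <= s <= 1 -> `|- chr p (chart p (c s)) (w s) (x s) + w s *m G| <= e * l.
  move=> s01; have [ps _ sd1 _] := Sm _ s01; have Hd := H1 _ ps sd1 (w s) (x s).
  rewrite HG; set Y := chr _ _ _ _ in Hd *.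
  set Y0 := chr _ _ _ _ in Hd.
  have E : - Y + chr p (chart p p) (w s) a = - (Y - Y0) - chr p (chart p p) (w s) (x s - a).
    have := chr_linear (w s) pp (-1) a (x s).
    rewrite !scaleN1r [- a + _]addrC [- chr _ _ _ _ + _]addrC => ->.
    by rewrite !opprB [Y0 - Y]addrC -addrA [Y0 + _]addrC subrK.
  rewrite E (le_trans (ler_normB _ _))// normrN.
  have T1 : `|Y - Y0| <= e / 2 * l.
    apply: (le_trans Hd); apply: (@le_trans _ _ (e1 * (C * l * (C * A)))).
      by rewrite ler_wpM2l ?(ltW e10)// ler_pM ?wb ?xb.
    rewrite (_ : e1 * _ = e1 * (C * (C * A)) * l); last by ring.
    rewrite ler_wpM2r// /e1 mulrAC ler_pdivrMr ?ltr_wpDl//.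
    by rewrite ler_wpM2l ?divr_ge0 ?(ltW e0)// lerDl.
  have T2 : `|chr p (chart p p) (w s) (x s - a)| <= e / 2 * l.
    apply: (le_trans (HK _ _)); apply: (@le_trans _ _ (K2 * l * l)).
      rewrite /K2 (_ : _ * l * l = K * ((C * l) * ((K + 1) * (C * (C * A)) * l))); last by ring.
      by rewrite ler_wpM2l ?(ltW K0)// ler_pM ?wb ?xa.
    rewrite ler_wpM2r//; move: (ltW ld); rewrite ler_pdivlMr ?ltr_wpDl//.
    apply: le_trans; rewrite mulrC ler_wpM2l// lerDl//.
  by rewrite (splitr e) mulrDl lerD.
have := mvt_mx_le ler01 _ dh hb; rewrite subr0 mulr1 => /(_ _).
rewrite /h x0 c0 c1 /x c1 X1 => H.
have [|ps _] := S 1; first by rewrite ler01 lexx.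
rewrite c1 in ps; split=> //.
rewrite mulmxBl; apply: le_trans (H _); last by rewrite mulr_ge0 ?(ltW e0).
by rewrite opprD addrACA.
Qed.

(** [c] is not assumed to be minimizing, so the transport need not follow it. Both vectors still
    have the same first-order expansion in the chart: the transported one by [transport_expansion],
    the velocity by the geodesic equation. *)
Lemma geodesic_transport c (s e : R) : geodesic c ->
  (forall t, 0 <= t <= 1 -> U (c t)) -> 0 <= s <= 1 -> 0 < e ->
  exists2 d : R, 0 < d & forall t, 0 <= t <= 1 -> `|t - s| < d ->
    tnorm (c t) (transport (c s) (c t) (velocity c s) - velocity c t)
      <= e * `|t - s|.
Proof.
move=> gc cU s01 e0; have C1c := gc.1; set p := c s; set a := velocity c s.
have pp := dom_refl p; have Up : U p by exact: cU.
have [r [C [r0 C0 rdom nrm]]] := chart_scale_exists p.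
have [G HG] := chr_matrix p a.
set V := tnorm p a; have V0 : 0 <= V := tnorm_ge0 p a.
pose W := V + 1 + n%:R * `|G|.
have W0 : 0 < W by rewrite ltr_pwDl// ?ltr_wpDl// mulr_ge0.
pose e1 := e / (C * W); have e10 : 0 < e1 by rewrite divr_gt0// mulr_gt0.
have [d1 d10 H1] := transport_expansion Up HG e10.
have pars : par_at p c (velocity c) s by exact: ((par_atP _ C1c).1 gc.2 s).
have dudu := curve_derive C1c pp; rewrite tc_id -/a in dudu.
have /is_derive_epsP/(_ _ e10)[d2 d20 H2] := pars.
have /is_derive_epsP/(_ _ e10)[d3 d30 H3] := dudu.
have [d4 d40 H4] : exists2 d : R, 0 < d & forall t, `|t - s| < d ->
    `|chart p (c t) - chart p p| <= r.
  have /continuous_epsP/(_ _ r0)[d d0 H] := chart_curve_continuous C1c pp.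
  by exists d => // t /H.
exists (Num.min (Num.min (d1 / (V + 1)) d2) (Num.min d3 d4)).
  by rewrite !lt_min d20 d30 d40 divr_gt0// ltr_wpDl.
move=> t t01; rewrite !lt_min => /andP[/andP[td1 td2] /andP[td3 td4]].
have Ut := cU t t01.
have dV : dist p (c t) <= `|t - s| * V by exact: dist_le_geodesic.
have dd1 : dist p (c t) < d1.
  rewrite (le_lt_trans dV)//; move: td1; rewrite ltr_pdivlMr ?ltr_wpDl//.
  by apply: le_lt_trans; rewrite ler_wpM2l// lerDl.
have [pt E1] := H1 _ Ut dd1.
have /(_ td2) E2 := H2 (t - s); have /(_ td3) E3 := H3 (t - s).
have ts : s + (t - s) *: (1 : R) = t by rewrite [_ *: _]mulr1 addrC subrK.
rewrite ts !tc_id -/a -HG /= in E2; rewrite ts /= in E3.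
have [_ T] := nrm _ pt (H4 _ td4) (transport p (c t) a - velocity c t).
apply: (le_trans T).
(* Three first-order remainders: those of the transport, of the velocity and of the curve itself. *)
have -> : tc p (c t) (transport p (c t) a - velocity c t) =
    (tc p (c t) (transport p (c t) a) - a + (chart p (c t) - chart p p) *m G)
    - (tc p (c t) (velocity c t) - a - (t - s) *: - (a *m G))
    - (chart p (c t) - chart p p - (t - s) *: a) *m G.
  rewrite (tcB _ _ pt) [(_ - (t - s) *: a) *m G]mulmxBl -scalemxAl.
  move: (tc _ _ (transport _ _ _)) (tc _ _ (velocity _ _)) (_ *m G) (a *m G) => A B X Y.
  by apply/rowP => j; rewrite !mxE; ring.
have nG : `|(chart p (c t) - chart p p - (t - s) *: a) *m G| <=
    n%:R * `|G| * (e1 * `|t - s|).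
  rewrite (le_trans (mulmx_norm_le _ _))// mulrAC ler_wpM2l// mulr_ge0//.
have S : `|tc p (c t) (transport p (c t) a) - a + (chart p (c t) - chart p p) *m G|
    <= e1 * (`|t - s| * V).
  by apply: (le_trans E1); rewrite ler_wpM2l// ltW.
apply: (@le_trans _ _ (C * (e1 * (`|t - s| * V) + e1 * `|t - s| +
    n%:R * `|G| * (e1 * `|t - s|)))).
  rewrite ler_wpM2l ?(ltW C0)// (le_trans (ler_normB _ _))// lerD//.
  by rewrite (le_trans (ler_normB _ _))// lerD.
rewrite (_ : C * _ = e1 * (C * W) * `|t - s|); last by rewrite /W; ring.
by rewrite /e1 divfK// gt_eqF// mulr_gt0.
Qed.

End ShortTransport.

(** * Increments of functions of one real variable *)

Section OneDimensional.
Context (R : realType).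

(** The local bounds with constant [A + e] add up by Cousin's lemma; then [e] tends to 0. *)
Lemma pointwise_lipschitz (psi : R -> R) (A a b : R) : a <= b ->
  (forall s, a <= s <= b -> forall e, 0 < e -> exists2 d : R, 0 < d &
    forall t, a <= t <= b -> `|t - s| < d ->
      `|psi t - psi s| <= (A + e) * `|t - s|) ->
  psi b - psi a <= A * (b - a).
Proof.
move=> ab H.
suff K e : 0 < e -> psi b - psi a <= (A + e) * (b - a).
  have [->|ba] := eqVneq b a; first by rewrite !subrr mulr0.
  have ba0 : 0 < b - a by rewrite subr_gt0 lt_neqAle eq_sym ba.
  rewrite -ler_pdivrMr//; apply/ler_addgt0Pr => e e0.
  by rewrite ler_pdivrMr//; exact: K.
move=> e0; apply: (@cousin R (fun x y => psi y - psi x <= (A + e) * (y - x)) a b ab).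
  by move=> x y z _ _; lra.
move=> s sab; have [d d0 Hd] := H s sab e e0; exists d => // x y.
move=> /andP[ax xs] /andP[sy yb] dx dy.
have := Hd x; have := Hd y.
rewrite (ger0_norm (_ : 0 <= y - s)) ?subr_ge0// ltrBlDl dy yb.
rewrite (ler0_norm (_ : x - s <= 0)) ?subr_le0// opprB ltrBlDl -ltrBlDr dx ax.
case/andP: sab => as_ sb; rewrite (le_trans as_ sy) (le_trans xs sb).
move=> /(_ isT isT)/ler_normlP[_ h1] /(_ isT isT)/ler_normlP[h2 _]; lra.
Qed.

(* [psi] is the derivative of [phi], but neither its continuity nor its
   integrability has to be known. *)
Lemma descent_integral (phi psi : R -> R) (A : R) : 0 <= A ->
  (forall s, 0 <= s <= 1 -> forall e, 0 < e -> exists2 d : R, 0 < d &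
    forall t, 0 <= t <= 1 -> `|t - s| < d ->
      `|phi t - phi s - (t - s) * psi s| <= e * `|t - s|) ->
  (forall s, 0 <= s <= 1 -> forall e, 0 < e -> exists2 d : R, 0 < d &
    forall t, 0 <= t <= 1 -> `|t - s| < d ->
      `|psi t - psi s| <= (A + e) * `|t - s|) ->
  phi 1 - phi 0 <= psi 0 + A / 2.
Proof.
move=> A0 Hphi Hpsi.
have P s : 0 <= s <= 1 -> psi s <= psi 0 + A * s.
  move=> /andP[s0 s1]; rewrite -lerBlDl -[s in A * s]subr0.
  apply: pointwise_lipschitz => // x /andP[x0 xs] e e0.
  have [|d d0 Hd] := Hpsi x _ e e0; first by rewrite x0 (le_trans xs).
  exists d => // t /andP[t0 ts]; apply: Hd; by rewrite t0 (le_trans ts).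
(* The subtracted quadratic has as derivative the upper bound [P] on [psi], so [chi] should not
   increase; Cousin's lemma shows it up to a slope [e]. *)
pose chi s := phi s - psi 0 * s - A / 2 * s ^+ 2.
suff K e : 0 < e -> chi 1 - chi 0 <= e.
  have : chi 1 - chi 0 <= 0 by apply/ler_addgt0Pr => e e0; rewrite add0r K.
  by rewrite /chi; lra.
move=> e0; have e20 : 0 < e / 2 by rewrite divr_gt0.
rewrite -[leRHS]mulr1 -[X in _ * X](subr0 1).
apply: (@cousin R (fun x y => chi y - chi x <= e * (y - x)) 0 1 ler01).
  by move=> x y z _ _; lra.
move=> s s01; have [d d0 Hd] := Hphi s s01 _ e20.
(* The second bound gives [A * (s - x) <= e / 2], the cost of bounding [psi] at [s] instead of at
   the left end [x]. *)
exists (Num.min d (e / 2 / (A + 1))) => [|x y].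
  by rewrite lt_min d0 divr_gt0// ltr_wpDl.
move=> /andP[x0 xs] /andP[sy y1] dx dy.
have xd : s - d < x by rewrite (le_lt_trans _ dx)// lerB// ge_min lexx.
have yd : y < s + d by rewrite (lt_le_trans dy)// lerD2l ge_min lexx.
have := Hd x; have := Hd y.
rewrite (ger0_norm (_ : 0 <= y - s)) ?subr_ge0// ltrBlDl yd y1.
rewrite (ler0_norm (_ : x - s <= 0)) ?subr_le0// opprB ltrBlDl -ltrBlDr xd x0.
case/andP: (s01) => s0 s1; rewrite (le_trans s0 sy) (le_trans xs s1).
move=> /(_ isT isT)/ler_normlP[_ h1] /(_ isT isT)/ler_normlP[h2 _].
have ps := P s s01.
have As : A * (s - x) <= e / 2.
  have : s - x <= e / 2 / (A + 1).
    by rewrite lerBlDl -lerBlDr ltW// (le_lt_trans _ dx)// lerB// ge_min lexx orbT.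
  rewrite ler_pdivlMr ?ltr_wpDl// => /(le_trans _); apply.
  by rewrite mulrC ler_wpM2l ?subr_ge0// lerDl.
have yx : 0 <= y - x by rewrite subr_ge0 (le_trans xs).
have M1 : (y - x) * psi s <= (y - x) * (psi 0 + A * s) by rewrite ler_wpM2l.
have M2 : (y - x) * (A * (s - x)) <= (y - x) * (e / 2) by rewrite ler_wpM2l.
have M3 : 0 <= A / 2 * (y - x) * (y - x) by rewrite !mulr_ge0.
rewrite /chi; lra.
Qed.

End OneDimensional.

(** * Gradients and Hessians *)

Section Differentials.
Context (R : realType) (n : nat).

Lemma diff_eps (V W : normedModType R) (f : V -> W) (a : V) :
  differentiable f a -> forall e : R, 0 < e -> exists2 d : R, 0 < d &
    forall k, `|k| < d -> `|f (a + k) - f a - 'D_k f a| <= e * `|k|.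
Proof.
move=> df e e0; have /eqaddoP/(_ e e0) := diff_locally df.
move=> /nbhs_epsP[d d0 H]; exists d => // k kd.
have : `|f (k + a) - (f a + 'd f a k)| <= e * `|k| by apply: H; rewrite subr0.
by rewrite [k + a]addrC opprD addrA deriveE.
Qed.

Lemma near_differentiable (V W : normedModType R) (f g : V -> W) (a : V) :
  (\forall u \near a, f u = g u) -> differentiable f a -> differentiable g a.
Proof.
move=> fg df.
suff H : is_diff a g ('d f a) by case: H.
apply: differentiable_eps; first exact: diff_continuous.
move=> e e0; have [d d0 Hd] := diff_eps df e0.
have /nbhs_epsP[d' d'0 Hd'] := fg.
exists (Num.min d d') => [|k]; first by rewrite lt_min d0.
rewrite lt_min => /andP[kd kd']; rewrite -(nbhs_singleton fg) -Hd'; last first.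
  by rewrite [a + k]addrC addrK.
by rewrite -deriveE//; exact: Hd.
Qed.

Definition dvec (f : 'rV[R]_n -> R) (u : 'rV[R]_n) : 'rV[R]_n :=
  \row_i 'D_(delta_mx 0 i) f u.

Lemma D_dvec f u w : differentiable f u -> 'D_w f u = bform (dvec f u) 1%:M w.
Proof.
move=> df; rewrite deriveE// {1}(row_sum_delta w) linear_sum bform1 mxE.
apply: eq_bigr => i _; rewrite linearZ -deriveE// !mxE mulrC.
by [].
Qed.

Lemma D_add (V : normedModType R) (f : V -> R) (a u v : V) k :
  differentiable f a -> 'D_(k *: u + v) f a = k * 'D_u f a + 'D_v f a.
Proof. by move=> df; rewrite !deriveE// linearP. Qed.

Lemma is_derive_dvec f (A : set 'rV[R]_n) u v : open A -> Ck 2 f A -> A u ->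
  is_derive u v (dvec f) (\row_i 'D_v ('D_(delta_mx 0 i) f) u).
Proof.
move=> oA Cf Au; apply/is_derive_mx => i j; rewrite mxE.
have H : is_derive u v ('D_(delta_mx 0 j) f) ('D_v ('D_(delta_mx 0 j) f) u).
  by apply: derivableP; exact: (Ck_derivable (Ck_D _ Cf)).
by under eq_fun do rewrite mxE.
Qed.

Lemma Ck_differentiable (V : normedModType R) k (f : V -> R) (A : set V) u :
  findim V -> open A -> Ck k.+1 f A -> A u -> differentiable f u.
Proof.
by move=> fV oA Cf Au; apply: (C1_differentiable fV oA (Ck_le _ Cf) Au).
Qed.

Lemma D_D_dvec f (A : set 'rV[R]_n) u v w : open A -> Ck 2 f A -> A u ->
  'D_v ('D_w f) u = bform (\row_i 'D_v ('D_(delta_mx 0 i) f) u) 1%:M w.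
Proof.
move=> oA Cf Au.
have H := is_derive_form (is_derive_dvec v oA Cf Au)
  (is_derive_cst 1%:M u v) (is_derive_cst w u v).
have -> : 'D_v ('D_w f) u = 'D_v (fun u => bform (dvec f u) 1%:M w) u.
  apply: near_eq_D; have : \forall u' \near u, A u' by apply: open_nbhs_nbhs.
  apply: filterS => u' Au'; apply: D_dvec.
  exact: (Ck_differentiable (findim_rV R n) oA Cf).
case: H => _ ->.
rewrite [X in _ + X](_ : _ = 0); last by rewrite bform0r.
rewrite [X in _ + X + _](_ : _ = 0) ?addr0// bform.unlock mulmx0 mul0mx mxE.
by [].
Qed.

End Differentials.

Section Functions.
Context (R : realType) (n : nat) (M : riemannianManifold R n).
Implicit Types (p q z y : M) (u v w : 'rV[R]_n) (c : R -> M) (h : M -> R).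

Lemma grad_inner h z v : differentiable (h \o ichart z) (chart z z) ->
  inner z (grad h z) v = 'D_v (h \o ichart z) (chart z z).
Proof.
move=> dh; rewrite (D_dvec _ dh) innerE /grad bform_mul mulVmx ?metric_unit//.
Qed.

(* [grad h y] is computed in the chart preferred at y; here it is read in the
   chart preferred at another point z *)
Lemma grad_chart h z y v : dom z y -> differentiable (h \o ichart z) (chart z y) ->
  inner y (grad h y) v = 'D_(tc z y v) (h \o ichart z) (chart z y).
Proof.
move=> zy dh; have yy := dom_refl y; have o := overlap_chart yy zy.
have E : \forall u \near chart y y, ((h \o ichart z) \o transition y z) u = (h \o ichart y) u.
  by apply: filterS (near_dom yy zy) => u [_ zu]; rewrite /transition /= chartK.
have dt := transition_differentiable o.
have dh' : differentiable (h \o ichart z) (transition y z (chart y y)).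
  by rewrite transitionE.
have dc : differentiable (h \o ichart y) (chart y y).
  exact: near_differentiable E (differentiable_comp dt dh').
rewrite (grad_inner _ dc) -(near_eq_D _ E) diff_chain// (transitionE _ yy).
by rewrite (D_transition _ o) (tcE _ zy).
Qed.

Lemma grad_curve h z c s : C1_curve c -> dom z (c s) ->
  differentiable (h \o ichart z) (chart z (c s)) ->
  is_derive s 1 (h \o c) (inner (c s) (grad h (c s)) (velocity c s)).
Proof.
move=> C1c zc dh; rewrite (grad_chart _ zc dh).
have := is_derive_comp (h := h \o ichart z) dh (curve_derive C1c zc).
apply: is_derive_near; apply: filterS (near_curve C1c.1 zc) => r zr /=.
by rewrite chartK.
Qed.

(* the Hessian of h at y, read in the chart preferred at z *)
Definition quad h z (u v w : 'rV[R]_n) : R :=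
  'D_v ('D_w (h \o ichart z)) u - 'D_(chr z u v w) (h \o ichart z) u.

(** Differentiate [<grad h, w> = D_w h] in the chart. Metric compatibility splits the derivative of
    the Gram matrix into the Christoffel term that completes the covariant derivative of [grad h]
    and the one subtracted in [quad]. *)
Lemma hess_inner h z (A : set 'rV[R]_n) v w : open A -> Ck 2 (h \o ichart z) A ->
  A (chart z z) -> inner z (hess h z v) w = quad h z (chart z z) v w.
Proof.
move=> oA C2 Az; have zz := dom_refl z; set u := chart z z.
set hz := h \o ichart z in C2 *; have fd := findim_rV R n.
have dh u' : A u' -> differentiable hz u' by exact: Ck_differentiable C2.
have nA : \forall u' \near u, A u' by apply: open_nbhs_nbhs.
pose X u' := tc z (ichart z u') (grad h (ichart z u')).
have XE : \forall u' \near u, dvec hz u' *m invmx (gr z u') = X u'.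
  apply: filterS (filterI nA (near_chart_dom zz)) => u' [Au' [y zy uE]].
  rewrite -{}uE in Au' *; rewrite /X chartK//; apply: (bform_inj (gr_unit zy)) => w'.
  rewrite bform_mul mulVmx ?gr_unit// -(D_dvec _ (dh _ Au')).
  rewrite -[w' in RHS](tcKV w' zy) -inner_gr// (grad_chart _ zy (dh _ Au')).
  by rewrite tcKV.
have cd := chart_dom_in zz.
(* The explicit derivative shows that [X] is derivable; its value is then abstracted to [X']. *)
have dX0 := is_derive_mulmx (is_derive_dvec v oA C2 Az)
  (is_derive_invmx (gr_unit zz) (is_derive_gr v cd)).
have dX := is_derive_near XE dX0.
set X' := _ + _ in dX.
have EH : hess h z v = X' + chr z u v (X u).
  rewrite /hess /nabla christoffelE; congr (_ + _); last first.
    by rewrite /X /u chartK// tc_id.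
  have -> : (fun u => tcoord z (ichart z u) (grad h (ichart z u))) = X.
    by apply/funext => u'; rewrite tcoordE.
  by case: dX.
have Xg u' : A u' -> chart_dom z u' -> bform (X u') (gr z u') w = 'D_w hz u'.
  move=> Au' [y zy E]; rewrite -E /X chartK//.
  rewrite -[w in LHS](tcKV w zy) -inner_gr// (grad_chart _ zy); last by rewrite E; exact: dh.
  by rewrite tcKV.
have D2 : 'D_v ('D_w hz) u = bform X' (gr z u) w + bform (X u) (dgr z u v) w.
  have [_] := is_derive_form dX (is_derive_gr v cd) (is_derive_cst w u v).
  rewrite bform0r addr0 => <-; apply/esym; apply: near_eq_D.
  by apply: filterS (filterI nA (near_chart_dom zz)) => u' [Au' cu']; exact: Xg.
rewrite innerE -(gr_self z) -/u EH bformDl /quad D2 -/hz.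
rewrite (metric_compat _ _ v zz) -/u.
have -> : 'D_(chr z u v w) hz u = bform (X u) (gr z u) (chr z u v w).
  have [y' zy' E] := cd; rewrite (D_dvec _ (dh u Az)).
  have := nbhs_singleton XE => <-.
  by rewrite bform_mul mulVmx// gr_unit.
have aux (a b d : R) : a + b = a + (b + d) - d by ring.
exact: aux.
Qed.

Lemma quad_linear h z y (A : set 'rV[R]_n) w : open A -> Ck 2 (h \o ichart z) A ->
  dom z y -> A (chart z y) -> forall k v v', quad h z (chart z y) (k *: v + v') w =
    k * quad h z (chart z y) v w + quad h z (chart z y) v' w.
Proof.
move=> oA C2 zy Ay k v v'; have fd := findim_rV R n.
have d1 := Ck_differentiable fd oA (Ck_D w C2) Ay.
have d2 := Ck_differentiable fd oA C2 Ay.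
have E : chr z (chart z y) (k *: v + v') w =
    k *: chr z (chart z y) v w + chr z (chart z y) v' w.
  by rewrite (chrC _ w zy) (chr_linear w zy) (chrC w v zy) (chrC w v' zy).
rewrite /quad E (D_add v v' k d1) (D_add _ _ k d2).
have aux (a b c d : R) : k * a + b - (k * c + d) = k * (a - c) + (b - d) by ring.
exact: aux.
Qed.

Lemma quad_sym h z y (A : set 'rV[R]_n) v w : open A -> Ck 2 (h \o ichart z) A ->
  dom z y -> A (chart z y) -> quad h z (chart z y) v w = quad h z (chart z y) w v.
Proof.
move=> oA C2 zy Ay; rewrite /quad (chrC v w zy).
have aux (a b d : R) : a = b -> a - d = b - d by move=> ->.
exact: aux (schwarz w v oA C2 Ay).
Qed.

Lemma inner_inj z v v' : (forall w, inner z v w = inner z v' w) -> v = v'.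
Proof.
move=> H; apply/eqP; rewrite -subr_eq0; apply/eqP; apply: (inner_eq0 (z := z)).
by rewrite innerBl H subrr.
Qed.

Lemma hess_linear h z (A : set 'rV[R]_n) : open A -> Ck 2 (h \o ichart z) A ->
  A (chart z z) -> linear (hess h z).
Proof.
move=> oA C2 Az k v v'; apply: (inner_inj (z := z)) => w.
rewrite [RHS]innerDl innerZl (hess_inner _ _ oA C2 Az).
rewrite (hess_inner v w oA C2 Az) (hess_inner v' w oA C2 Az).
exact: (quad_linear _ oA C2 (dom_refl z) Az).
Qed.

(** Along a geodesic the acceleration in the chart is minus the Christoffel term of the velocity,
    which is precisely the correction in [quad]. *)
Lemma geodesic_second h z c s (A : set 'rV[R]_n) : open A ->
  Ck 2 (h \o ichart z) A -> geodesic c -> dom z (c s) -> A (chart z (c s)) ->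
  let w := tc z (c s) (velocity c s) in
  is_derive s 1 (fun r => inner (c r) (grad h (c r)) (velocity c r))
    (quad h z (chart z (c s)) w w).
Proof.
move=> oA C2 gc zc Ac w; have C1c := gc.1; set hz := h \o ichart z in C2 *.
have fd := findim_rV R n.
have dh u' : A u' -> differentiable hz u' by exact: Ck_differentiable C2.
have du := curve_derive C1c zc.
have dw : is_derive s 1 (fun r => tc z (c r) (velocity c r)) (- chr z (chart z (c s)) w w).
  apply: (par_change C1c (dom_refl (c s)) zc).
  exact: ((par_atP _ C1c).1 gc.2 s).
pose H2 := \row_i 'D_w ('D_(delta_mx 0 i) hz) (chart z (c s)).
have dd : is_derive s 1 (fun r => dvec hz (chart z (c r))) H2.
  apply/is_derive_mx => i j; rewrite [H2 _ _]mxE.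
  under eq_fun do rewrite mxE.
  apply: (is_derive_comp (h := 'D_(delta_mx 0 j) hz)) du.
  exact: (Ck_differentiable fd oA (Ck_D (delta_mx 0 j) C2)).
have := is_derive_form dd (is_derive_cst 1%:M s 1) dw.
rewrite [X in _ + X + _](_ : _ = 0); last by rewrite bform.unlock mulmx0 mul0mx mxE.
rewrite addr0 bformNr -(D_dvec _ (dh _ Ac)) -(D_D_dvec _ _ oA C2 Ac).
apply: is_derive_near; near=> r.
have zr : dom z (c r) by near: r; exact: near_curve C1c.1 zc.
have Ar : A (chart z (c r)).
  near: r; apply: (chart_curve_continuous C1c zc).
  by apply: open_nbhs_nbhs.
by rewrite (grad_chart _ zr (dh _ Ar)) (D_dvec _ (dh _ Ar)).
Unshelve. all: by end_near. Qed.

Lemma quad_continuous h z (A : set 'rV[R]_n) w : open A ->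
  Ck 2 (h \o ichart z) A -> A (chart z z) ->
  {for chart z z, continuous (fun u => quad h z u w w)}.
Proof.
move=> oA C2 Az; set hz := h \o ichart z in C2 *; have zz := dom_refl z.
have fd := findim_rV R n.
have c1 : {for chart z z, continuous ('D_w ('D_w hz))}.
  exact: (Ck_cont (Ck_D w (Ck_D w C2))).
have c2 : {for chart z z, continuous (dvec hz)}.
  apply/(cvg_mxP (nbhs_filter (chart z z))) => i j.
  have E u : dvec hz u i j = 'D_(delta_mx 0 j) hz u by rewrite mxE.
  rewrite (eq_cvg _ _ E) E.
  exact: (Ck_cont (Ck_D (delta_mx 0 j) C2) Az).
have uc : (fun u : 'rV[R]_n => u) @ chart z z --> chart z z by exact: cvg_id.
have ec : (fun _ : 'rV[R]_n => w) @ chart z z --> w.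
  exact: (@cst_continuous _ _ w (chart z z)).
have c3 := cvg_chr (nbhs_filter (chart z z)) zz uc ec ec.
have c4 := cvg_form (nbhs_filter (chart z z)) c2
  (@cst_continuous _ _ (1%:M : 'M[R]_n) (chart z z)) c3.
have : {for chart z z, continuous (fun u => 'D_w ('D_w hz) u -
    bform (dvec hz u) 1%:M (chr z u w w))} by exact: cvgB c1 c4.
apply: near_eq_continuous; have : \forall u \near chart z z, A u.
  by apply: open_nbhs_nbhs.
apply: filterS => u Au; rewrite /quad (D_dvec (chr z u w w))//.
exact: (Ck_differentiable fd oA C2).
Qed.

Section Regular.
Variable U : set M.
Hypothesis hUreg : U `<=` closure (interior U).

(** A negative value at [z] would persist on a neighbourhood, which meets the interior of [U]. In
    its uses [Phi] keeps the coordinates of the tangent vector fixed while the base point moves. *)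
Lemma closure_interior_ge0 z (Phi : 'rV[R]_n -> R) : U z ->
  {for chart z z, continuous Phi} ->
  (\forall u \near chart z z, forall y, dom z y -> u = chart z y ->
     interior U y -> 0 <= Phi u) -> 0 <= Phi (chart z z).
Proof.
move=> Uz cPhi H; rewrite leNgt; apply/negP => neg.
have N1 : \forall u \near chart z z, Phi u < 0.
  have e0 : 0 < - Phi (chart z z) / 2 by rewrite divr_gt0// oppr_gt0.
  have /continuous_epsP/(_ _ e0)[d d0 Hd] := cPhi.
  apply/nbhs_epsP; exists d => // u /Hd; rewrite ler_norml => /andP[]; lra.
have zz := dom_refl z.
have N2 : nbhs z [set y | dom z y /\ (Phi (chart z y) < 0 /\
    (forall y', dom z y' -> chart z y = chart z y' -> interior U y' -> 0 <= Phi (chart z y)))].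
  apply: filterI; first by apply: open_nbhs_nbhs; split; [exact: dom_open|].
  exact: (chart_continuous zz (filterI N1 H)).
have [y [iy [zy [neg' pos]]]] := hUreg Uz N2.
by move: neg'; rewrite ltNge (pos y).
Qed.

Hypothesis complete : geodesically_complete M.

Lemma interior_geodesic y v : interior U y -> exists c (d : R),
  [/\ geodesic c, c 0 = y, velocity c 0 = v, 0 < d &
      forall s, `|s| < d -> U (c s)].
Proof.
move=> iy; have [c [gc c0 v0]] := complete y v.
have cc := gc.1.1; have : nbhs 0 (c @^-1` U) by apply: cc; rewrite c0.
by move=> /nbhs_epsP[d d0 H]; exists c, d; split=> // s sd; apply: H; rewrite subr0.
Qed.

(** At an interior point the difference quotients of [h] along a short geodesic are at most [l]
    times its speed. *)
Lemma D_lipschitz_le h z (l : R) (A : set 'rV[R]_n) w : U z -> 0 <= l ->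
  open A -> Ck 1 (h \o ichart z) A -> A (chart z z) ->
  (forall y1 y2, U y1 -> U y2 -> `|h y1 - h y2| <= l * dist y1 y2) ->
  'D_w (h \o ichart z) (chart z z) <= l * tnorm z w.
Proof.
move=> Uz l0 oA C1 Az lip; set hz := h \o ichart z in C1 *; have zz := dom_refl z.
pose Phi u := l * Num.sqrt (bform w (gr z u) w) - 'D_w hz u.
suff : 0 <= Phi (chart z z).
  by rewrite /Phi subr_ge0 gr_self -innerE.
apply: closure_interior_ge0 => //.
  have ec : (fun _ : 'rV[R]_n => w) @ chart z z --> w.
    exact: (@cst_continuous _ _ w (chart z z)).
  have gc := gr_continuous (chart_dom_in zz).
  have c0 : {for chart z z, continuous (fun u => bform w (gr z u) w)}.
    exact: (cvg_form (nbhs_filter (chart z z)) ec gc ec).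
  have c1 : {for chart z z, continuous (fun u => Num.sqrt (bform w (gr z u) w))}.
    by apply: (continuous_comp c0); exact: sqrt_continuous.
  have c2 : {for chart z z, continuous (fun u => l * Num.sqrt (bform w (gr z u) w))}.
    exact: cvgM (@cst_continuous _ _ l (chart z z)) c1.
  have c3 : {for chart z z, continuous ('D_w hz)} := Ck_cont (Ck_D w C1) Az.
  exact: cvgB c2 c3.
have : \forall u \near chart z z, A u by apply: open_nbhs_nbhs.
apply: filterS => u Au y zy uE iy; rewrite {}uE in Au *.
have [c [d [gc c0 v0 d0 cU]]] := interior_geodesic (w *m jac z y (chart z y)) iy.
have dh : differentiable hz (chart z y) by exact: (Ck_differentiable (findim_rV R n) oA C1 Au).
have zc : dom z (c 0) by rewrite c0.
have dh' : differentiable hz (chart z (c 0)) by rewrite c0.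
have D := grad_curve gc.1 zc dh'.
rewrite (grad_chart _ zc dh') c0 v0 tcKV// in D.
have Ew : bform w (gr z (chart z y)) w = inner y (w *m jac z y (chart z y))
  (w *m jac z y (chart z y)) by rewrite (inner_gr _ _ zy) tcKV.
rewrite /Phi subr_ge0 Ew.
rewrite -/(tnorm _ _) -v0 -c0; apply/ler_addgt0Pr => e e0.
have /is_derive_epsP/(_ _ e0)[d' d'0 Hd'] := D.
pose s := Num.min d d' / 2; have m0 : 0 < Num.min d d' by rewrite lt_min d0.
have s0 : 0 < s by rewrite divr_gt0.
have : `|s| < Num.min d d'.
  by rewrite gtr0_norm// /s ltr_pdivrMr// mulr_natr mulr2n ltrDl.
rewrite lt_min => /andP[sd sd'].
have := Hd' s sd'; rewrite add0r [s *: 1]mulr1 /= => H.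
have U0 : U (c 0) by apply: cU; rewrite normr0.
have L := lip _ _ (cU s sd) U0.
have dl : dist (c s) (c 0) <= s * tnorm (c 0) (velocity c 0).
  have := dist_le_geodesic s 0 gc; rewrite sub0r normrN (gtr0_norm s0).
  by rewrite (geodesic_speed s 0 gc).
have L' := le_trans L (ler_wpM2l l0 dl).
rewrite -(ler_pM2l s0); move: H; rewrite (gtr0_norm s0) /GRing.scale /=.
move=> /ler_normlP[H _]; move: L' => /ler_normlP[_ L'].
rewrite c0; move: H L'; rewrite c0; set DD := 'D_w hz _; lra.
Qed.

Variable (mu : R) (h : M -> R).
Hypothesis mu0 : 0 < mu.
Hypothesis sc : geodesically_strongly_convex mu U h.

(** Strong convexity at a small time [s], divided by [s]. The choice of [s] leaves [e / 2] for the
    remainder of the derivative and [e / 2] for the term [B * s]. *)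
Lemma strong_convex_first c : geodesic c -> (forall s, 0 <= s <= 1 -> U (c s)) ->
  is_derive (0 : R) 1 (h \o c) (inner (c 0) (grad h (c 0)) (velocity c 0)) ->
  inner (c 0) (grad h (c 0)) (velocity c 0) <=
    h (c 1) - h (c 0) - mu / 2 * tnorm (c 0) (velocity c 0) ^+ 2.
Proof.
move=> gc cU D; set g0 := inner _ _ _ in D *; set V := tnorm _ _ ^+ 2.
apply/ler_addgt0Pr => e e0; have e20 : 0 < e / 2 by rewrite divr_gt0.
have /is_derive_epsP/(_ _ e20)[d d0 Hd] := D.
have V0 : 0 <= V by exact: sqr_ge0.
pose B := mu / 2 * V; have B0 : 0 <= B by rewrite /B mulr_ge0// divr_ge0// ltW.
pose s := Num.min (Num.min d 1) (e / 2 / (B + 1)) / 2.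
have m0 : 0 < Num.min (Num.min d 1) (e / 2 / (B + 1)).
  by rewrite !lt_min d0 ltr01 divr_gt0// ltr_wpDl.
have s0 : 0 < s by rewrite divr_gt0.
have : s < Num.min (Num.min d 1) (e / 2 / (B + 1)).
  by rewrite /s ltr_pdivrMr// mulr_natr mulr2n ltrDl.
rewrite !lt_min -andbA => /and3P[sd s1 sB].
have := Hd s; rewrite (gtr0_norm s0) => /(_ sd).
rewrite add0r [s *: 1]mulr1 /GRing.scale /= => /ler_normlP[H _].
have s01 : 0 <= s <= 1 by rewrite !ltW.
have C := sc gc cU s01; rewrite -/V in C.
have Bs : B * s <= e / 2.
  move: (ltW sB); rewrite ler_pdivlMr ?ltr_wpDl//; apply: le_trans.
  by rewrite mulrC ler_pM2l// lerDl.
have Bss : s * (B * s) <= s * (e / 2) by rewrite ler_pM2l.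
rewrite -(ler_pM2l s0); rewrite /B in Bss; move: C H Bss; lra.
Qed.

(** The first-order inequality is added to the one for the reversed geodesic. *)
Lemma strong_monotone c : geodesic c -> (forall s, 0 <= s <= 1 -> U (c s)) ->
  is_derive (0 : R) 1 (h \o c) (inner (c 0) (grad h (c 0)) (velocity c 0)) ->
  is_derive (1 : R) 1 (h \o c) (inner (c 1) (grad h (c 1)) (velocity c 1)) ->
  mu * tnorm (c 0) (velocity c 0) ^+ 2 <=
  inner (c 1) (grad h (c 1)) (velocity c 1) - inner (c 0) (grad h (c 0)) (velocity c 0).
Proof.
move=> gc cU D0 D1; have F := strong_convex_first gc cU D0.
have gr_ := geodesic_aff (-1) 1 gc.
have E0 := aff_rev0 c; have E1 := aff_rev1 c.
have v0 : velocity (c \o aff (-1) 1) 0 = - velocity c 1.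
  by rewrite (velocity_aff _ _ _ gc.1) /aff mulr0 add0r scaleN1r.
have rU s : 0 <= s <= 1 -> U ((c \o aff (-1) 1) s).
  by move=> /andP[s0 s1]; apply: cU; rewrite /aff; apply/andP; split; lra.
have D : is_derive (0 : R) 1 (h \o (c \o aff (-1) 1))
    (inner ((c \o aff (-1) 1) 0) (grad h ((c \o aff (-1) 1) 0))
      (velocity (c \o aff (-1) 1) 0)).
  rewrite E0 v0 innerC innerNl innerC.
  have D1' : is_derive (aff (-1) 1 0) 1 (h \o c)
      (inner (c 1) (grad h (c 1)) (velocity c 1)) by rewrite /aff mulr0 add0r.
  by have := is_derive_comp_aff D1'; rewrite scaleN1r.
have := strong_convex_first gr_ rU D; rewrite E0 E1 v0 tnormN.
rewrite innerC innerNl innerC (geodesic_speed 1 0 gc).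
have aux (P Q V a b : R) : P <= b - a - mu / 2 * V ->
  - Q <= a - b - mu / 2 * V -> mu * V <= Q - P by lra.
exact: aux F.
Qed.

Hypothesis hC : forall z, U z -> exists A, [/\ open A, A (chart z z) &
  Ck 2 (h \o ichart z) A].

Lemma derive_on_curve c s : C1_curve c -> U (c s) ->
  is_derive s 1 (h \o c) (inner (c s) (grad h (c s)) (velocity c s)).
Proof.
move=> C1c Uc; have [A [oA Az C2]] := hC Uc.
apply: (grad_curve C1c (dom_refl (c s))).
exact: (Ck_differentiable (findim_rV R n) oA C2).
Qed.

(* Strong convexity only gives information along geodesics inside U: it is
   used at interior points and extended to U by continuity. *)
Lemma hess_coercive z v : U z -> mu * inner z v v <= inner z (hess h z v) v.
Proof.
move=> Uz; have [A [oA Az C2]] := hC Uz; have zz := dom_refl z.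
rewrite (hess_inner v v oA C2 Az).
pose Phi u := quad h z u v v - mu * bform v (gr z u) v.
suff : 0 <= Phi (chart z z) by rewrite /Phi subr_ge0 gr_self -innerE.
apply: closure_interior_ge0 => //.
  have ec : (fun _ : 'rV[R]_n => v) @ chart z z --> v.
    exact: (@cst_continuous _ _ v (chart z z)).
  have c0 : {for chart z z, continuous (fun u => bform v (gr z u) v)}.
    exact: (cvg_form (nbhs_filter (chart z z)) ec (gr_continuous (chart_dom_in zz)) ec).
  have c2 : {for chart z z, continuous (fun u => mu * bform v (gr z u) v)}.
    exact: cvgM (@cst_continuous _ _ mu (chart z z)) c0.
  have c3 : {for chart z z, continuous (fun u => quad h z u v v)}.
    exact: quad_continuous C2 Az.
  exact: cvgB c3 c2.
have : \forall u \near chart z z, A u by apply: open_nbhs_nbhs.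
apply: filterS => u Au y zy uE iy; rewrite {}uE in Au *.
have [c [d [gc c0 v0 d0 cU]]] := interior_geodesic (v *m jac z y (chart z y)) iy.
have zc : dom z (c 0) by rewrite c0.
have Ac : A (chart z (c 0)) by rewrite c0.
have := geodesic_second oA C2 gc zc Ac; rewrite c0 v0 tcKV// => D.
have Ev : bform v (gr z (chart z y)) v = inner y (v *m jac z y (chart z y))
  (v *m jac z y (chart z y)) by rewrite (inner_gr _ _ zy) tcKV.
rewrite /Phi subr_ge0 Ev.
rewrite -tnorm_sqr -v0 -c0; apply/ler_addgt0Pr => e e0.
have /is_derive_epsP/(_ _ e0)[d' d'0 Hd'] := D.
pose s := Num.min d d' / 2; have m0 : 0 < Num.min d d' by rewrite lt_min d0.
have s0 : 0 < s by rewrite divr_gt0.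
have : `|s| < Num.min d d'.
  by rewrite gtr0_norm// /s ltr_pdivrMr// mulr_natr mulr2n ltrDl.
rewrite lt_min => /andP[sd sd'].
have := Hd' s sd'; rewrite add0r [s *: 1]mulr1 (gtr0_norm s0) /GRing.scale /=.
(* The geodesic is shrunk so as to stay in [U]; monotonicity along it, divided by [s * s], compares
   the second derivative of [h] with [mu] times the squared speed. *)
have ga := geodesic_aff s 0 gc.
have aU r : 0 <= r <= 1 -> U ((c \o aff s 0) r).
  move=> /andP[r0 r1]; apply: cU; rewrite /aff addr0 normrM (gtr0_norm s0).
  by rewrite (ger0_norm r0) (le_lt_trans _ sd)// (gtr0_norm s0) ler_piMr// ltW.
have Dr (r : R) : 0 <= r <= 1 -> is_derive r 1 (h \o (c \o aff s 0))
    (inner ((c \o aff s 0) r) (grad h ((c \o aff s 0) r)) (velocity (c \o aff s 0) r)).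
  by move=> /aU; apply: derive_on_curve; exact: ga.1.
have := strong_monotone ga aU (Dr 0 _) (Dr 1 _); rewrite !lexx !ler01.
move=> /(_ isT isT); rewrite !(velocity_aff _ _ _ gc.1) /= /aff mulr0 mulr1 !addr0.
rewrite tnormZ (gtr0_norm s0) !(innerC _ (grad _ _)) !innerZl exprMn.
move=> M1 /ler_normlP[_ M2].
have ss0 : 0 < s * s by rewrite mulr_gt0.
rewrite -(ler_pM2l ss0).
set P := inner (c s) _ _ in M1 M2; set Q := inner (c 0) _ _ in M1 M2.
have M3 : s * (P - Q - s * quad h z (chart z y) v v) <= s * (e * s).
  by rewrite ler_pM2l.
rewrite c0; move: M1 M3; rewrite c0; set X := tnorm _ _ ^+ 2.
set Y := quad _ _ _ _ _; lra.
Qed.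

Lemma hess_tnorm z v : U z -> mu * tnorm z v <= tnorm z (hess h z v).
Proof.
move=> Uz; have [->|v0] := eqVneq (tnorm z v) 0; first by rewrite mulr0 tnorm_ge0.
have vp : 0 < tnorm z v by rewrite lt0r v0 tnorm_ge0.
rewrite -(ler_pM2r vp) -mulrA -expr2 tnorm_sqr (le_trans (hess_coercive v Uz))//.
exact: inner_le.
Qed.

End Regular.

End Functions.

(** * Functions on a product of manifolds *)

Section Slices.
Context (R : realType) (V W : normedModType R).

Lemma shift_pairr (h : R) (a : V) (u w : W) :
  (a, h *: w + u) = h *: (0, w) + (a, u).
Proof. by congr pair; rewrite /= scaler0 add0r. Qed.

Lemma shift_pairl (h : R) (b : W) (u v : V) :
  (h *: v + u, b) = h *: (v, 0) + (u, b).
Proof. by congr pair; rewrite /= scaler0 add0r. Qed.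

Lemma quotient_slicer (Z : normedModType R) (H : V * W -> Z) a u w :
  (fun h : R => h^-1 *: (((fun u => H (a, u)) \o shift u) (h *: w) - H (a, u))) =
  (fun h : R => h^-1 *: ((H \o shift (a, u)) (h *: (0, w)) - H (a, u))).
Proof. by apply/funext => h; rewrite /= -shift_pairr. Qed.

Lemma quotient_slicel (Z : normedModType R) (H : V * W -> Z) b u v :
  (fun h : R => h^-1 *: (((fun u => H (u, b)) \o shift u) (h *: v) - H (u, b))) =
  (fun h : R => h^-1 *: ((H \o shift (u, b)) (h *: (v, 0)) - H (u, b))).
Proof. by apply/funext => h; rewrite /= -shift_pairl. Qed.

Lemma D_slicer (Z : normedModType R) (H : V * W -> Z) a u w :
  'D_w (fun u => H (a, u)) u = 'D_(0, w) H (a, u).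
Proof. by rewrite /derive quotient_slicer. Qed.

Lemma D_slicel (Z : normedModType R) (H : V * W -> Z) b u v :
  'D_v (fun u => H (u, b)) u = 'D_(v, 0) H (u, b).
Proof. by rewrite /derive quotient_slicel. Qed.

Lemma derivable_slicer (Z : normedModType R) (H : V * W -> Z) a u w :
  derivable H (a, u) (0, w) -> derivable (fun u => H (a, u)) u w.
Proof. by rewrite /derivable quotient_slicer. Qed.

Lemma derivable_slicel (Z : normedModType R) (H : V * W -> Z) b u v :
  derivable H (u, b) (v, 0) -> derivable (fun u => H (u, b)) u v.
Proof. by rewrite /derivable quotient_slicel. Qed.

Lemma pairr_continuous (a : V) : continuous (fun u : W => (a, u)).
Proof.
move=> u; apply/continuous_epsP => e e0; exists e => // v vu.
by rewrite prod_normE /= subrr normr0 ge_max (ltW e0) ltW.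
Qed.

Lemma pairl_continuous (b : W) : continuous (fun u : V => (u, b)).
Proof.
move=> u; apply/continuous_epsP => e e0; exists e => // v vu.
by rewrite prod_normE /= subrr normr0 ge_max (ltW e0) ltW.
Qed.

Lemma Ck_slicer (Z : normedModType R) k (H : V * W -> Z) (A : set (V * W)) a :
  Ck k H A -> Ck k (fun u => H (a, u)) [set u | A (a, u)].
Proof.
have cont (G : V * W -> Z) u : {for (a, u), continuous G} ->
    {for u, continuous (fun u => G (a, u))}.
  by move=> cG; apply: (@continuous_comp _ _ _ (fun u : W => (a, u)) G) cG;
    exact: pairr_continuous.
elim: k H => [|k IH] H [cH DH]; first by split=> // u /cH/cont.
split=> [u /cH/cont//|w]; have [dH CH] := DH (0, w); split=> [u /dH|].
  exact: derivable_slicer.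
have -> : 'D_w (fun u => H (a, u)) = (fun u => 'D_(0, w) H (a, u)).
  by apply: funext => u; exact: D_slicer.
exact: (IH _ CH).
Qed.

Lemma Ck_slicel (Z : normedModType R) k (H : V * W -> Z) (A : set (V * W)) b :
  Ck k H A -> Ck k (fun u => H (u, b)) [set u | A (u, b)].
Proof.
have cont (G : V * W -> Z) u : {for (u, b), continuous G} ->
    {for u, continuous (fun u => G (u, b))}.
  by move=> cG; apply: (@continuous_comp _ _ _ (fun u : V => (u, b)) G) cG;
    exact: pairl_continuous.
elim: k H => [|k IH] H [cH DH]; first by split=> // u /cH/cont.
split=> [u /cH/cont//|v]; have [dH CH] := DH (v, 0); split=> [u /dH|].
  exact: derivable_slicel.
have -> : 'D_v (fun u => H (u, b)) = (fun u => 'D_(v, 0) H (u, b)).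
  by apply: funext => u; exact: D_slicel.
exact: (IH _ CH).
Qed.

Lemma open_slicer (A : set (V * W)) a : open A -> open [set u | A (a, u)].
Proof.
by move=> oA; apply: (@open_comp _ _ (fun u : W => (a, u)) A) => // u _;
  exact: pairr_continuous.
Qed.

Lemma open_slicel (A : set (V * W)) b : open A -> open [set u | A (u, b)].
Proof.
by move=> oA; apply: (@open_comp _ _ (fun u : V => (u, b)) A) => // u _;
  exact: pairl_continuous.
Qed.

End Slices.

Section Joint.
Context (R : realType) (m n : nat).
Context (Mx : riemannianManifold R m) (My : riemannianManifold R n).
Implicit Types (h f g : Mx -> My -> R) (x : Mx) (y : My).

Definition joint h x y (u : 'rV[R]_m * 'rV[R]_n) : R :=
  h (ichart x u.1) (ichart y u.2).

Lemma joint_y h x y : h x \o ichart y = (fun u => joint h x y (chart x x, u)).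
Proof. by apply/funext => u; rewrite /joint /= chartK//; exact: dom_refl. Qed.

Lemma findim_xy : findim ('rV[R]_m * 'rV[R]_n)%type.
Proof. by apply: findim_prod; exact: findim_rV. Qed.

Variables (h : Mx -> My -> R) (x : Mx) (y : My) (A : set ('rV[R]_m * 'rV[R]_n)).
Hypotheses (oA : open A) (Axy : A (chart x x, chart y y)).

Lemma section_y_Ck k : Ck k (joint h x y) A -> exists B : set 'rV[R]_n,
  [/\ open B, B (chart y y) & Ck k (h x \o ichart y) B].
Proof.
move=> C; exists [set u | A (chart x x, u)]; split=> //; first exact: open_slicer.
by rewrite joint_y; exact: Ck_slicer.
Qed.

Lemma gradx_joint u z : Ck 1 (joint h x y) A -> A (chart x x, u) ->
  inner x (gradx h x (ichart y u)) z = 'D_(z, 0) (joint h x y) (chart x x, u).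
Proof.
move=> C Au; rewrite -D_slicel /gradx grad_inner.
  by congr ('D_z _ _); apply/funext => v; rewrite /joint /=.
have := Ck_slicel u C.
move=> /(C1_differentiable (findim_rV R m) (open_slicel u oA)); exact.
Qed.

Lemma grady_joint w : Ck 1 (joint h x y) A ->
  inner y (grady h x y) w = 'D_(0, w) (joint h x y) (chart x x, chart y y).
Proof.
move=> C; rewrite -D_slicer -joint_y; apply: grad_inner; rewrite joint_y.
exact: (C1_differentiable (findim_rV R n) (open_slicer _ oA) (Ck_slicer (chart x x) C)).
Qed.

(** The point [x] does not move, so its metric is a constant matrix and no Christoffel symbol
    enters: the cross derivative is the plain mixed derivative in charts. *)
Lemma crossxy_joint v z : Ck 2 (joint h x y) A ->
  inner x (crossxy h x y v) z =
  'D_(0, v) ('D_(z, 0) (joint h x y)) (chart x x, chart y y).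
Proof.
move=> C2; have C1 : Ck 1 (joint h x y) A by exact: Ck_le C2.
set uy := chart y y; pose X u := gradx h x (ichart y u).
have nA : \forall u \near uy, A (chart x x, u).
  by apply: open_nbhs_nbhs; split=> //; exact: open_slicer.
pose r u : 'rV[R]_m := \row_i 'D_(delta_mx 0 i, 0) (joint h x y) (chart x x, u).
have rX : \forall u \near uy, r u *m invmx (metric x) = X u.
  apply: filterS nA => u Au; apply: (inner_inj (z := x)) => w.
  rewrite (gradx_joint _ C1 Au) innerE bform_mul mulVmx ?metric_unit//.
  have dj : differentiable (fun v => joint h x y (v, u)) (chart x x).
    exact: (C1_differentiable (findim_rV R m) (open_slicel u oA) (Ck_slicel u C1)).
  rewrite -D_slicel (D_dvec _ dj); congr bform; apply/rowP => i.
  by rewrite !mxE D_slicel.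
have dX : is_derive uy v X (crossxy h x y v).
  apply: derivableP; apply: (near_eq_dvbl rX).
  have dr : derivable r uy v.
    apply/derivable_mxP => i j.
    have H : derivable (fun u => 'D_(delta_mx 0 j, 0) (joint h x y) (chart x x, u)) uy v.
      have d := @Ck_derivable _ _ _ 0 _ _ (Ck_D (delta_mx 0 j, 0) C2)
        (chart x x, chart y y) (0, v) Axy.
      exact: derivable_slicer d.
    rewrite (_ : (fun u => r u i j) =
      (fun u => 'D_(delta_mx 0 j, 0) (joint h x y) (chart x x, u)))//.
    by apply/funext => u; rewrite mxE.
  by have [] := is_derive_mulmx (derivableP dr) (is_derive_cst (invmx (metric x)) uy v).
have [_] := is_derive_form dX (is_derive_cst (metric x) uy v) (is_derive_cst z uy v).
rewrite [X in _ + X](_ : _ = 0); last by rewrite bform0r.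
rewrite [X in _ + X + _](_ : _ = 0); last first.
  by rewrite bform.unlock mulmx0 mul0mx mxE.
rewrite !addr0 -innerE => <-; rewrite -D_slicer.
apply: near_eq_D; apply: filterS nA => u Au.
by rewrite -innerE -(gradx_joint _ C1 Au).
Qed.

Lemma crossxy_linear : Ck 2 (joint h x y) A -> linear (crossxy h x y).
Proof.
move=> C2 k v w; apply: (inner_inj (z := x)) => z.
apply: (eq_trans (crossxy_joint (k *: v + w) z C2)).
apply: (eq_trans _ (esym (innerDl x (k *: crossxy h x y v) (crossxy h x y w) z))).
have aux (a b c d e : R) : e = k * a -> a = c -> b = d -> k * c + d = e + b.
  by move=> -> -> ->.
apply: (eq_trans _ (aux _ _ _ _ _ (innerZl x k (crossxy h x y v) z)
  (crossxy_joint v z C2) (crossxy_joint w z C2))).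
have dD : differentiable ('D_(z, 0) (joint h x y)) (chart x x, chart y y).
  exact: (C1_differentiable findim_xy oA (Ck_D (z, 0) C2)).
have -> : (0, k *: v + w) = k *: (0 : 'rV[R]_m, v) + (0, w) by rewrite shift_pairr.
exact: (D_add _ _ k dD).
Qed.

End Joint.

(** * Regularity of the hypergradient *)

Lemma D_global_min (R : realType) (V : normedModType R) (h : V -> R) (a w : V) :
  differentiable h a -> (forall v, h a <= h v) -> 'D_w h a = 0.
Proof.
move=> dh min.
have ge0 v : 0 <= 'D_v h a.
  apply/ler_addgt0Pr => e e0.
  have /is_derive_epsP/(_ _ e0)[d d0 Hd] := derivableP (diff_derivable (v := v) dh).
  have d20 : 0 < d / 2 by rewrite divr_gt0.
  have dd : `|d / 2| < d by rewrite gtr0_norm// ltr_pdivrMr// mulr_natr mulr2n ltrDl.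
  have := Hd _ dd; rewrite (gtr0_norm d20) /GRing.scale /= => /ler_normlP[_].
  have := min (a + (d / 2) *: v); move: (h (a + _ *: v)) (h a) ('D_v h a) => X Y Z XY Hs.
  by rewrite -(pmulr_rge0 _ d20) mulrDr; lra.
apply/eqP; rewrite eq_le ge0 andbT.
have := ge0 (- w); rewrite (deriveE (- w) dh) linearN /= -deriveE//.
by rewrite oppr_ge0.
Qed.

Lemma subrACA (V : zmodType) (a b c d : V) : a - b - (c - d) = a - c - (b - d).
Proof. by rewrite !opprD !opprK addrACA. Qed.

Lemma sqrD_le (R : realDomainType) (a b : R) :
  (a + b) ^+ 2 <= 2 * a ^+ 2 + 2 * b ^+ 2.
Proof.
by rewrite -subr_ge0 (_ : _ - _ = (a - b) ^+ 2) ?sqr_ge0//; ring.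
Qed.

Section Bilevel.
Context (R : realType) (m n : nat).
Context (Mx : riemannianManifold R m) (My : riemannianManifold R n).
Variables (Ux : set Mx) (Uy : set My) (f g : Mx -> My -> R) (ystar : Mx -> My).
Variables (mu lf Lf Lg rho : R).
Hypothesis hMy : geodesically_complete My.
Hypotheses (hUx : geodesically_convex Ux) (hUy : geodesically_convex Uy).
Hypothesis hUyreg : Uy `<=` closure (interior Uy).
Hypothesis hystar : forall x y, g x (ystar x) <= g x y.
Hypothesis hystarU : forall x, Ux x -> Uy (ystar x).
Hypotheses (hmu : 0 < mu) (hlf : 0 < lf) (hLf : 0 < Lf) (hLg : 0 < Lg)
  (hrho : 0 < rho).
Hypotheses (hfC1 : Ck_on 1 f Ux Uy) (hgC2 : Ck_on 2 g Ux Uy).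
Hypothesis hgconv : forall x, Ux x -> geodesically_strongly_convex mu Uy (g x).
Hypothesis hflip : lipschitz_fun lf f Ux Uy.
Hypothesis hfgrad : lipschitz_gradients Lf f Ux Uy.
Hypothesis hggrad : lipschitz_gradients Lg g Ux Uy.
Hypothesis hghess : lipschitz_hessy rho g Ux Uy.
Hypothesis hgxy : lipschitz_crossxy rho g Ux Uy.

Lemma section_y x : Ux x -> forall y, Uy y -> exists B, [/\ open B,
  B (chart y y) & Ck 2 (g x \o ichart y) B].
Proof.
move=> Ux_x y Uy_y; have [A [oA Axy C2]] := hgC2 Ux_x Uy_y.
exact: (section_y_Ck oA Axy C2).
Qed.

Lemma grady_ystar x : Ux x -> grady g x (ystar x) = 0.
Proof.
move=> Ux_x; set y := ystar x; have Uy_y : Uy y by exact: hystarU.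
have [B [oB By C2]] := section_y Ux_x Uy_y.
have dg := Ck_differentiable (findim_rV R n) oB C2 By.
apply: (inner_inj (z := y)) => w; rewrite inner0l /grady (grad_inner _ dg).
apply: D_global_min dg _ => u; rewrite /= chartK; last exact: dom_refl.
exact: hystar.
Qed.

(** Strong monotonicity along the geodesic from [y] to [ystar x], where the gradient vanishes. *)
Lemma dist_ystar x y : Ux x -> Uy y ->
  mu * dist y (ystar x) <= tnorm y (grady g x y).
Proof.
move=> Ux_x Uy_y; have Uys := hystarU Ux_x.
have [c mc cU] := minimizing_exists hUy Uy_y Uys.
have [gc c0 c1 cd] := mc; have hC := section_y Ux_x.
have D (s : R) : 0 <= s <= 1 -> is_derive s 1 (g x \o c)
    (inner (c s) (grad (g x) (c s)) (velocity c s)).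
  by move=> s01; apply: (derive_on_curve hC gc.1); exact: cU.
have D0 : is_derive (0 : R) 1 (g x \o c) (inner (c 0) (grad (g x) (c 0)) (velocity c 0)).
  by apply: D; rewrite lexx ler01.
have D1 : is_derive (1 : R) 1 (g x \o c) (inner (c 1) (grad (g x) (c 1)) (velocity c 1)).
  by apply: D; rewrite lexx ler01.
have := strong_monotone hmu (hgconv Ux_x) gc cU D0 D1.
rewrite c0 c1 -[grad (g x) (ystar x)]/(grady g x (ystar x)) (grady_ystar Ux_x).
rewrite inner0l sub0r -innerNl => H.
have l0 : 0 <= tnorm y (velocity c 0) := tnorm_ge0 _ _.
rewrite -cd; have [->|l1] := eqVneq (tnorm y (velocity c 0)) 0.
  by rewrite mulr0 tnorm_ge0.
have lp : 0 < tnorm y (velocity c 0) by rewrite lt0r l1 l0.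
rewrite -(ler_pM2r lp) -mulrA -expr2 (le_trans H)// (le_trans (inner_le _ _ _))//.
by rewrite tnormN.
Qed.

(** At [ystar x2] the gradient for [x2] vanishes, so the one for [x1] is at most [Lg * dist x1 x2];
    [dist_ystar] at [x1] turns it into a distance. *)
Lemma ystar_lipschitz x1 x2 : Ux x1 -> Ux x2 ->
  mu * dist (ystar x1) (ystar x2) <= Lg * dist x1 x2.
Proof.
move=> U1 U2; have y1 := hystarU U1; have y2 := hystarU U2.
rewrite (dist_sym hUy y1 y2) (le_trans (dist_ystar U1 y2))//.
have [_ _ _ H] := hggrad; have := H x1 x2 (ystar x2) U1 U2 y2.
by rewrite (grady_ystar U2) subr0.
Qed.

Lemma hessy_linear x y : Ux x -> Uy y -> linear (hessy g x y).
Proof.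
move=> Ux_x Uy_y; have [B [oB By C2]] := section_y Ux_x Uy_y.
exact: (hess_linear oB C2 By).
Qed.

Lemma hessyB x y v w : Ux x -> Uy y ->
  hessy g x y (v - w) = hessy g x y v - hessy g x y w.
Proof.
move=> Ux_x Uy_y; have L := hessy_linear Ux_x Uy_y (-1) w v.
by rewrite -[- w]scaleN1r (addrC v) L scaleN1r addrC.
Qed.

Lemma hessy_tnorm x y v : Ux x -> Uy y ->
  mu * tnorm y v <= tnorm y (hessy g x y v).
Proof.
move=> Ux_x Uy_y.
exact: (hess_tnorm hUyreg hMy hmu (hgconv Ux_x) (section_y Ux_x) v Uy_y).
Qed.

(** Coercivity makes the Hessian injective, hence invertible in finite dimension, so the choice in
    [hessy_inv] is a genuine solution. *)
Lemma hessy_invK x y w : Ux x -> Uy y -> hessy g x y (hessy_inv g x y w) = w.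
Proof.
move=> Ux_x Uy_y; have L := hessy_linear Ux_x Uy_y.
apply: (@xgetPex _ 0 [set v | hessy g x y v = w]).
pose LL : {linear 'rV[R]_n -> 'rV[R]_n} :=
  HB.pack (hessy g x y) (GRing.isLinear.Build R _ _ _ _ L).
have u : lin1_mx LL \in unitmx.
  rewrite -row_free_unit -kermx_eq0; apply/rowV0P => v /sub_kermxP.
  rewrite mul_rV_lin1 /= => v0; have := hessy_tnorm v Ux_x Uy_y.
  rewrite v0 tnorm0 pmulr_rle0// => tv; apply: (inner_eq0 (z := y)).
  have E : tnorm y v = 0 by apply/eqP; rewrite eq_le tv tnorm_ge0.
  by rewrite -tnorm_sqr E expr0n.
exists (w *m invmx (lin1_mx LL)).
exact: (etrans (esym (mul_rV_lin1 LL _)) (mulmxKV u w)).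
Qed.

Lemma grady_f_le x y : Ux x -> Uy y -> tnorm y (grady f x y) <= lf.
Proof.
move=> Ux_x Uy_y; have [A [oA Axy C1]] := hfC1 Ux_x Uy_y.
have [B [oB By C1']] := section_y_Ck oA Axy C1.
have df := Ck_differentiable (findim_rV R n) oB C1' By.
apply: tnorm_le_sqr; first exact: ltW.
rewrite {1}/grady (grad_inner _ df).
apply: (D_lipschitz_le hUyreg hMy _ Uy_y (ltW hlf) oB C1' By).
by move=> y1 y2 U1 U2; exact: (hflip.2 x y1 y2).
Qed.

Lemma crossxy_g_linear x y : Ux x -> Uy y -> linear (crossxy g x y).
Proof.
move=> Ux_x Uy_y; have [A [oA Axy C2]] := hgC2 Ux_x Uy_y.
exact: (crossxy_linear oA Axy C2).
Qed.

Lemma crossxyB x y v w : Ux x -> Uy y ->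
  crossxy g x y (v - w) = crossxy g x y v - crossxy g x y w.
Proof.
move=> Ux_x Uy_y; have L := crossxy_g_linear Ux_x Uy_y (-1) w v.
by rewrite -[- w]scaleN1r (addrC v) L scaleN1r addrC.
Qed.

(** With [z] the image of [v], the function [y' |-> <G_x g(x, y'), z>] is Lipschitz with constant
    [Lg * |z|], and its derivative along [v] is [<z, z>]. *)
Lemma crossxy_le x y v : Ux x -> Uy y ->
  tnorm x (crossxy g x y v) <= Lg * tnorm y v.
Proof.
move=> Ux_x Uy_y; have [A [oA Axy C2]] := hgC2 Ux_x Uy_y.
have C1 : Ck 1 (joint g x y) A by exact: Ck_le C2.
set z := crossxy g x y v.
apply: tnorm_le_sqr; first by rewrite mulr_ge0 ?tnorm_ge0// ltW.
pose h y' := inner x (gradx g x y') z.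
pose B := [set u | A (chart x x, u)].
have oB : open B by exact: open_slicer.
have hE u : B u -> (h \o ichart y) u = 'D_(z, 0) (joint g x y) (chart x x, u).
  by move=> Bu; rewrite /h /= (gradx_joint oA z C1 Bu).
have Ch : Ck 1 (h \o ichart y) B.
  apply: (Ck_eq oB _ (Ck_slicer (chart x x) (Ck_D (z, 0) C2))) => u.
  by rewrite inE => /hE.
have -> : inner x z z = 'D_v (h \o ichart y) (chart y y).
  rewrite {1}/z (crossxy_joint oA Axy v z C2) -D_slicer.
  apply: near_eq_D; have : \forall u \near chart y y, B u.
    by apply: open_nbhs_nbhs.
  by apply: filterS => u /hE.
rewrite mulrAC; have l0 : 0 <= Lg * tnorm x z by rewrite mulr_ge0 ?tnorm_ge0// ltW.
apply: (D_lipschitz_le hUyreg hMy v Uy_y l0 oB Ch Axy).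
move=> y1 y2 U1 U2; rewrite /h -innerBl (le_trans (cauchy_schwarz _ _ _))//.
rewrite -mulrA (mulrC (tnorm x z)) mulrA ler_wpM2r ?tnorm_ge0//.
by have [_ H _ _] := hggrad; exact: H.
Qed.

(** The Lipschitz constant of [G f - A v] for an operator [A] of second derivatives of g: [Lf] comes
    from f, and [rho] acts on a vector of norm at most [lf / mu], the bound of [vstar_le]. *)
Definition kappa : R := Lf + rho * lf / mu.

Lemma kappa_ge0 : 0 <= kappa.
Proof. by rewrite addr_ge0 ?divr_ge0 ?mulr_ge0// ltW. Qed.

Lemma kappaM d : kappa * d = Lf * d + rho * d * (lf / mu).
Proof. by rewrite /kappa; ring. Qed.

Let lerDkappa (A B X Y : R) : A <= Y -> X + (B + A) <= B + (Y + X).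
Proof. by lra. Qed.

Definition vstar x y : 'rV[R]_n := hessy_inv g x y (grady f x y).

Lemma vstarE x y : Ux x -> Uy y -> hessy g x y (vstar x y) = grady f x y.
Proof. by move=> Ux_x Uy_y; exact: hessy_invK. Qed.

Lemma vstar_le x y : Ux x -> Uy y -> tnorm y (vstar x y) <= lf / mu.
Proof.
move=> Ux_x Uy_y; rewrite ler_pdivlMr// mulrC.
by rewrite (le_trans (hessy_tnorm _ Ux_x Uy_y))// vstarE// grady_f_le.
Qed.

(** Solutions of the linear system at different points are compared through residuals: by
    coercivity, the error of an approximate solution is at most its residual divided by [mu]. *)
Lemma residual_y x y1 y2 v : Ux x -> Uy y1 -> Uy y2 -> tnorm y1 v <= lf / mu ->
  tnorm y2 (hessy g x y2 (transport y1 y2 v) - grady f x y2) <=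
  tnorm y1 (hessy g x y1 v - grady f x y1) + kappa * dist y1 y2.
Proof.
move=> Ux_x U1 U2 vl; set P := transport y1 y2.
have d0 := dist_ge0 hUy U1 U2.
have H1 : tnorm y2 (P (hessy g x y1 v) - hessy g x y2 (P v)) <= rho * dist y1 y2 * (lf / mu).
  have := hghess.1 x y1 y2 Ux_x U1 U2 (P v); rewrite /P (transportK hUy v U1 U2).
  rewrite (transport_tnorm hUy v U1 U2) => /le_trans; apply.
  by rewrite ler_wpM2l// mulr_ge0// ltW.
have H2 : tnorm y2 (P (grady f x y1) - grady f x y2) <= Lf * dist y1 y2.
  by have [H _ _ _] := hfgrad; exact: H.
have H3 : tnorm y2 (P (hessy g x y1 v) - P (grady f x y1)) =
    tnorm y1 (hessy g x y1 v - grady f x y1).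
  by rewrite /P -(transportB hUy _ _ U1 U2) (transport_tnorm hUy _ U1 U2).
rewrite (le_trans (tnorm_triangle y2 (P (hessy g x y1 v)) _ _))// tnormBC.
rewrite (le_trans (lerD H1 (tnorm_triangle y2 (P (grady f x y1)) _ _)))// H3.
by rewrite kappaM; exact: lerDkappa.
Qed.

Lemma residual_x x1 x2 y v : Ux x1 -> Ux x2 -> Uy y -> tnorm y v <= lf / mu ->
  tnorm y (hessy g x2 y v - grady f x2 y) <=
  tnorm y (hessy g x1 y v - grady f x1 y) + kappa * dist x1 x2.
Proof.
move=> U1 U2 Uy_y vl; have d0 := dist_ge0 hUx U1 U2.
have H1 : tnorm y (hessy g x1 y v - hessy g x2 y v) <= rho * dist x1 x2 * (lf / mu).
  apply: (le_trans (hghess.2 x1 x2 y U1 U2 Uy_y v)).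
  by rewrite ler_wpM2l// mulr_ge0// ltW.
have H2 : tnorm y (grady f x1 y - grady f x2 y) <= Lf * dist x1 x2.
  by have [_ _ _ H] := hfgrad; exact: H.
rewrite (le_trans (tnorm_triangle y (hessy g x1 y v) _ _))// tnormBC.
rewrite (le_trans (lerD H1 (tnorm_triangle y (grady f x1 y) _ _)))//.
by rewrite kappaM; exact: lerDkappa.
Qed.

(** [v2] is left arbitrary: it will be the exact solution at the other point for the Lipschitz
    bound, and the computed vector for the error bound. *)
Lemma approx_y x y1 y2 v1 v2 : Ux x -> Uy y1 -> Uy y2 -> tnorm y1 v1 <= lf / mu ->
  tnorm x (approx_hypergradient f g x y1 v1 - approx_hypergradient f g x y2 v2) <=
  kappa * dist y1 y2 + Lg * tnorm y2 (transport y1 y2 v1 - v2).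
Proof.
move=> Ux_x U1 U2 vl; have d0 := dist_ge0 hUy U1 U2; set P := transport y1 y2.
have H1 : tnorm x (crossxy g x y1 v1 - crossxy g x y2 (P v1)) <= rho * dist y1 y2 * (lf / mu).
  apply: (le_trans (hgxy.2 x y1 y2 Ux_x U1 U2 v1)).
  by rewrite ler_wpM2l// mulr_ge0// ltW.
have H2 : tnorm x (gradx f x y1 - gradx f x y2) <= Lf * dist y1 y2.
  by have [_ H _ _] := hfgrad; exact: H.
have H3 : tnorm x (crossxy g x y2 (P v1) - crossxy g x y2 v2) <= Lg * tnorm y2 (P v1 - v2).
  by rewrite -(crossxyB _ _ Ux_x U2) crossxy_le.
rewrite /approx_hypergradient subrACA.
rewrite (le_trans (tnormB _ _ _))//.
rewrite (le_trans (lerD H2 (tnorm_triangle x (crossxy g x y2 (P v1)) _ _)))//.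
rewrite kappaM; apply: (le_trans (lerD (lexx _) (lerD H1 H3))).
by rewrite addrA.
Qed.

Lemma approx_x x1 x2 y v : Ux x1 -> Ux x2 -> Uy y -> tnorm y v <= lf / mu ->
  tnorm x2 (transport x1 x2 (approx_hypergradient f g x1 y v) -
    approx_hypergradient f g x2 y v) <= kappa * dist x1 x2.
Proof.
move=> U1 U2 Uy_y vl; have d0 := dist_ge0 hUx U1 U2; set P := transport x1 x2.
have H1 : tnorm x2 (P (crossxy g x1 y v) - crossxy g x2 y v) <= rho * dist x1 x2 * (lf / mu).
  apply: (le_trans (hgxy.1 x1 x2 y U1 U2 Uy_y v)).
  by rewrite ler_wpM2l// mulr_ge0// ltW.
have H2 : tnorm x2 (P (gradx f x1 y) - gradx f x2 y) <= Lf * dist x1 x2.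
  by have [_ _ H _] := hfgrad; exact: H.
rewrite /approx_hypergradient /P (transportB hUx _ _ U1 U2) -/P.
rewrite subrACA.
rewrite (le_trans (tnormB _ _ _))//.
by rewrite kappaM; exact: lerD.
Qed.

Lemma hypergradientE x : hypergradient f g ystar x =
  approx_hypergradient f g x (ystar x) (vstar x (ystar x)).
Proof. by []. Qed.

(** One passes from [(x1, y1)] to [(x2, y2)] by moving x first, with [y1] and [v1] kept, and then y,
    because each Lipschitz hypothesis moves one variable at a time. *)
Lemma hypergradient_lipschitz x1 x2 : Ux x1 -> Ux x2 ->
  tnorm x2 (transport x1 x2 (hypergradient f g ystar x1) - hypergradient f g ystar x2)
  <= const_LF mu lf Lf Lg rho * dist x1 x2.
Proof.
move=> U1 U2; rewrite !hypergradientE.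
set y1 := ystar x1; set y2 := ystar x2; set v1 := vstar x1 y1; set v2 := vstar x2 y2.
have Y1 : Uy y1 by exact: hystarU. have Y2 : Uy y2 by exact: hystarU.
have vl : tnorm y1 v1 <= lf / mu by exact: vstar_le.
have dx := dist_ge0 hUx U1 U2; have dy := dist_ge0 hUy Y1 Y2.
have k0 := kappa_ge0.
have yl : dist y1 y2 <= Lg / mu * dist x1 x2.
  by rewrite mulrAC ler_pdivlMr// mulrC; exact: ystar_lipschitz.
(* [v1] solves the system at [(x1, y1)] exactly, so its residual at [(x2, y2)] stems from the two
   moves alone. *)
have rx := residual_x U1 U2 Y1 vl; rewrite vstarE// subrr tnorm0 add0r in rx.
have ry := le_trans (residual_y U2 Y1 Y2 vl) (lerD rx (lexx _)).
have vv : tnorm y2 (transport y1 y2 v1 - v2) <= kappa * (dist x1 x2 + dist y1 y2) / mu.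
  rewrite ler_pdivlMr// mulrC (le_trans (hessy_tnorm _ U2 Y2))//.
  by rewrite hessyB// [hessy g x2 y2 v2]vstarE// mulrDr.
have T := tnorm_triangle x2 (approx_hypergradient f g x2 y1 v1)
  (transport x1 x2 (approx_hypergradient f g x1 y1 v1))
  (approx_hypergradient f g x2 y2 v2).
apply: (le_trans T); apply: (le_trans (lerD (approx_x U1 U2 Y1 vl) (approx_y v2 U2 Y1 Y2 vl))).
(* The two factors [1 + q] have different origins: the distance between the minimizers, and the
   error in v passed on by the cross derivative. *)
set q := Lg / mu in yl; have q0 : 0 <= q by rewrite divr_ge0// ltW.
have S : dist x1 x2 + dist y1 y2 <= (1 + q) * dist x1 x2 by rewrite mulrDl mul1r lerD2l.
have vv' : Lg * tnorm y2 (transport y1 y2 v1 - v2) <=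
    q * (kappa * (dist x1 x2 + dist y1 y2)).
  rewrite (_ : q * _ = Lg * (kappa * (dist x1 x2 + dist y1 y2) / mu)).
    by rewrite ler_wpM2l// ltW.
  by rewrite /q; ring.
rewrite /const_LF -/kappa -/q.
apply: (@le_trans _ _ (kappa * (1 + q) * (dist x1 x2 + dist y1 y2))).
  apply: (le_trans (lerD (lexx _) (lerD (lexx _) vv'))).
  rewrite le_eqVlt; apply/orP; left; apply/eqP.
  have aux (k r d e : R) : k * d + (k * e + r * (k * (d + e))) =
    k * (1 + r) * (d + e) by ring.
  exact: aux.
by rewrite expr2 -!mulrA ler_wpM2l// ler_wpM2l// addr_ge0.
Qed.

(* The distance to [ystar x] and to the solution of the linear system are both
   controlled by the residuals, thanks to the coercivity of the Hessian. *)
Lemma approx_error x y v (e : R) : Ux x -> Uy y ->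
  tnorm y (grady g x y) ^+ 2 <= e -> tnorm y (gradR f g x y v) ^+ 2 <= e ->
  tnorm x (hypergradient f g ystar x - approx_hypergradient f g x y v) ^+ 2 <=
  2 * const_Lbar mu lf Lf Lg rho ^+ 2 / mu ^+ 2 * e.
Proof.
move=> Ux_x Uy_y ge re; have e0 : 0 <= e by apply: le_trans ge; exact: sqr_ge0.
set s := Num.sqrt e; have s0 : 0 <= s by exact: sqrtr_ge0.
have ss : s ^+ 2 = e by exact: sqr_sqrtr.
have gs : tnorm y (grady g x y) <= s.
  by rewrite -(ler_pXn2r (ltn0Sn 1)) ?nnegrE ?tnorm_ge0// ss.
have rs : tnorm y (gradR f g x y v) <= s.
  by rewrite -(ler_pXn2r (ltn0Sn 1)) ?nnegrE ?tnorm_ge0// ss.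
set ys := ystar x; have Ys : Uy ys by exact: hystarU.
set vs := vstar x ys; have vl : tnorm ys vs <= lf / mu by exact: vstar_le.
have dl : dist ys y <= s / mu.
  rewrite ler_pdivlMr// mulrC (dist_sym hUy Ys Uy_y).
  exact: le_trans (dist_ystar Ux_x Uy_y) gs.
have d0 := dist_ge0 hUy Ys Uy_y; have k0 := kappa_ge0.
have ry := residual_y Ux_x Ys Uy_y vl; rewrite vstarE// subrr tnorm0 add0r in ry.
have vv : tnorm y (transport ys y vs - v) <= (kappa * (s / mu) + s) / mu.
  rewrite ler_pdivlMr// mulrC (le_trans (hessy_tnorm _ Ux_x Uy_y))// hessyB//.
  rewrite (le_trans (tnorm_triangle y (grady f x y) _ _))//.
  apply: lerD; last by rewrite tnormBC.
  by apply: (le_trans ry); rewrite ler_wpM2l.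
have H := approx_y v Ux_x Ys Uy_y vl; rewrite -hypergradientE in H.
(* [const_L1] equals [kappa * (1 + Lg / mu)]: the displacement of y acts directly and through v. The
   additional [Lg] is due to the residual of v itself. *)
have B : tnorm x (hypergradient f g ystar x - approx_hypergradient f g x y v) <=
    (const_L1 mu lf Lf Lg rho + Lg) * (s / mu).
  apply: (le_trans H).
  apply: (@le_trans _ _ (kappa * (s / mu) + Lg * ((kappa * (s / mu) + s) / mu))).
    by rewrite lerD// ler_wpM2l// ltW.
  rewrite /const_L1 /kappa le_eqVlt; apply/orP; left; apply/eqP; field.
  exact: lt0r_neq0.
have L10 : 0 <= const_L1 mu lf Lf Lg rho.
  have i0 : 0 <= mu^-1 by rewrite invr_ge0 ltW.
  have := (ltW hlf, ltW hLf, ltW hLg, ltW hrho) => -[[[a1 a2] a3] a4].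
  by rewrite /const_L1; do ?[apply: addr_ge0|apply: mulr_ge0]; rewrite // invr_ge0 sqr_ge0.
have Lb0 : 0 <= const_Lbar mu lf Lf Lg rho.
  by rewrite /const_Lbar le_max; apply/orP; left; exact: mulr_ge0 (sqrtr_ge0 _) L10.
have s2 : Num.sqrt 2 ^+ 2 = 2 :> R by rewrite sqr_sqrtr.
(* The factor [sqrt 2] in [const_Lbar] absorbs the 2 of [(a + b)^2 <= 2 a^2 + 2 b^2]. *)
have b1 : 2 * const_L1 mu lf Lf Lg rho ^+ 2 <= const_Lbar mu lf Lf Lg rho ^+ 2.
  rewrite -{1}s2 -exprMn ler_pXn2r ?nnegrE//; last exact: mulr_ge0 (sqrtr_ge0 _) L10.
  by rewrite /const_Lbar le_max lexx.
have b2 : 2 * Lg ^+ 2 <= const_Lbar mu lf Lf Lg rho ^+ 2.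
  rewrite -{1}s2 -exprMn ler_pXn2r ?nnegrE//; last exact: mulr_ge0 (sqrtr_ge0 _) (ltW hLg).
  by rewrite /const_Lbar le_max lexx orbT.
apply: (@le_trans _ _ (((const_L1 mu lf Lf Lg rho + Lg) * (s / mu)) ^+ 2)).
  by apply: (le_trans (lerXn2r 2 _ _ B)) => //; rewrite nnegrE ?tnorm_ge0//; exact: le_trans (tnorm_ge0 _ _) B.
rewrite exprMn expr_div_n ss (_ : 2 * _ ^+ 2 / _ * e =
  (const_Lbar mu lf Lf Lg rho ^+ 2 + const_Lbar mu lf Lf Lg rho ^+ 2) * (e / mu ^+ 2)).
  rewrite ler_wpM2r ?divr_ge0 ?sqr_ge0// (le_trans _ (lerD b1 b2))//.
  exact: sqrD_le.
by field; exact: lt0r_neq0.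
Qed.

(* Since [Phi] is critical in its second variable, the value at [ystar] along
   a curve has the derivative of [Phi] in the first variable. *)
Lemma envelope (V W : normedModType R) (Phi : V * W -> R) (u0 : V) (y0 : W) :
  differentiable Phi (u0, y0) -> (forall w, 'D_(0, w) Phi (u0, y0) = 0) ->
  forall e : R, 0 < e -> exists2 d : R, 0 < d & forall k l,
    `|k| < d -> `|l| < d ->
    `|Phi (u0 + k, y0 + l) - Phi (u0 + k, y0)| <= e * (`|k| + `|l|).
Proof.
move=> dPhi crit e e0; have e20 : 0 < e / 2 by rewrite divr_gt0.
have [d d0 Hd] := diff_eps dPhi e20; exists d => // k l kd ld.
have H1 : `|Phi ((u0, y0) + (k, l)) - Phi (u0, y0) - 'D_(k, l) Phi (u0, y0)|
    <= e / 2 * (`|k| + `|l|).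
  apply: (le_trans (Hd (k, l) _)); rewrite prod_normE /= ?gt_max ?kd//.
  by apply: ler_wpM2l (ltW e20) _ _ _; rewrite ge_max lerDl lerDr !normr_ge0.
have H2 : `|Phi ((u0, y0) + (k, 0)) - Phi (u0, y0) - 'D_(k, 0) Phi (u0, y0)|
    <= e / 2 * (`|k| + `|l|).
  apply: (le_trans (Hd (k, 0) _)); rewrite prod_normE /= normr0 ?gt_max ?kd//.
  by apply: ler_wpM2l (ltW e20) _ _ _; rewrite ge_max lerDl normr_ge0 addr_ge0.
move: H1 H2.
have -> : 'D_(k, l) Phi (u0, y0) = 'D_(k, 0) Phi (u0, y0).
  have -> : (k, l) = 1 *: (0 : V, l) + (k, 0).
    by congr pair; rewrite /= ?scaler0 ?add0r ?scale1r ?addr0.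
  by rewrite (D_add _ _ _ dPhi) crit mulr0 add0r.
have -> : (u0, y0) + (k, l) = (u0 + k, y0 + l) by [].
have -> : (u0, y0) + (k, 0) = (u0 + k, y0).
  by congr pair; rewrite /= addr0.
have aux (X Y Z K b : R) : `|X - Z - K| <= e / 2 * b -> `|Y - Z - K| <= e / 2 * b ->
    `|X - Y| <= e * b.
  by rewrite !ler_norml => /andP[a1 a2] /andP[a3 a4]; apply/andP; split; lra.
exact: aux.
Qed.

(** The Lipschitz bound on [ystar] is a bound on distances; [short_geodesic] converts it to
    coordinates in one chart, valid for all nearby points. *)
Lemma ystar_near p : Ux p -> exists r K : R, [/\ 0 < r, 0 <= K &
  forall z, Ux z -> K * dist p z < r -> dom (ystar p) (ystar z) /\
    `|chart (ystar p) (ystar z) - chart (ystar p) (ystar p)| <= K * dist p z].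
Proof.
move=> Up; set q := ystar p; have Uq : Uy q by exact: hystarU.
have [r [C sc]] := chart_scale_exists q; have [r0 C0 _ _] := sc.
exists r, (C * (Lg / mu)); split=> //.
  by rewrite mulr_ge0 ?divr_ge0 ?(ltW hLg)// ltW.
move=> z Uz Kr; have Uyz : Uy (ystar z) by exact: hystarU.
have dl : C * dist q (ystar z) <= C * (Lg / mu) * dist p z.
  rewrite -mulrA ler_wpM2l ?(ltW C0)// mulrAC ler_pdivlMr// mulrC.
  exact: ystar_lipschitz.
have [c [gc c0 c1 cd] _] := minimizing_exists hUy Uq Uyz.
have lr : C * tnorm q (velocity c 0) < r by rewrite cd (le_lt_trans dl).
have s01 : 0 <= (1 : R) <= 1 by rewrite ler01 lexx.
have [] := short_geodesic sc gc c0 lr s01; rewrite c1 mulr1 cd => qz H.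
by split=> //; exact: le_trans H dl.
Qed.

Lemma objective_derive c s : geodesic c -> (forall t, 0 <= t <= 1 -> Ux (c t)) ->
  0 <= s <= 1 -> forall e : R, 0 < e -> exists2 d : R, 0 < d &
  forall t, 0 <= t <= 1 -> `|t - s| < d ->
    `|upper_objective f ystar (c t) - upper_objective f ystar (c s) -
      (t - s) * inner (c s) (hypergradient f g ystar (c s)) (velocity c s)|
    <= e * `|t - s|.
Proof.
move=> gc cU s01; set p := c s; set q := ystar p; set a := velocity c s.
have Up : Ux p by exact: cU. have Uq : Uy q by exact: hystarU.
have pp := dom_refl p; have qq := dom_refl q.
set vs := vstar p q; set w0 := (chart p p, chart q q).
have [A [oA Aw Cg]] := hgC2 Up Uq; have [A' [oA' Aw' Cf]] := hfC1 Up Uq.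
pose G := joint g p q; have {}Cg : Ck 2 G A := Cg.
pose H := joint f p q; have {}Cf : Ck 1 H A' := Cf.
have Cg1 : Ck 1 G A by exact: Ck_le Cg.
pose D := 'D_(0, vs) G; have CD : Ck 1 D A by exact: Ck_D.
have dH := C1_differentiable (@findim_xy R m n) oA' Cf Aw'.
have dD := C1_differentiable (@findim_xy R m n) oA CD Aw.
(* [vs] is frozen in the coordinates of the chart at [q], so [D] is the derivative of g in a
   constant direction and is still C^1. *)
pose Phi w := H w - D w.
have dPhi : differentiable Phi w0 by exact: differentiableB.
have DPhi w : 'D_w Phi w0 = 'D_w H w0 - 'D_w D w0.
  by apply: (@deriveB _ _ _ H D); exact: diff_derivable.
have [B [oB Bq CB]] := section_y Up Uq.
(* d_y g vanishes at [ystar z] also when read in the fixed charts of [p] and [q], so [Phi] takes the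
   value of the upper objective there. *)
have D0 z y : Ux z -> dom p z -> dom q (ystar z) -> A (chart p z, chart q (ystar z)) ->
    y = ystar z -> forall w, 'D_(0, w) G (chart p z, chart q y) = 0.
  move=> Uz pz qz Az -> w; rewrite -D_slicer; apply: D_global_min.
    exact: (C1_differentiable (findim_rV R n) (open_slicer _ oA) (Ck_slicer _ Cg1)).
  by move=> u; rewrite /G /joint /= chartK// chartK//; exact: hystar.
have crit w : 'D_(0, w) Phi w0 = 0.
  have E1 : 'D_(0, w) D w0 = 'D_w ('D_vs (fun u => G (chart p p, u))) (chart q q).
    rewrite -D_slicer (_ : (fun u => D (chart p p, u)) = 'D_vs (fun u => G (chart p p, u)))//.
    by apply/funext => u; rewrite /D D_slicer.
  (* Where d_y g vanishes, the Christoffel part of the Hessian drops out, and criticality of [Phi]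
     becomes the equation defining [vs]. *)
  have E2 : 'D_(chr q (chart q q) w vs) (g p \o ichart q) (chart q q) = 0.
    by rewrite joint_y; apply: (eq_trans (D_slicer _ _ _ _)); exact: D0.
  have E3 : 'D_(0, w) H w0 = inner q (hessy g p q vs) w.
    by rewrite (vstarE Up Uq) (grady_joint oA' Aw' w Cf).
  have E4 : inner q (hessy g p q vs) w = 'D_w ('D_vs (g p \o ichart q)) (chart q q) - 0.
    have aux (b1 b2 : R) : b2 = 0 -> b1 - b2 = b1 - 0 by move=> ->.
    apply: (eq_trans (hess_inner vs w oB CB Bq)).
    by apply: (eq_trans (quad_sym vs w oB CB qq Bq)); exact: aux E2.
  have aux (a1 a2 a3 a4 : R) : a1 = a3 -> a3 = a4 - 0 -> a2 = a4 -> a1 - a2 = 0.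
    by move=> -> -> ->; rewrite subr0 subrr.
  apply: (eq_trans (DPhi (0, w))); apply: (aux _ _ _ _ E3 E4).
  by rewrite (joint_y g p q); exact: E1.
(* Schwarz's theorem turns the x-derivative of [D] into the cross derivative that enters the
   hypergradient. *)
have DPhia : 'D_(a, 0) Phi w0 = inner p (hypergradient f g ystar p) a.
  have E1 : 'D_(a, 0) H w0 = inner p (gradx f p q) a.
    by have := gradx_joint oA' a Cf Aw'; rewrite chartK.
  have E2 : 'D_(a, 0) D w0 = inner p (crossxy g p q vs) a.
    apply: (eq_trans (schwarz (0, vs) (a, 0) oA Cg Aw)).
    exact: (esym (crossxy_joint oA Aw vs a Cg)).
  have aux (a1 a2 a3 a4 a5 : R) : a5 = a1 - a2 -> a3 = a1 -> a4 = a2 -> a3 - a4 = a5.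
    by move=> -> -> ->.
  exact: (eq_trans (DPhi (a, 0)) (aux _ _ _ _ _ (innerBl _ _ _ _) E1 E2)).
pose phi u := Phi (u, chart q q).
have dc := curve_derive gc.1 (dom_refl (c s)); rewrite tc_id in dc.
have dphi : is_derive s 1 (phi \o (chart p \o c)) (inner p (hypergradient f g ystar p) a).
  have D1 : differentiable (fun u => H (u, chart q q)) (chart p p).
    exact: (C1_differentiable (findim_rV R m) (open_slicel _ oA') (Ck_slicel _ Cf)).
  have D2 : differentiable (fun u => D (u, chart q q)) (chart p p).
    exact: (C1_differentiable (findim_rV R m) (open_slicel _ oA) (Ck_slicel _ CD)).
  have dp : differentiable phi (chart p p) by exact: differentiableB.
  by rewrite -DPhia -D_slicel; exact: is_derive_comp dp dc.
have V0 : 0 <= tnorm p a := tnorm_ge0 _ _.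
have [r [K [r0 K0 HK]]] := ystar_near Up.
have /is_derive_epsP/(_ _ ltr01)[d1 d10 H1] := dc.
have nd : \forall t \near s, dom p (c t).
  by apply: gc.1.1; apply: open_nbhs_nbhs; split; [exact: dom_open|].
have /nbhs_epsP[d2 d20 H2] := nd.
have nA : nbhs w0 A by apply: open_nbhs_nbhs.
have /nbhs_epsP[dA dA0 HA] := nA.
(* [K1] and [K2] bound, in charts, how fast [c] and its image under [ystar] move away from their
   positions at time [s]. *)
move=> e e0; pose K1 := `|a| + 1; pose K2 := K * tnorm p a; pose N := K1 + K2 + 1.
have K10 : 0 <= K1 by rewrite addr_ge0.
have K20 : 0 <= K2 by rewrite mulr_ge0.
have N0 : 0 < N by rewrite ltr_pwDr// addr_ge0.
have e20 : 0 < e / 2 by rewrite divr_gt0.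
have eN : 0 < e / 2 / N by rewrite divr_gt0.
have [dE dE0 HE] := envelope dPhi crit eN.
have /is_derive_epsP/(_ _ e20)[d5 d50 H5] := dphi.
pose d3 := Num.min r (Num.min dA dE).
have d30 : 0 < d3 by rewrite !lt_min r0 dA0 dE0.
exists (Num.min (Num.min d1 d2) (Num.min d5 (d3 / N))).
  by rewrite !lt_min d10 d20 d50 divr_gt0.
move=> t t01; rewrite !lt_min => /andP[/andP[t1 t2] /andP[t5]].
rewrite ltr_pdivlMr// => t3.
have h0 : 0 <= `|t - s| by [].
have Ut : Ux (c t) by exact: cU.
have le1 : K1 * `|t - s| <= `|t - s| * N.
  by rewrite mulrC ler_wpM2l// /N -addrA lerDl addr_ge0.
have le2 : K2 * `|t - s| <= `|t - s| * N.
  by rewrite mulrC ler_wpM2l// /N addrAC lerDr addr_ge0.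
have u1 : `|chart p (c t) - chart p p| <= K1 * `|t - s|.
  have := H1 _ t1; rewrite /= /GRing.scale /= mulr1 (addrC s) subrK mul1r => Hu.
  rewrite mulrDl mul1r (_ : `|a| * _ = `|(t - s) *: a|); last by rewrite normrZ mulrC.
  apply: (le_trans _ (lerD (lexx _) Hu)); apply: (le_trans _ (ler_normD _ _)).
  by rewrite (addrC (_ *: a)) subrK.
have dK : K * dist p (c t) <= K2 * `|t - s|.
  rewrite /K2 -mulrA ler_wpM2l// [leRHS]mulrC; exact: dist_le_geodesic.
have pt : dom p (c t) by exact: H2.
have [qt y1] : dom q (ystar (c t)) /\ `|chart q (ystar (c t)) - chart q q| <= K2 * `|t - s|.
  have [qt y1] : dom q (ystar (c t)) /\
    `|chart q (ystar (c t)) - chart q q| <= K * dist p (c t).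
    apply: HK => //; apply: (le_lt_trans dK); apply: (le_lt_trans le2).
    by apply: (lt_le_trans t3); rewrite /d3 ge_min lexx.
  by split=> //; exact: le_trans y1 dK.
have u2 : `|chart p (c t) - chart p p| < Num.min dA dE.
  by apply: (le_lt_trans u1); apply: (le_lt_trans le1); apply: (lt_le_trans t3);
    rewrite /d3 ge_min lexx orbT.
have y2 : `|chart q (ystar (c t)) - chart q q| < Num.min dA dE.
  by apply: (le_lt_trans y1); apply: (le_lt_trans le2); apply: (lt_le_trans t3);
    rewrite /d3 ge_min lexx orbT.
move: u2 y2; rewrite !lt_min => /andP[uA uE] /andP[yA yE].
have At : A (chart p (c t), chart q (ystar (c t))).
  by apply: HA; rewrite prod_normE /= gt_max uA.
have Ft : upper_objective f ystar (c t) = Phi (chart p (c t), chart q (ystar (c t))).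
  by rewrite /Phi /D (D0 _ _ Ut pt qt At erefl) subr0 /H /joint /= !chartK.
have Fs : upper_objective f ystar (c s) = Phi (chart p p, chart q q).
  by rewrite /Phi /D (D0 _ _ Up pp qq Aw erefl) subr0 /H /joint /= !chartK.
rewrite Ft Fs.
have E1 := HE _ _ uE yE; rewrite !subrKC in E1.
have E5 := H5 _ t5; rewrite /= /GRing.scale /= mulr1 (addrC s) subrK /phi in E5.
have le3 : e / 2 / N * (`|chart p (c t) - chart p p| +
    `|chart q (ystar (c t)) - chart q q|) <= e / 2 * `|t - s|.
  rewrite -mulrA ler_wpM2l ?(ltW e20)// mulrC ler_pdivrMr//.
  rewrite (le_trans (lerD u1 y1))// -mulrDl mulrC ler_wpM2l// /N lerDl.
  exact: ler01.
have {}E1 := le_trans E1 le3.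
have aux (X Y Z L b : R) : `|X - Y| <= e / 2 * b -> `|Y - Z - L| <= e / 2 * b ->
    `|X - Z - L| <= e * b.
  have -> : e * b = e / 2 * b + e / 2 * b by rewrite -mulrDl -splitr.
  by move=> h1 h2; rewrite (_ : X - Z - L = (X - Y) + (Y - Z - L)) ?(le_trans (ler_normD _ _) (lerD h1 h2))// !addrA subrK.
exact: aux E1 E5.
Qed.

(** As transport is an isometry, the increment of [psi] is the sum of a change of the hypergradient,
    measured by its Lipschitz constant, and a change of the velocity, negligible by
    [geodesic_transport]. *)
Lemma upper_descent c : geodesic c -> (forall t, 0 <= t <= 1 -> Ux (c t)) ->
  upper_objective f ystar (c 1) <= upper_objective f ystar (c 0) +
    inner (c 0) (hypergradient f g ystar (c 0)) (velocity c 0) +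
    const_LF mu lf Lf Lg rho / 2 * tnorm (c 0) (velocity c 0) ^+ 2.
Proof.
move=> gc cU; pose GF := hypergradient f g ystar.
pose phi s := upper_objective f ystar (c s).
pose psi s := inner (c s) (GF (c s)) (velocity c s).
set V := tnorm (c 0) (velocity c 0); have V0 : 0 <= V := tnorm_ge0 _ _.
have VE s : tnorm (c s) (velocity c s) = V by exact: geodesic_speed.
have L0 : 0 <= const_LF mu lf Lf Lg rho.
  by rewrite /const_LF mulr_ge0 ?sqr_ge0//; exact: kappa_ge0.
set L := const_LF _ _ _ _ _ in L0 *.
have A0 : 0 <= L * V ^+ 2 by rewrite mulr_ge0 ?sqr_ge0.
have Hphi s : 0 <= s <= 1 -> forall e, 0 < e -> exists2 d : R, 0 < d &
    forall t, 0 <= t <= 1 -> `|t - s| < d ->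
    `|phi t - phi s - (t - s) * psi s| <= e * `|t - s|.
  by move=> s01; exact: objective_derive.
have Hpsi s : 0 <= s <= 1 -> forall e, 0 < e -> exists2 d : R, 0 < d &
    forall t, 0 <= t <= 1 -> `|t - s| < d ->
    `|psi t - psi s| <= (L * V ^+ 2 + e) * `|t - s|.
  move=> s01 e e0; set B := tnorm (c s) (GF (c s)).
  have B0 : 0 < B + 1 by rewrite ltr_wpDl// tnorm_ge0.
  have eB : 0 < e / (B + 1) by rewrite divr_gt0.
  have [d d0 Hd] := geodesic_transport hUx gc cU s01 eB.
  exists d => // t t01 ts; have Us := cU _ s01; have Ut := cU _ t01.
  have {}Hd := Hd t t01 ts; set P := transport (c s) (c t) in Hd.
  have E1 : `|inner (c t) (GF (c t) - P (GF (c s))) (velocity c t)| <=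
      L * V ^+ 2 * `|t - s|.
    rewrite (le_trans (cauchy_schwarz _ _ _))// VE.
    rewrite (_ : L * _ * _ = L * (`|t - s| * V) * V); last by rewrite expr2; ring.
    rewrite ler_wpM2r// tnormBC (le_trans (hypergradient_lipschitz Us Ut))//.
    by rewrite ler_wpM2l// -(VE s); exact: dist_le_geodesic.
  have E2 : `|inner (c t) (P (GF (c s))) (velocity c t - P (velocity c s))| <=
      e * `|t - s|.
    rewrite (le_trans (cauchy_schwarz _ _ _))// (transport_tnorm hUx _ Us Ut) -/B.
    rewrite tnormBC (le_trans (ler_wpM2l (tnorm_ge0 _ _) Hd))// mulrA ler_wpM2r//.
    by rewrite mulrCA ger_pMr// ler_pdivrMr// mul1r lerDl ler01.
  rewrite mulrDl; apply: (le_trans _ (lerD E1 E2)); apply: (le_trans _ (ler_normD _ _)).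
  rewrite innerBl innerBr /P (transport_inner hUx _ _ Us Ut) /psi.
  rewrite (_ : forall a b d : R, a - b + (b - d) = a - d)//.
  by move=> a b d0'; rewrite addrA subrK.
have := descent_integral A0 Hphi Hpsi; rewrite /phi /psi -/V lerBlDl addrA => H.
rewrite mulrAC; exact: H.
Qed.

Hypothesis hMx : geodesically_complete Mx.

Lemma upper_step x w : step_in Ux x w ->
  upper_objective f ystar (Exp x w) <= upper_objective f ystar x +
    inner x (hypergradient f g ystar x) w +
    const_LF mu lf Lf Lg rho / 2 * tnorm x w ^+ 2.
Proof.
move=> sU; have [c [gc c0 cv]] := hMx x w.
(* [Exp] is a chosen end point: [c'] is a geodesic reaching it, and [step_in] covers every geodesic
   with these initial data. *)
have [c' [gc' c'0 c'v c'1]] : exists c, [/\ geodesic c, c 0 = x, velocity c 0 = w &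
    c 1 = Exp x w].
  by apply: (@xgetPex _ x [set p | exists c, [/\ geodesic c, c 0 = x,
    velocity c 0 = w & c 1 = p]]); exists (c 1), c.
have := upper_descent gc' (sU c' gc' c'0 c'v).
by rewrite c'0 c'v c'1.
Qed.

End Bilevel.

(** * Adaptive step sizes *)

Section AdaGrad.
Context (R : realType) (T : nat) (F G E a : nat -> R) (L delta Fst : R).
Hypotheses (L0 : 0 < L) (a00 : 0 < a 0%N).
Hypothesis G0 : forall t, 0 <= G t.
Hypothesis E0 : forall t, 0 <= E t.
Hypothesis aE : forall t, (t < T)%N -> a t.+1 = Num.sqrt (a t ^+ 2 + E t).
Hypothesis step : forall t, (t < T)%N -> G t / a t.+1 + E t / a t.+1 <=
  2 * (F t - F t.+1) + L * E t / a t.+1 ^+ 2 + delta.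
Hypothesis FT : Fst <= F T.

Lemma stepsize_sqr t : (t < T)%N -> a t.+1 ^+ 2 = a t ^+ 2 + E t.
Proof. by move=> tT; rewrite aE// sqr_sqrtr// addr_ge0// sqr_ge0. Qed.

Lemma stepsize_gt0 t : (t <= T)%N -> 0 < a t.
Proof.
elim: t => [//|t IH] tT; rewrite aE// sqrtr_gt0 ltr_pwDl//.
by rewrite exprn_gt0// IH// ltnW.
Qed.

Lemma stepsize_le t : (t < T)%N -> a t <= a t.+1.
Proof.
move=> tT; have p1 := stepsize_gt0 tT; have p0 := stepsize_gt0 (ltnW tT).
rewrite -(ler_pXn2r (ltn0Sn 1)) ?nnegrE ?(ltW p0) ?(ltW p1)//.
by rewrite stepsize_sqr// lerDl.
Qed.

Lemma stepsize_ge0 t : (t <= T)%N -> a 0%N <= a t.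
Proof.
elim: t => [//|t IH] tT; exact: le_trans (IH (ltnW tT)) (stepsize_le tT).
Qed.

Let S t := \sum_(k < t) G k / a k.+1.
Let Ca := Num.max (2 * L) (a 0%N).
Let A0 := a 0%N.

(* The step sizes stay in two regimes: while [a t <= Ca] the quadratic error
   term is bounded by the growth of [a t ^+ 2], afterwards it is absorbed and
   the decrease of F pays for the growth of [a t]. *)
Lemma adagrad_potential t : (t <= T)%N ->
  (a t <= Ca -> S t <= 2 * (F 0%N - F t) + t%:R * delta
     + L * (a t ^+ 2 - A0 ^+ 2) / A0 ^+ 2) /\
  (Ca < a t -> S t + (a t - Ca) / 2 <= 2 * (F 0%N - F t) + t%:R * delta
     + L * Ca ^+ 2 / A0 ^+ 2).
Proof.
have A2 : 0 < A0 ^+ 2 by rewrite exprn_gt0.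
have CaA : A0 <= Ca by rewrite le_max lexx orbT.
have Ca2 : 2 * L <= Ca by rewrite le_max lexx.
elim: t => [_|t IH tT].
  by split=> [_|/(le_lt_trans CaA)]; rewrite ?ltxx// /S big_ord0 !subrr !mul0r mulr0 mulr0 mul0r !addr0.
have [IH1 IH2] := IH (ltnW tT); have st := step tT.
have p1 := stepsize_gt0 tT; have p0 := stepsize_gt0 (ltnW tT).
have E2 := stepsize_sqr tT; have le1 := stepsize_le tT.
have leA : A0 ^+ 2 <= a t.+1 ^+ 2.
  by rewrite ler_pXn2r ?nnegrE ?(ltW p1) ?(ltW a00)//; exact: stepsize_ge0.
have SE : S t.+1 = S t + G t / a t.+1 by rewrite /S big_ord_recr.
have nE : t.+1%:R * delta = t%:R * delta + delta :> R by rewrite mulrSr mulrDl mul1r.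
have Ea : 0 <= E t / a t.+1 by rewrite divr_ge0// ltW.
rewrite SE nE; split=> [le|gt].
  (* [E t] is the growth of [a t ^+ 2], so with the denominator replaced by [A0 ^+ 2] the quadratic
     terms telescope. *)
  have LE : L * E t / a t.+1 ^+ 2 <= L * E t / A0 ^+ 2.
    by rewrite ler_wpM2l ?mulr_ge0 ?(ltW L0)// lef_pV2// posrE exprn_gt0.
  have {}IH1 := IH1 (le_trans le1 le).
  have -> : L * (a t.+1 ^+ 2 - A0 ^+ 2) / A0 ^+ 2 =
      L * (a t ^+ 2 - A0 ^+ 2) / A0 ^+ 2 + L * E t / A0 ^+ 2.
    by rewrite E2 -mulrDl -mulrDr addrAC.
  have aux (s x f0 f1 f2 d nd q1 q2 q3 e : R) : s <= 2 * (f0 - f1) + nd + q1 ->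
      q2 <= q3 -> 0 <= e -> x + e <= 2 * (f1 - f2) + q2 + d ->
      s + x <= 2 * (f0 - f2) + (nd + d) + (q1 + q3) by lra.
  exact: aux IH1 LE Ea st.
(* Since [2 * L <= Ca < a t.+1], at least half of [a t.+1] remains in [a t.+1 - L]; with [E t]
   factored as a difference of squares, half of the growth of [a] survives the quadratic term. *)
have half : (a t.+1 - a t) / 2 <= E t / a t.+1 - L * E t / a t.+1 ^+ 2.
  have -> : E t / a t.+1 - L * E t / a t.+1 ^+ 2 =
      E t * (a t.+1 - L) / a t.+1 ^+ 2 by field; exact: lt0r_neq0.
  have EE : E t = (a t.+1 - a t) * (a t.+1 + a t) by rewrite -subr_sqr E2 addrC addKr.
  rewrite ler_pdivlMr ?exprn_gt0// EE -!mulrA ler_wpM2l ?subr_ge0//.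
  have aL : a t.+1 / 2 <= a t.+1 - L by move: gt Ca2; lra.
  rewrite mulrC ler_pdivrMr// expr2.
  apply: (@le_trans _ _ (a t.+1 * (a t.+1 / 2) * 2)).
    by rewrite -mulrA divfK// pnatr_eq0.
  rewrite ler_wpM2r// ler_pM ?divr_ge0 ?(ltW p1)//.
  by rewrite lerDl ltW.
(* If the threshold is crossed at this very step, the bound of the first regime is weakened to the
   form of the second. *)
have mid : S t + (a t - Ca) / 2 <= 2 * (F 0%N - F t) + t%:R * delta + L * Ca ^+ 2 / A0 ^+ 2.
  have [le|gt'] := leP (a t) Ca; last exact: IH2.
  have {}IH1 := IH1 le.
  have LE : L * (a t ^+ 2 - A0 ^+ 2) / A0 ^+ 2 <= L * Ca ^+ 2 / A0 ^+ 2.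
    rewrite ler_wpM2r ?invr_ge0 ?(ltW A2)// ler_wpM2l ?(ltW L0)//.
    rewrite (le_trans (y := a t ^+ 2)) ?gerBl ?(ltW A2)//.
    by rewrite ler_pXn2r ?nnegrE ?(ltW p0)// (le_trans (ltW p0)).
  have neg : (a t - Ca) / 2 <= 0 by rewrite pmulr_lle0 ?subr_le0// invr_gt0.
  have aux (s f d q1 q2 e : R) : s <= f + d + q1 -> q1 <= q2 -> e <= 0 ->
      s + e <= f + d + q2 by lra.
  exact: aux IH1 LE neg.
have -> : (a t.+1 - Ca) / 2 = (a t.+1 - a t) / 2 + (a t - Ca) / 2.
  by rewrite -mulrDl addrA subrK.
have aux (s x f0 f1 f2 d nd q1 q2 k1 k2 e : R) : s + k2 <= 2 * (f0 - f1) + nd + q1 ->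
    k1 <= e - q2 -> x + e <= 2 * (f1 - f2) + q2 + d ->
    s + x + (k1 + k2) <= 2 * (f0 - f2) + (nd + d) + q1 by lra.
exact: aux mid half st.
Qed.

Let B := 2 * (F 0%N - Fst) + L * Ca ^+ 2 / A0 ^+ 2 + T%:R * delta.

(** As [a] is nondecreasing, the plain sum is at most [a T] times the weighted one; the potential
    bounds the weighted sum by [B] and [a T] by [Ca + 2 * B]. *)
Lemma adagrad_sum :
  \sum_(t < T) G t <= B * (Ca + 2 * B).
Proof.
have A2 : 0 < A0 ^+ 2 by rewrite exprn_gt0.
have CaA : A0 <= Ca by rewrite le_max lexx orbT.
have Ca0 : 0 < Ca by exact: lt_le_trans CaA.
have [H1 H2] := adagrad_potential (leqnn T).
have S0 : 0 <= S T.
  by apply: sumr_ge0 => k _; rewrite divr_ge0// ltW// stepsize_gt0.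
have aT := stepsize_gt0 (leqnn T).
have [SB aB] : S T <= B /\ a T <= Ca + 2 * B.
  have [le|gt] := leP (a T) Ca.
    have {}H1 := H1 le.
    have LE : L * (a T ^+ 2 - A0 ^+ 2) / A0 ^+ 2 <= L * Ca ^+ 2 / A0 ^+ 2.
      rewrite ler_wpM2r ?invr_ge0 ?(ltW A2)// ler_wpM2l ?(ltW L0)//.
      rewrite (le_trans (y := a T ^+ 2)) ?gerBl ?(ltW A2)//.
      by rewrite ler_pXn2r ?nnegrE ?(ltW aT)// (le_trans (ltW aT)).
    have SB : S T <= B.
      have aux (s f0 f1 f2 nd q1 q2 : R) : s <= 2 * (f0 - f1) + nd + q1 -> q1 <= q2 ->
        f2 <= f1 -> s <= 2 * (f0 - f2) + q2 + nd by lra.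
      exact: aux H1 LE FT.
    have aux (s x k b : R) : s <= b -> x <= k -> 0 <= s -> x <= k + 2 * b by lra.
    by split=> //; exact: aux SB le S0.
  have {}H2 := H2 gt.
  have SB : S T + (a T - Ca) / 2 <= B.
    have aux (s f0 f1 f2 nd q : R) : s <= 2 * (f0 - f1) + nd + q ->
      f2 <= f1 -> s <= 2 * (f0 - f2) + q + nd by lra.
    exact: aux H2 FT.
  have aux (s x k b : R) : s + (x - k) / 2 <= b -> k < x -> 0 <= s ->
      s <= b /\ x <= k + 2 * b by split; lra.
  exact: aux SB gt S0.
apply: (@le_trans _ _ (S T * a T)).
  rewrite /S mulr_suml; apply: ler_sum => k _.
  have pk := stepsize_gt0 (ltn_ord k); rewrite mulrAC ler_pdivlMr// ler_wpM2l//.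
  have mono j : (k.+1 + j <= T)%N -> a k.+1 <= a (k.+1 + j)%N.
    elim: j => [|j IH]; first by rewrite addn0.
    by rewrite addnS => jT; exact: le_trans (IH (ltnW jT)) (stepsize_le jT).
  by have := mono (T - k.+1)%N; rewrite subnKC// => /(_ (leqnn T)).
by rewrite ler_pM// ltW.
Qed.

End AdaGrad.

(** * One step of the algorithm and the final bound *)

Lemma tnorm_sqrB (R : realType) (n : nat) (M : riemannianManifold R n) (z : M) v w :
  tnorm z (v - w) ^+ 2 = tnorm z v ^+ 2 - 2 * inner z v w + tnorm z w ^+ 2.
Proof.
rewrite !tnorm_sqr innerBl !innerBr (innerC z w v).
have aux (a b c : R) : a - b - (b - c) = a - 2 * b + c by ring.
exact: aux.
Qed.

Lemma inner_scaleNr (R : realType) (n : nat) (M : riemannianManifold R n) (z : M) v w k :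
  inner z v (- k *: w) = - (k * inner z v w).
Proof. by rewrite innerC innerZl mulNr (innerC z w v). Qed.

Lemma tnorm_sqr_scaleN (R : realType) (n : nat) (M : riemannianManifold R n) (z : M) w k :
  tnorm z (- k *: w) ^+ 2 = k ^+ 2 * tnorm z w ^+ 2.
Proof. by rewrite tnormZ exprMn real_normK ?num_real// sqrrN. Qed.

(** [G], [E] and [P] stand for |G F|^2, |ghat|^2 and <G F, ghat>, so that [G - 2 * P + E] is the
    squared error of [ghat]; [p] and [q] are the linear and quadratic terms of the step in the
    descent inequality. *)
Lemma adagrad_step (R : realFieldType) (G E a a0 d P p q L f0 f1 : R) :
  0 < a -> a^-1 <= a0^-1 -> 0 <= d -> G - 2 * P + E <= d ->
  p = - (a^-1 * P) -> q = a^-1 ^+ 2 * E -> f1 <= f0 + p + L / 2 * q ->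
  G / a + E / a <= 2 * (f0 - f1) + L * E / a ^+ 2 + d / a0.
Proof.
move=> a_gt0 ij d_ge0 H1 -> ->; rewrite -exprVn.
have: 0 <= a^-1 by rewrite invr_ge0 ltW.
move: a^-1 a0^-1 ij => i j ij i_ge0 H2.
have H3 : i * (G - 2 * P + E) <= d * j.
  by rewrite mulrC; apply: (le_trans (ler_wpM2r i_ge0 H1)); rewrite ler_wpM2l.
have -> : G * i + E * i = i * (G - 2 * P + E) + 2 * (i * P) by ring.
have -> : L * E * i ^+ 2 = 2 * (L / 2 * (i ^+ 2 * E)) by field.
have aux (u w r k : R) : f1 <= f0 - w + r -> u <= k ->
  u + 2 * w <= 2 * (f0 - f1) + 2 * r + k by lra.
exact: aux H2 H3.
Qed.

Theorem theorem3p1 (R : realType) (m n : nat)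
    (Mx : riemannianManifold R m) (My : riemannianManifold R n)
    (tau : R) (htau : tau < 0)
    (hMx : geodesically_complete Mx)
    (hMy : hadamard My) (hMytau : curvature_ge My tau)
    (Ux : set Mx) (Uy : set My)
    (hUx : geodesically_convex Ux) (hUy : geodesically_convex Uy)
    (hUyreg : Uy `<=` closure (interior Uy))
    (f g : Mx -> My -> R) (ystar : Mx -> My)
    (hystar : forall x y, g x (ystar x) <= g x y)
    (hystarU : forall x, Ux x -> Uy (ystar x))
    (mu lf Lf Lg rho : R)
    (hmu : 0 < mu) (hlf : 0 < lf) (hLf : 0 < Lf) (hLg : 0 < Lg)
    (hrho : 0 < rho)
    (hfC1 : Ck_on 1 f Ux Uy) (hgC2 : Ck_on 2 g Ux Uy)
    (hgconv : forall x, Ux x -> geodesically_strongly_convex mu Uy (g x))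
    (hflip : lipschitz_fun lf f Ux Uy)
    (hfgrad : lipschitz_gradients Lf f Ux Uy)
    (hggrad : lipschitz_gradients Lg g Ux Uy)
    (hghess : lipschitz_hessy rho g Ux Uy)
    (hgxy : lipschitz_crossxy rho g Ux Uy)
    (hgyx : lipschitz_crossyx rho g Ux Uy)
    (Fstar : R)
    (hFbounded : has_lbound (range (upper_objective f ystar)))
    (hFstar : Fstar = inf (range (upper_objective f ystar)))
    (var : variant)
    (x0 : Mx) (y0 : My) (v0 : 'rV[R]_n) (a0 b0 c0 : R)
    (ha0 : 0 < a0) (hb0 : 0 < b0) (hc0 : 0 < c0)
    (T : nat) (hT : (1 <= T)%N)
    (x : nat -> Mx) (a : nat -> R)
    (K : nat -> nat) (y : nat -> nat -> My) (b : nat -> nat -> R)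
    (N : nat -> nat) (v : nat -> nat -> 'rV[R]_n) (c : nat -> nat -> R)
    (hrun : adarhd_run f g var x0 y0 v0 a0 b0 c0 T x a K y b N v c)
    (hregion : run_in_region f g Ux Uy T x a K y b N v)
    (zet : R)
    (hzeta : forall t k, (t < T)%N -> (k <= K t)%N ->
       zeta tau (dist (y t k) (ystar (x t))) <= zet) :
  (T%:R)^-1 * \sum_(t < T) tnorm (x t) (hypergradient f g ystar (x t)) ^+ 2
  <= const_C mu lf Lf Lg rho a0 (upper_objective f ystar x0 - Fstar) / T%:R.
Proof.
have [hMyc _ _] := hMy; have T0 : 0 < T%:R :> R by rewrite ltr0n.
pose F t := upper_objective f ystar (x t).
pose GF t := hypergradient f g ystar (x t).
pose ap t := approx_hypergradient f g (x t) (y t (K t)) (v t (N t)).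
pose E t := tnorm (x t) (ap t) ^+ 2; pose G t := tnorm (x t) (GF t) ^+ 2.
have G0 t : 0 <= G t by exact: sqr_ge0.
have E0 t : 0 <= E t by exact: sqr_ge0.
have aE t : (t < T)%N -> a t.+1 = Num.sqrt (a t ^+ 2 + E t) by exact: (run_a hrun).
have a00 : 0 < a 0%N by rewrite (run_a0 hrun).
pose L := const_LF mu lf Lf Lg rho; pose Lb := const_Lbar mu lf Lf Lg rho.
have L0 : 0 < L.
  rewrite /L /const_LF mulr_gt0 ?exprn_gt0//; first by rewrite addr_gt0 ?divr_gt0 ?mulr_gt0.
  by rewrite addr_gt0 ?divr_gt0.
pose delta0 := 2 * Lb ^+ 2 / mu ^+ 2 * T%:R^-1.
have d00 : 0 <= delta0.
  by rewrite /delta0 mulr_ge0 ?invr_ge0 ?ler0n// divr_ge0 ?sqr_ge0// mulr_ge0 ?sqr_ge0.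
have Ux_x t : (t <= T)%N -> Ux (x t) by exact: (region_x hregion).
have err t : (t < T)%N -> tnorm (x t) (GF t - ap t) ^+ 2 <= delta0.
  move=> tT; have Uy_y : Uy (y t (K t)) by exact: (region_y hregion tT (leqnn _)).
  have [_ ey] := lower_exit (run_y hrun tT).
  have ev : tnorm (y t (K t)) (gradR f g (x t) (y t (K t)) (v t (N t))) ^+ 2 <= T%:R^-1.
    (* Both variants leave their loop under the same stopping criterion. *)
    have := run_v hrun tT; case: (var) => /= [[_ _ _ _ []]|[_ []]] //.
  exact: (approx_error hMyc hUy hUyreg hystar hystarU hmu hlf hLf hLg hrho hfC1 hgC2
    hgconv hflip hfgrad hggrad hghess hgxy (Ux_x t (ltnW tT)) Uy_y ey ev).
have step t : (t < T)%N -> G t / a t.+1 + E t / a t.+1 <=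
    2 * (F t - F t.+1) + L * E t / a t.+1 ^+ 2 + delta0 / a 0%N.
  move=> tT; have i0 : 0 < a t.+1 := stepsize_gt0 a00 E0 aE tT.
  have ia : (a t.+1)^-1 <= (a 0%N)^-1.
    by rewrite lef_pV2 ?posrE//; exact: stepsize_ge0 aE _ tT.
  have H := upper_step hMyc hUx hUy hUyreg hystar hystarU hmu hlf hLf hLg hrho hfC1 hgC2
    hgconv hflip hfgrad hggrad hghess hgxy hMx (region_x_step hregion tT).
  have {}H : F t.+1 <= F t + inner (x t) (GF t) (- (a t.+1)^-1 *: ap t) +
      L / 2 * tnorm (x t) (- (a t.+1)^-1 *: ap t) ^+ 2.
    by rewrite /F (run_x hrun tT); exact: H.
  have D : G t - 2 * inner (x t) (GF t) (ap t) + E t <= delta0.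
    exact: (eq_ind _ (fun z => z <= delta0) (err t tT) _ (tnorm_sqrB _ (GF t) (ap t))).
  exact: (adagrad_step i0 ia d00 D (inner_scaleNr _ (GF t) (ap t) _)
    (tnorm_sqr_scaleN _ (ap t) _) H).
have FT : Fstar <= F T by rewrite hFstar; apply: ge_inf => //; exists (x T).
rewrite mulrC ler_pM2r ?invr_gt0//.
have := adagrad_sum L0 a00 G0 E0 aE step FT.
rewrite /F (run_x0 hrun) (run_a0 hrun) /const_C /const_F0 /const_Ca -/L -/Lb.
(* The [T] errors, each a multiple of [1 / T], add up to a constant independent of [T]. *)
suff -> : T%:R * (delta0 / a0) = 2 * Lb ^+ 2 / (a0 * mu ^+ 2) by [].
by rewrite /delta0; field; rewrite !lt0r_neq0.
Qed.
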